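(* Suppose that $(Y(t))_{t\in\mathbb{R}^2}$ is a causal CARMA$(p,q)$ (resp. causal GCARMA) random field on the plane $\mathbb{R}^2$ such that $\Lambda$ has a finite second moment, both $A_1$ and $A_2$ have distinct eigenvalues, and the kernel $g(s)=b^\top e^{A_1s_1}e^{A_2s_2}c\,1_{\{s\ge0\}}$ is given by $$g(s)=\sum_{i_1,i_2=1}^p d(i_1,i_2)e^{\lambda_1(i_1)s_1}e^{\lambda_2(i_2)s_2}1_{\{s\ge0\}},\quad s\in\mathbb{R}^2,$$ where $(\lambda_n(i_n))_{1\le i_n\le p}$ is an enumeration of the distinct eigenvalues of $A_n$ for $n=1,2$ and $d(i_1,i_2)\in\mathbb{C}$. Then the autocovariance function of $Y$ is $$\gamma(t)=\kappa_2\sum_{i_1,i_2=1}^p\left(\sum_{j_1,j_2=1}^p\frac{d(i_1,i_2)d(j_1,j_2)}{(\lambda_1(j_1)+\lambda_1(i_1))(\lambda_2(j_2)+\lambda_2(i_2))}\right)e^{\lambda_1(i_1)|t_1|}e^{\lambda_2(i_2)|t_2|}\quad\text{if }t_1t_2\ge0,$$ and $$\gamma(t)=\kappa_2\sum_{i_1,i_2=1}^p\left(\sum_{j_1,j_2=1}^p\frac{d(i_1,j_2)d(j_1,i_2)}{(\lambda_1(j_1)+\lambda_1(i_1))(\lambda_2(j_2)+\lambda_2(i_2))}\right)e^{\lambda_1(i_1)|t_1|}e^{\lambda_2(i_2)|t_2|}\quad\text{if }t_1t_2<0.$$ In particular, the representation $\gamma(t)=\kappa_2\sum_{i_1,i_2=1}^pd_v(\lambda_1(i_1),\lambda_2(i_2))e^{\lambda_1(i_1)|t_1|}e^{\lambda_2(i_2)|t_2|}$,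 valid for $v\in\{-1,1\}^2$ and $t\in\mathbb{R}^2$ with $v_1t_1\ge0$, $v_2t_2\ge0$, holds with the coefficients $$d_{(1,1)}(\lambda_1(i_1),\lambda_2(i_2))=d_{(-1,-1)}(\lambda_1(i_1),\lambda_2(i_2))=\sum_{j_1,j_2=1}^p\frac{d(i_1,i_2)d(j_1,j_2)}{(\lambda_1(j_1)+\lambda_1(i_1))(\lambda_2(j_2)+\lambda_2(i_2))},$$ $$d_{(1,-1)}(\lambda_1(i_1),\lambda_2(i_2))=d_{(-1,1)}(\lambda_1(i_1),\lambda_2(i_2))=\sum_{j_1,j_2=1}^p\frac{d(i_1,j_2)d(j_1,i_2)}{(\lambda_1(j_1)+\lambda_1(i_1))(\lambda_2(j_2)+\lambda_2(i_2))}$$ for all $i_1,i_2=1,\dots,p$.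
   Context: Lévy bases. On a fixed complete probability space, a homogeneous Lévy basis $\Lambda$ on $\mathbb{R}^2$ with characteristics $(\beta,\sigma^2,\nu)$ ($\beta\in\mathbb{R}$, $\sigma\ge0$, $\nu$ a Lévy measure on $\mathbb{R}$) is the family indexed by bounded Borel sets $A\subset\mathbb{R}^2$, $$\Lambda(A)=\beta\,\mathrm{Leb}(A)+\sigma W(A)+\int_{\mathbb{R}^2}\int_{\mathbb{R}}1_A(s)z1_{\{|z|\le1\}}(\mathfrak p-\mathfrak q)(ds,dz)+\int_{\mathbb{R}^2}\int_{\mathbb{R}}1_A(s)z1_{\{|z|>1\}}\mathfrak p(ds,dz),$$ where $W$ is Gaussian white noise with $\mathrm{Var}(W(A))=\mathrm{Leb}(A)$ and $\mathfrak p$ is a Poisson random measure on $\mathbb{R}^2\times\mathbb{R}$ with intensity $\mathfrak q=\mathrm{Leb}\otimes\nu$, independent of $W$. $\Lambda$ has a finite second moment if $\int_{\mathbb{R}}z^2\nu(dz)<\infty$, with variance $\kappa_2:=\sigma^2+\int_{\mathbb{R}}z^2\nu(dz)$. Integrals of deterministic functions with respect to $\Lambda$ are Rajput–Rosiński integrals, taken componentwise for vector-valued integrands. Companion matrix. The companion matrix of a monic polynomial $a(z)=z^p+\alpha_1z^{p-1}+\dots+\alpha_p$ is the $p\times p$ matrix with ones on the superdiagonal, last row $(-\alpha_p,-\alpha_{p-1},\dots,-\alpha_1)$ and zeros elsewhere (for $p=1$: $(-\alpha_1)$). GCARMA. Let $p\ge1$, $b,c\in\mathbb{R}^p$, $A_1,A_2\in\mathbb{R}^{p\times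 p}$ with all eigenvalues having strictly negative real parts, and $\Lambda$ a homogeneous Lévy basis on $\mathbb{R}^2$ with $\int_{\mathbb{R}}\log(|z|)^21_{\{|z|>1\}}\nu(dz)<\infty$. $(Y(t))_{t\in\mathbb{R}^2}$ is a causal GCARMA random field if $$Y(t)=b^\top X(t),\quad X(t)=\int_{-\infty}^{t_1}\int_{-\infty}^{t_2}e^{A_1(t_1-s_1)}e^{A_2(t_2-s_2)}c\,\Lambda(ds),\quad t\in\mathbb{R}^2;$$ equivalently $Y(t)=\int_{\mathbb{R}^2}g(t-s)\Lambda(ds)$ with $g$ as in the claim. CARMA. For integers $0\le q<p$, $Y$ is a causal CARMA$(p,q)$ random field if it is given by the same equations where $b=(b_0,\dots,b_{p-1})^\top$ with $b_q\ne0$ and $b_i=0$ for $i>q$, $c=(0,\dots,0,1)^\top$, $A_i$ is the companion matrix of a real monic polynomial $a_i$ of degree $p$ whose roots have strictly negative real parts, and $\Lambda$ satisfies the same log-moment condition. Notation: $s\ge0$ is componentwise; $\gamma(t)=\mathrm{Cov}[Y(r+t),Y(r)]$ (independent of $r$). *)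

(* Defs.v *)
From HB Require Import structures.
From mathcomp Require Import all_boot all_order all_algebra.
From mathcomp Require Import complex.
From mathcomp Require Import all_classical all_reals all_analysis.
From mathcomp Require Import measurable_realfun.

Set Implicit Arguments.
Unset Strict Implicit.
Unset Printing Implicit Defensive.

Import Order.TTheory GRing.Theory Num.Theory.
Import numFieldNormedType.Exports.

Local Open Scope classical_set_scope.
Local Open Scope ring_scope.
Local Open Scope complex_scope.

Definition expmx (R : realType) (p : nat) (A : 'M[R]_p) : 'M[R]_p :=
  \matrix_(i, j) limn (series (fun k => (A ^+ k) i j / k`!%:R)).

Definition complex_eigenvalue (R : realType) (p : nat) (A : 'M[R]_p)
    (z : R[i]) : bool :=
  eigenvalue (map_mx (real_complex R) A) z.

(* The index type 'I_p forces A to have p distinct eigenvalues. *)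
Definition enum_distinct_eigenvalues (R : realType) (p : nat) (A : 'M[R]_p)
    (lambda : 'I_p -> R[i]) : Prop :=
  injective lambda /\
  forall z, complex_eigenvalue A z <-> exists i, lambda i = z.

(* [companionmx a] has dimension [(size a).-1], the degree of [a], and last row
   [(- a`_0, ..., - a`_p.-1)]. *)
Definition is_companion (R : realType) (p : nat) (a : {poly R})
    (A : 'M[R]_p) : Prop :=
  a \is monic /\
  exists e : (size a).-1 = p, A = castmx (e, e) (companionmx a).

Definition expC (R : realType) (z : R[i]) : R[i] :=
  (expR (complex.Re z) * cos (complex.Im z)) +i*
  (expR (complex.Re z) * sin (complex.Im z)).

Definition Leb2 (R : realType) : set (R * R) -> \bar R :=
  (@lebesgue_measure R \x @lebesgue_measure R)%E.

Definition bounded_Borel (R : realType) (A : set (R * R)) : Prop :=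
  measurable A /\ bounded_set A.

Definition levy_measure (R : realType) (nu : {measure set R -> \bar R}) : Prop :=
  nu [set 0] = 0%E /\ (\int[nu]_z (Num.min 1 (z ^+ 2))%:E < +oo)%E.

Section RandomMeasures.
Import HBSimple.
Context (d : measure_display) (Omega : measurableType d) (R : realType).
Variable P : probability Omega R.

Definition cvg_in_probability (X_ : nat -> Omega -> R) (X : Omega -> R) : Prop :=
  forall e : R, 0 < e ->
    P [set w | e <= `|X_ n w - X w|] @[n --> \oo] --> (0 : \bar R).

Definition cvg_in_mean_square (X_ : nat -> Omega -> R) (X : Omega -> R) : Prop :=
  ('E_P[fun w => ((X_ n w - X w) ^+ 2)%R])%E @[n --> \oo] --> (0 : \bar R).

(* [normal_prob m 0] is not the Dirac mass at m, hence the separate case. *)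
Definition has_normal_law (X : Omega -> R) (m v : R) : Prop :=
  (v = 0 /\ {ae P, forall w, X w = m}) \/
  (0 < v /\ forall B : set R, measurable B ->
    P (X @^-1` B) = normal_prob m (Num.sqrt v) B).

(* Centred Gaussian process with Cov(W(A), W(B)) = Leb(A `&` B). *)
Definition gaussian_white_noise (W : set (R * R) -> {RV P >-> R}) : Prop :=
  forall (n : nat) (A : 'I_n -> set (R * R)) (x : 'I_n -> R),
    (forall i, bounded_Borel (A i)) ->
    has_normal_law (fun w => \sum_(i < n) x i * W (A i) w) 0
      (\sum_(i < n) \sum_(j < n) x i * x j * fine (Leb2 (A i `&` A j))).

(* The Poisson weights are written out because [poisson_pmf 0] is not the
   Dirac mass at 0. *)
Definition poisson_random_measure (d' : measure_display)
    (E : measurableType d') (q : set E -> \bar R) (N : R.-ker Omega ~> E) :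
    Prop :=
  [/\ forall B, measurable B -> (q B < +oo)%E -> forall k : nat,
        P [set w | N w B = k%:R%:E] =
        (fine (q B) ^+ k / k`!%:R * expR (- fine (q B)))%:E,
      forall B, measurable B -> q B = +oo%E ->
        {ae P, forall w, N w B = +oo%E} &
      forall (n : nat) (B : 'I_n -> set E) (C : 'I_n -> set (\bar R)),
        (forall i, measurable (B i)) -> trivIset setT B ->
        (forall i, measurable (C i)) ->
        P (\bigcap_i [set w | C i (N w (B i))]) =
        (\prod_(i < n) P [set w | C i (N w (B i))])%E].

Definition independent_sigma_algebras (G H : set (set Omega)) : Prop :=
  forall A B, <<s G >> A -> <<s H >> B -> P (A `&` B) = (P A * P B)%E.

Definition events_of_noise (W : set (R * R) -> {RV P >-> R}) :
    set (set Omega) :=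
  [set F | exists A (B : set R),
    [/\ bounded_Borel A, measurable B & F = W A @^-1` B]].

Definition events_of_random_measure (d' : measure_display)
    (E : measurableType d') (N : R.-ker Omega ~> E) : set (set Omega) :=
  [set F | exists A (B : set (\bar R)),
    [/\ measurable A, measurable B & F = [set w | B (N w A)]]].

(* For h square integrable with respect to q, Z is (a version of) the integral
   of h against N - q, the mean-square limit of the integrals over the sets
   {|z| > 1/(n+1)}, which carry finite q-mass on bounded sets of space. *)
Definition is_compensated_integral (q : set (R * R * R) -> \bar R)
    (N : R.-ker Omega ~> (R * R * R)%type) (h : R * R * R -> R)
    (Z : Omega -> R) : Prop :=
  cvg_in_mean_square
    (fun n w =>
       fine (\int[N w]_(x in [set x | (n.+1%:R^-1 < `|x.2|)%R]) (h x)%:E)%E -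
       fine (\int[q]_(x in [set x | (n.+1%:R^-1 < `|x.2|)%R]) (h x)%:E)%E)
    Z.

(* [Lambda] and the white noise are only meaningful on bounded Borel sets. *)
Definition homogeneous_levy_basis (beta sigma : R)
    (nu : {measure set R -> \bar R}) (Lambda : set (R * R) -> {RV P >-> R}) :
    Prop :=
  [/\ 0 <= sigma, levy_measure nu &
  exists (W : set (R * R) -> {RV P >-> R})
         (N : R.-ker Omega ~> (R * R * R)%type),
    [/\ gaussian_white_noise W,
        poisson_random_measure (@Leb2 R \x nu)%E N,
        independent_sigma_algebras
          (events_of_noise W) (events_of_random_measure N) &
        forall A, bounded_Borel A ->
        exists2 Z : {RV P >-> R},
          is_compensated_integral (@Leb2 R \x nu)%E N
            (fun x => \1_A x.1 * x.2 * \1_[set z | `|z| <= 1] x.2) Z &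
          {ae P, forall w,
            Lambda A w = beta * fine (Leb2 A) + sigma * W A w + Z w +
              fine (\int[N w]_x
                (\1_A x.1 * x.2 * \1_[set z | 1 < `|z|] x.2)%:E)%E}]].

Definition finite_second_moment (nu : {measure set R -> \bar R}) : Prop :=
  (\int[nu]_z (z ^+ 2)%:E < +oo)%E.

Definition kappa2 (sigma : R) (nu : {measure set R -> \bar R}) : R :=
  sigma ^+ 2 + fine (\int[nu]_z (z ^+ 2)%:E)%E.

Definition log_moment (nu : {measure set R -> \bar R}) : Prop :=
  (\int[nu]_z (ln `|z| ^+ 2 * \1_[set z | 1 < `|z|] z)%:E < +oo)%E.

Definition bounded_support (f : R * R -> R) : Prop :=
  bounded_set [set s | f s != 0].

(* The term x = 0 vanishes, so only the values of Lambda on bounded sets matter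
   when f has bounded support. *)
Definition simple_levy_integral (Lambda : set (R * R) -> {RV P >-> R})
    (f : {sfun (R * R)%type >-> R}) (A : set (R * R)) : Omega -> R :=
  fun w => \sum_(x \in range f) x * Lambda (A `&` f @^-1` [set x]) w.

(* The integral of Rajput and Rosinski. Almost everywhere convergence is with
   respect to Lebesgue measure, because the control measure of a homogeneous
   Levy basis is a multiple of it. *)
Definition is_levy_integral (Lambda : set (R * R) -> {RV P >-> R})
    (f : R * R -> R) (X : {RV P >-> R}) : Prop :=
  measurable_fun setT f /\
  exists f_ : nat -> {sfun (R * R)%type >-> R},
    [/\ forall n, bounded_support (f_ n),
        {ae @Leb2 R, forall s, f_ n s @[n --> \oo] --> f s},
        forall A, measurable A -> exists Z : {RV P >-> R},
          cvg_in_probability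
            (fun n => simple_levy_integral Lambda (f_ n) A) Z &
        cvg_in_probability
          (fun n => simple_levy_integral Lambda (f_ n) setT) X].

Definition state_kernel (p : nat) (A1 A2 : 'M[R]_p) (c : 'cV[R]_p)
    (s : R * R) : 'cV[R]_p :=
  if (0 <= s.1) && (0 <= s.2)
  then expmx (s.1 *: A1) *m expmx (s.2 *: A2) *m c else 0.

Definition kernel_g (p : nat) (A1 A2 : 'M[R]_p) (b c : 'cV[R]_p)
    (s : R * R) : R :=
  (b^T *m state_kernel A1 A2 c s) 0 0.

Definition carma_equations (p : nat) (A1 A2 : 'M[R]_p) (b c : 'cV[R]_p)
    (Lambda : set (R * R) -> {RV P >-> R}) (Y : R * R -> {RV P >-> R}) : Prop :=
  exists X : R * R -> 'I_p -> {RV P >-> R},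
    (forall t i, is_levy_integral Lambda
       (fun s => state_kernel A1 A2 c (t.1 - s.1, t.2 - s.2) i 0) (X t i)) /\
    (forall t, {ae P, forall w, Y t w = \sum_(i < p) b i 0 * X t i w}).

Definition causal_gcarma (p : nat) (A1 A2 : 'M[R]_p) (b c : 'cV[R]_p)
    (beta sigma : R) (nu : {measure set R -> \bar R})
    (Lambda : set (R * R) -> {RV P >-> R}) (Y : R * R -> {RV P >-> R}) : Prop :=
  [/\ (0 < p)%N,
      forall z, complex_eigenvalue A1 z \/ complex_eigenvalue A2 z ->
        complex.Re z < 0,
      homogeneous_levy_basis beta sigma nu Lambda,
      log_moment nu &
      carma_equations A1 A2 b c Lambda Y].

Definition roots_in_left_half_plane (a : {poly R}) : Prop :=
  forall z : R[i], root (map_poly (real_complex R) a) z -> complex.Re z < 0.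

Definition causal_carma (p q : nat) (A1 A2 : 'M[R]_p) (b c : 'cV[R]_p)
    (beta sigma : R) (nu : {measure set R -> \bar R})
    (Lambda : set (R * R) -> {RV P >-> R}) (Y : R * R -> {RV P >-> R}) : Prop :=
  [/\ (q < p)%N,
      (forall i : 'I_p, i = q :> nat -> b i 0 != 0) /\
      (forall i : 'I_p, (q < i)%N -> b i 0 = 0),
      c = \col_(i < p) (i.+1 == p)%:R,
      (exists a1 a2 : {poly R},
        [/\ is_companion a1 A1, is_companion a2 A2,
            roots_in_left_half_plane a1 & roots_in_left_half_plane a2]) &
      [/\ homogeneous_levy_basis beta sigma nu Lambda,
          log_moment nu &
          carma_equations A1 A2 b c Lambda Y]].

Definition is_autocovariance (Y : R * R -> {RV P >-> R}) (gamma : R * R -> R) :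
    Prop :=
  (forall t, (Y t : Omega -> R) \in Lfun P 2%:E) /\
  (forall r t, covariance P (Y (r.1 + t.1, r.2 + t.2)) (Y r) = (gamma t)%:E).

End RandomMeasures.

Definition coef_same (R : realType) (p : nat) (d : 'I_p -> 'I_p -> R[i])
    (lambda1 lambda2 : 'I_p -> R[i]) (i1 i2 : 'I_p) : R[i] :=
  \sum_(j1 < p) \sum_(j2 < p) d i1 i2 * d j1 j2 /
    ((lambda1 j1 + lambda1 i1) * (lambda2 j2 + lambda2 i2)).

Definition coef_opposite (R : realType) (p : nat) (d : 'I_p -> 'I_p -> R[i])
    (lambda1 lambda2 : 'I_p -> R[i]) (i1 i2 : 'I_p) : R[i] :=
  \sum_(j1 < p) \sum_(j2 < p) d i1 j2 * d j1 i2 /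
    ((lambda1 j1 + lambda1 i1) * (lambda2 j2 + lambda2 i2)).

(* Main.v *)
(* On bounded sets, the compensated and uncompensated jump parts of Lambda are mean-square
   limits of Poisson integrals, whose moments come from those of the Poisson law, and the
   Gaussian part is handled by polarization.  This gives E Lambda(A) = m Leb A and
     E Lambda(A) Lambda(B) = kappa2 Leb(A n B) + m^2 Leb A Leb B.
   The field Y_t is only known as a limit in probability of Lambda-integrals of some simple
   functions F_n with F_n -> g(t - .) almost everywhere, where moreover the integrals over
   every Borel set converge.  Comparing with simple functions h_n -> g(t - .) in L^1 and L^2,
   a gliding hump argument forces the integrals of F_n - h_n to tend to 0 in probability, so
   that Y_t is also the mean-square limit of the integrals of h_n, and
     Cov(Y_t, Y_r) = kappa2 * \int g(t - s) g(r - s) ds.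
   The last integral is a sum of products of one-dimensional integrals of
   e^{lambda (a - s)} e^{mu (b - s)} over s <= min a b; the sign of a - b decides which of the
   two exponentials survives, whence the two formulas. *)

Require Import Defs.
From HB Require Import structures.
From mathcomp Require Import all_boot all_order all_algebra finmap.
From mathcomp Require Import complex ring lra.
From mathcomp Require Import all_classical all_reals all_analysis.
From mathcomp Require Import measurable_realfun.

Set Implicit Arguments.
Unset Strict Implicit.
Unset Printing Implicit Defensive.

Import Order.TTheory GRing.Theory Num.Theory.
Import numFieldNormedType.Exports.

Local Open Scope classical_set_scope.
Local Open Scope ring_scope.

(** The definition of the field offers a single approximating sequence F_n that converges almost
    everywhere without domination, so that mass of F_n - g(t - .) could concentrate or escape; the
    convergence of the integrals over every Borel set is what excludes this. Upper bounds suffice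
    for it: the second moment of a [Lambda]-sum is controlled by the integral of z^2 + |z| along its
    kernel, where |z| pays for the mean m, and Chebyshev's inequality turns this into a bound on
    tails. The obstacle to the moments of [Lambda] is that infinitely many small jumps may occur.
    With the jumps |z| <= 1/(n+1) removed, the remaining small jumps and the large ones form one
    Poisson integral with explicit moments; the compensator goes into a constant, which leaves the
    mean m = beta + int_{|z|>1} z nu(dz) for every n. The eigenvalues may be complex whereas g is
    real: g(t - .) g(r - .) is expanded bilinearly, without conjugates, whence the denominators
    lambda + mu. The integrability of g(t - .) is read off the same expansion, not off bounds on
    matrix exponentials. *)

Section L2.

(** * Square-integrable functions and their inner product *)

Context d (T : measurableType d) (R : realType) (mu : {measure set T -> \bar R}).
Implicit Types (f g h : T -> R) (k : R).

Lemma Lfun2P f : f \in Lfun mu 2%:E <->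
  measurable_fun setT f /\ (\int[mu]_x (f x ^+ 2)%:E < +oo)%E.
Proof.
split=> [f2|[mf f2]].
  split; last exact/integrable_lty/Lfun2_integrable_sqr.
  by move: f2; rewrite inE => /andP[]; rewrite inE.
rewrite inE; apply/andP; split; rewrite inE//=.
rewrite /finite_norm unlock poweR_lty//.
apply: le_lt_trans f2; apply: ge0_le_integral => //.
- by move=> x _; rewrite lee_fin powR_ge0.
- apply/measurable_EFinP/(@measurableT_comp _ _ _ _ _ _ (fun x : R => x `^ 2)%R) => //.
  exact: measurableT_comp.
- by apply/measurable_EFinP; exact: measurable_funX.
- by move=> x _; rewrite lee_fin powR_mulrn// real_normK ?num_real.
Qed.

Lemma Lfun2_measurable f : f \in Lfun mu 2%:E -> measurable_fun setT f.
Proof. by move=> /Lfun2P[]. Qed.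

Lemma Lfun2D f g : f \in Lfun mu 2%:E -> g \in Lfun mu 2%:E ->
  (fun x => f x + g x) \in Lfun mu 2%:E.
Proof. by move=> f2 g2; rewrite [X in X \in _](_ : _ = f + g)// rpredD// lee1n. Qed.

Lemma Lfun2B f g : f \in Lfun mu 2%:E -> g \in Lfun mu 2%:E ->
  (fun x => f x - g x) \in Lfun mu 2%:E.
Proof. by move=> f2 g2; rewrite [X in X \in _](_ : _ = f - g)// rpredB// lee1n. Qed.

Lemma Lfun2Z k f : f \in Lfun mu 2%:E -> (fun x => k * f x) \in Lfun mu 2%:E.
Proof. by move=> f2; rewrite [X in X \in _](_ : _ = k *: f)// rpredZ// lee1n. Qed.

Lemma Lfun2_0 : (fun=> 0) \in Lfun mu 2%:E.
Proof. by rewrite [X in X \in _](_ : _ = 0)// rpred0// lee1n. Qed.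

Lemma Lfun2_sum (I : Type) (s : seq I) (F : I -> T -> R) :
  (forall i, F i \in Lfun mu 2%:E) -> (fun x => \sum_(i <- s) F i x) \in Lfun mu 2%:E.
Proof.
move=> F2; rewrite [X in X \in _](_ : _ = \sum_(i <- s) F i).
  by rewrite rpred_sum// lee1n.
by apply/funext => x; rewrite fct_sumE.
Qed.

Lemma Lfun2_integrableM f g : f \in Lfun mu 2%:E -> g \in Lfun mu 2%:E ->
  mu.-integrable setT (EFin \o (fun x => f x * g x)).
Proof. by move=> f2 g2; apply/Lfun1_integrable/(Lfun2_mul_Lfun1 f2 g2). Qed.

(** Real-valued, hence meaningful only for integrable products; this is why the rules of bilinearity
    below ask for membership in [Lfun mu 2%:E]. *)
Definition ip f g : R := \int[mu]_x (f x * g x).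

Lemma ipC f g : ip f g = ip g f.
Proof. by apply: eq_Rintegral => x _; rewrite mulrC. Qed.

Lemma ip_ge0 f : 0 <= ip f f.
Proof. by apply: Rintegral_ge0 => x _; rewrite -expr2 sqr_ge0. Qed.

Lemma ipDl f g h : f \in Lfun mu 2%:E -> g \in Lfun mu 2%:E -> h \in Lfun mu 2%:E ->
  ip (fun x => f x + g x) h = ip f h + ip g h.
Proof.
move=> f2 g2 h2; rewrite /ip -RintegralD//; [|exact: Lfun2_integrableM..].
by apply: eq_Rintegral => x _; rewrite mulrDl.
Qed.

Lemma ipZl k f h : f \in Lfun mu 2%:E -> h \in Lfun mu 2%:E ->
  ip (fun x => k * f x) h = k * ip f h.
Proof.
move=> f2 h2; rewrite /ip -RintegralZl//; last exact: Lfun2_integrableM.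
by apply: eq_Rintegral => x _; rewrite mulrA.
Qed.

Lemma ipBl f g h : f \in Lfun mu 2%:E -> g \in Lfun mu 2%:E -> h \in Lfun mu 2%:E ->
  ip (fun x => f x - g x) h = ip f h - ip g h.
Proof.
move=> f2 g2 h2; rewrite /ip -RintegralB//; [|exact: Lfun2_integrableM..].
by apply: eq_Rintegral => x _; rewrite mulrBl.
Qed.

Lemma ipDr f g h : f \in Lfun mu 2%:E -> g \in Lfun mu 2%:E -> h \in Lfun mu 2%:E ->
  ip h (fun x => f x + g x) = ip h f + ip h g.
Proof. by move=> f2 g2 h2; rewrite ipC ipDl// !(ipC _ h). Qed.

Lemma ipBr f g h : f \in Lfun mu 2%:E -> g \in Lfun mu 2%:E -> h \in Lfun mu 2%:E ->
  ip h (fun x => f x - g x) = ip h f - ip h g.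
Proof. by move=> f2 g2 h2; rewrite ipC ipBl// !(ipC _ h). Qed.

Lemma ipZr k f h : f \in Lfun mu 2%:E -> h \in Lfun mu 2%:E ->
  ip h (fun x => k * f x) = k * ip h f.
Proof. by move=> f2 h2; rewrite ipC ipZl// ipC. Qed.

Lemma ip_suml (I : Type) (s : seq I) (F : I -> T -> R) h :
  (forall i, F i \in Lfun mu 2%:E) -> h \in Lfun mu 2%:E ->
  ip (fun x => \sum_(i <- s) F i x) h = \sum_(i <- s) ip (F i) h.
Proof.
move=> F2 h2; elim: s => [|i s ih].
  rewrite big_nil /ip (_ : (fun x => _) = (fun=> 0)) ?Rintegral_cst// ?mul0r//.
  by apply/funext => x; rewrite big_nil mul0r.
rewrite big_cons -ih -ipDl//; last exact: Lfun2_sum.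
by congr ip; apply/funext => x; rewrite big_cons.
Qed.

Lemma ip_sqrB f g : f \in Lfun mu 2%:E -> g \in Lfun mu 2%:E ->
  ip (fun x => f x - g x) (fun x => f x - g x) = ip f f + ip g g - 2 * ip f g.
Proof.
move=> f2 g2; have fg := Lfun2B f2 g2.
by rewrite ipBl// !ipBr// (ipC g f); ring.
Qed.

Lemma ip_sqrD f g : f \in Lfun mu 2%:E -> g \in Lfun mu 2%:E ->
  ip (fun x => f x + g x) (fun x => f x + g x) = ip f f + ip g g + 2 * ip f g.
Proof.
move=> f2 g2; have fg := Lfun2D f2 g2.
by rewrite ipDl// !ipDr// (ipC g f); ring.
Qed.

Lemma integral_sqr_ip f : f \in Lfun mu 2%:E ->
  (\int[mu]_x (f x ^+ 2)%:E)%E = (ip f f)%:E.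
Proof.
move=> f2; rewrite /ip /Rintegral fineK; first by apply: eq_integral => x _; rewrite expr2.
exact/integrable_fin_num/Lfun2_integrableM.
Qed.

(** The quadratic polynomial k |-> |f - k g|^2 is nonnegative, hence its discriminant is not
    positive. *)
Lemma ip_CS f g : f \in Lfun mu 2%:E -> g \in Lfun mu 2%:E ->
  (ip f g) ^+ 2 <= ip f f * ip g g.
Proof.
move=> f2 g2.
have H k : 0 <= ip f f - 2 * k * ip f g + k ^+ 2 * ip g g.
  have kg2 := Lfun2Z k g2.
  have := ip_ge0 (fun x => f x - k * g x).
  rewrite ip_sqrB// ipZl// !ipZr//.
  by congr (_ <= _); ring.
have [g0|g0] := eqVneq (ip g g) 0.
  rewrite g0 mulr0; have [->|n0] := eqVneq (ip f g) 0; first by rewrite expr0n.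
  (* With [ip g g] = 0 the polynomial is affine in k, and this k gives it the value -1. *)
  have := H ((ip f f + 1) / (2 * ip f g)).
  by rewrite g0 mulr0 addr0 (_ : 2 * _ * _ = ip f f + 1); [lra|field].
have gp : 0 < ip g g by rewrite lt_neqAle eq_sym g0 ip_ge0.
have := H (ip f g / ip g g).
rewrite -(pmulr_lge0 _ gp) => h; rewrite -subr_ge0; apply: le_trans h _.
by rewrite le_eqVlt; apply/orP; left; apply/eqP; field.
Qed.

Lemma ip_norm_le f g : f \in Lfun mu 2%:E -> g \in Lfun mu 2%:E ->
  `|ip f g| <= Num.sqrt (ip f f) * Num.sqrt (ip g g).
Proof.
move=> f2 g2; rewrite -sqrtrM ?ip_ge0// -sqrtr_sqr ler_sqrt ?ip_CS//.
by rewrite mulr_ge0 ?ip_ge0.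
Qed.

Lemma ip_sqrD_le f g : f \in Lfun mu 2%:E -> g \in Lfun mu 2%:E ->
  ip (fun x => f x + g x) (fun x => f x + g x) <= 2 * ip f f + 2 * ip g g.
Proof.
move=> f2 g2; have := ip_ge0 (fun x => f x - g x).
by rewrite ip_sqrB// ip_sqrD//; lra.
Qed.

Lemma ip_cvgl (F : nat -> T -> R) f h :
  (forall n, F n \in Lfun mu 2%:E) -> f \in Lfun mu 2%:E -> h \in Lfun mu 2%:E ->
  ip (fun x => F n x - f x) (fun x => F n x - f x) @[n --> \oo] --> 0 ->
  ip (F n) h @[n --> \oo] --> ip f h.
Proof.
move=> F2 f2 h2 cv; apply/cvgrPdistC_lt => e e0.
have [h0|h0] := eqVneq (ip h h) 0.
  near=> n; have := ip_norm_le (Lfun2B (F2 n) f2) h2.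
  by rewrite h0 sqrtr0 mulr0 ipBl// => /le_lt_trans; apply.
have hp : 0 < ip h h by rewrite lt_neqAle eq_sym h0 ip_ge0.
have e1 : 0 < e ^+ 2 / ip h h by rewrite divr_gt0// exprn_gt0.
move/cvgrPdist_lt : cv => /(_ _ e1) cv.
near=> n; rewrite -ipBl//.
apply: (le_lt_trans (ip_norm_le (Lfun2B (F2 n) f2) h2)).
rewrite -sqrtrM ?ip_ge0// -[ltRHS]gtr0_norm// -sqrtr_sqr ltr_sqrt ?exprn_gt0//.
rewrite -ltr_pdivlMr//; near: n; apply: filterS cv => n.
by rewrite sub0r normrN ger0_norm// ip_ge0.
Unshelve. all: by end_near. Qed.

Lemma ip_cvg_sqr (F : nat -> T -> R) f :
  (forall n, F n \in Lfun mu 2%:E) -> f \in Lfun mu 2%:E ->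
  ip (fun x => F n x - f x) (fun x => F n x - f x) @[n --> \oo] --> 0 ->
  ip (F n) (F n) @[n --> \oo] --> ip f f.
Proof.
move=> F2 f2 cv.
have -> : (fun n => ip (F n) (F n)) = (fun n =>
    ip (fun x => F n x - f x) (fun x => F n x - f x) + 2 * ip (F n) f - ip f f).
  by apply/funext => n; rewrite ip_sqrB//; lra.
rewrite -[X in _ --> X]addr0 (_ : ip f f + 0 = 0 + 2 * ip f f - ip f f); last by ring.
apply: cvgB; last exact: cvg_cst.
by apply: cvgD => //; apply: cvgMr; exact: ip_cvgl.
Qed.

(** Polarization: the inner product is a combination of squares, and squares pass to the limit by
    [ip_cvg_sqr], also those of the sums F_n + G_n. *)
Lemma ip_cvg (F G : nat -> T -> R) f g :
  (forall n, F n \in Lfun mu 2%:E) -> f \in Lfun mu 2%:E ->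
  (forall n, G n \in Lfun mu 2%:E) -> g \in Lfun mu 2%:E ->
  ip (fun x => F n x - f x) (fun x => F n x - f x) @[n --> \oo] --> 0 ->
  ip (fun x => G n x - g x) (fun x => G n x - g x) @[n --> \oo] --> 0 ->
  ip (F n) (G n) @[n --> \oo] --> ip f g.
Proof.
move=> F2 f2 G2 g2 cF cG.
have FG : ip (fun x => (F n x + G n x) - (f x + g x))
             (fun x => (F n x + G n x) - (f x + g x)) @[n --> \oo] --> 0.
  have s : 2 * ip (fun x => F n x - f x) (fun x => F n x - f x) +
      2 * ip (fun x => G n x - g x) (fun x => G n x - g x) @[n --> \oo] --> 0.
    by rewrite -[X in _ --> X]addr0 -[X in _ --> X + _](mulr0 2)
      -[X in _ --> _ + X](mulr0 2); apply: cvgD; exact: cvgMr.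
  apply: (squeeze_cvgr _ (cvg_cst 0) s); near=> n; rewrite ip_ge0/=.
  apply: le_trans (ip_sqrD_le (Lfun2B (F2 n) f2) (Lfun2B (G2 n) g2)).
  rewrite le_eqVlt; apply/orP; left; apply/eqP.
  by congr ip; apply/funext => x; ring.
have := ip_cvg_sqr (fun n => Lfun2D (F2 n) (G2 n)) (Lfun2D f2 g2) FG.
move=> c; have c1 := ip_cvg_sqr F2 f2 cF; have c2 := ip_cvg_sqr G2 g2 cG.
have -> : (fun n => ip (F n) (G n)) = (fun n =>
   2^-1 * (ip (fun x => F n x + G n x) (fun x => F n x + G n x) - ip (F n) (F n)
     - ip (G n) (G n))).
  by apply/funext => n; rewrite ip_sqrD//; field.
rewrite (_ : ip f g = 2^-1 * (ip (fun x => f x + g x) (fun x => f x + g x) - ip f f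
     - ip g g)); last by rewrite ip_sqrD//; field.
by apply: cvgMr; apply: cvgB => //; exact: cvgB.
Unshelve. all: by end_near. Qed.

Lemma ip_ae f g f' g' : measurable_fun setT f -> measurable_fun setT g ->
  measurable_fun setT f' -> measurable_fun setT g' ->
  {ae mu, forall x, f x = f' x} -> {ae mu, forall x, g x = g' x} ->
  ip f g = ip f' g'.
Proof.
move=> mf mg mf' mg' ff gg; rewrite /ip /Rintegral; congr fine.
apply: ae_eq_integral => //.
- by apply/measurable_EFinP; exact: measurable_funM.
- by apply/measurable_EFinP; exact: measurable_funM.
- by apply: filterS2 ff gg => x -> ->.
Qed.

Lemma Lfun2_ae f g : measurable_fun setT g -> {ae mu, forall x, f x = g x} ->
  f \in Lfun mu 2%:E -> g \in Lfun mu 2%:E.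
Proof.
move=> mg fg /Lfun2P[mf f2]; apply/Lfun2P; split => //.
rewrite (_ : integral _ _ _ = \int[mu]_x (f x ^+ 2)%:E)%E//.
apply: ae_eq_integral => //.
- by apply/measurable_EFinP; exact: measurable_funX.
- by apply/measurable_EFinP; exact: measurable_funX.
- by apply: filterS fg => x ->.
Qed.

End L2.

(** * Expectation of a product of independent variables *)

Section indep.
Context d (T : measurableType d) (R : realType) (P : probability T R).

(** Independence makes the joint law agree with the product of the two laws on rectangles, hence
    everywhere; Fubini's theorem then splits the integral. *)
Lemma ip_indep (X Y : {RV P >-> R}) :
  (forall A B, measurable A -> measurable B ->
    P (X @^-1` A `&` Y @^-1` B) = (P (X @^-1` A) * P (Y @^-1` B))%E) ->
  (X : T -> R) \in Lfun P 2%:E -> (Y : T -> R) \in Lfun P 2%:E ->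
  ip P X Y = \int[P]_w X w * \int[P]_w Y w.
Proof.
move=> XY X2 Y2.
have iX : P.-integrable setT (EFin \o X).
  by apply/Lfun1_integrable; exact: (Lfun_subset12 (fin_num_measure P _ measurableT)).
have iY : P.-integrable setT (EFin \o Y).
  by apply/Lfun1_integrable; exact: (Lfun_subset12 (fin_num_measure P _ measurableT)).
pose Z w := (X w, Y w).
have mZ : measurable_fun setT Z by apply/measurable_fun_pairP; split.
pose Zm := isMeasurableFun.Build _ _ _ _ _ mZ.
pose ZZ : {mfun T >-> (R * R)%type} := HB.pack Z Zm.
pose f (z : R * R) := (z.1 * z.2)%:E.
have mf : measurable_fun setT f.
  by apply/measurable_EFinP; apply: measurable_funM.
have -> : ip P X Y = fine (\int[(distribution P X \x distribution P Y)%E]_z f z)%E.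
  rewrite /ip /Rintegral; congr fine.
  transitivity (\int[distribution P ZZ]_z f z)%E.
    rewrite integral_distribution//; exact: Lfun2_integrableM.
  apply: eq_measure_integral => A mA _.
  exact/esym/product_measure_unique.
have iXd : (distribution P X).-integrable setT (EFin : R -> _).
  by apply: integrable_pushforward.
have iYd : (distribution P Y).-integrable setT (EFin : R -> _).
  by apply: integrable_pushforward.
have mab : measurable_fun [set: R] (fun y : R => `|y|%:E).
  by apply/measurable_EFinP; apply: measurableT_comp; [exact: normr_measurable|exact: measurable_id].
have [_ xfin] := integrableP _ _ _ iXd.
have [_ yfin] := integrableP _ _ _ iYd.
rewrite -integral12_prod_meas1; last first.
  apply/integrable12ltyP => //.
  have E x : (\int[distribution P Y]_y `|f (x, y)| =
      `|x|%:E * \int[distribution P Y]_y `|y%:E|)%E.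
    rewrite -ge0_integralZl_EFin//; apply: eq_integral => y _.
    by rewrite /f/= normrM EFinM.
  under eq_integral do rewrite E.
  rewrite ge0_integralZr//; last exact: integral_ge0.
  by rewrite lte_mul_pinfty// ?ge0_fin_numE// integral_ge0.
rewrite /fubini_F.
have E x : (\int[distribution P Y]_y f (x, y) = x%:E * \int[distribution P Y]_y y%:E)%E.
  by rewrite -integralZl//; apply: eq_integral => y _; rewrite /f/= EFinM.
under eq_integral do rewrite E.
rewrite -(fineK (integrable_fin_num _ iYd))// integralZr// fineM//; last first.
  exact: integrable_fin_num.
by rewrite !integral_distribution.
Qed.

End indep.

(** * Moments of the Poisson law *)

Section poisson_moments.
Context (R : realType) (q : R) (q0 : 0 <= q).

(** As 0 ^ 0 = 1, the weights at q = 0 are those of the Dirac mass at 0, so that null sets of the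
    intensity are covered too. *)
Definition poisson_weight k : R := q ^+ k / k`!%:R * expR (- q).

Lemma poisson_weight_ge0 k : 0 <= poisson_weight k.
Proof. by rewrite /poisson_weight mulr_ge0 ?expR_ge0// mulr_ge0// ?exprn_ge0// invr_ge0. Qed.

Lemma nneseries_shift (f : nat -> \bar R) : (forall k, 0 <= f k)%E ->
  (\sum_(0 <= k <oo) f k = f 0%N + \sum_(0 <= k <oo) f k.+1)%E.
Proof.
move=> f0; rewrite nneseries_recl//; congr (_ + _)%E.
by rewrite -(nneseries_addn 1)//; apply: eq_eseriesr => i _; rewrite addn1.
Qed.

Lemma poisson_weight_sum : (\sum_(0 <= k <oo) (poisson_weight k)%:E = 1)%E.
Proof.
rewrite (_ : 1%E = (expR (- q))%:E * (expR q)%:E)%E; last first.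
  by rewrite -EFinM expRN mulVf ?gt_eqF ?expR_gt0.
under eq_eseriesr do rewrite /poisson_weight EFinM muleC.
rewrite /= nneseriesZl/=; last first.
  by move=> n _; rewrite lee_fin divr_ge0// exprn_ge0.
congr (_ * _)%E; rewrite expRE -EFin_lim; last first.
  rewrite /pseries/=; under eq_fun do rewrite mulrC.
  exact: is_cvg_series_exp_coeff.
apply/congr_lim/funext => n/=; rewrite /pseries/= /series/= -sumEFin//.
by under eq_bigr do rewrite mulrC.
Qed.

(** The size-biasing identity of the Poisson law. It trades a factor k for a shift of the index, so
    that the first two moments reduce to the total mass. *)
Lemma poisson_weightS k : k.+1%:R * poisson_weight k.+1 = q * poisson_weight k.
Proof.
rewrite /poisson_weight factS natrM exprS; field.
by rewrite -[X in (1 + X)]/(k%:R) (addrC 1) natr1 !pnatr_eq0 -lt0n fact_gt0.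
Qed.

Lemma poisson_weight_mean : (\sum_(0 <= k <oo) (k%:R * poisson_weight k)%:E = q%:E)%E.
Proof.
rewrite nneseries_shift => [|k]; last by rewrite lee_fin mulr_ge0 ?poisson_weight_ge0.
rewrite mul0r add0e; under eq_eseriesr do rewrite poisson_weightS EFinM.
by rewrite nneseriesZl ?poisson_weight_sum ?mule1// => k _; rewrite lee_fin poisson_weight_ge0.
Qed.

Lemma poisson_weight_sqr : (\sum_(0 <= k <oo) (k%:R ^+ 2 * poisson_weight k)%:E = (q ^+ 2 + q)%:E)%E.
Proof.
rewrite nneseries_shift => [|k]; last by rewrite lee_fin mulr_ge0 ?poisson_weight_ge0 ?sqr_ge0.
rewrite expr0n mul0r add0e.
under eq_eseriesr => k _.
  rewrite expr2 -mulrA poisson_weightS mulrCA -natr1 mulrDl mul1r EFinM EFinD; over.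
rewrite /= nneseriesZl; last first.
  by move=> k _; rewrite -EFinD lee_fin; apply: addr_ge0; [apply: mulr_ge0 => //|]; exact: poisson_weight_ge0.
rewrite nneseriesD; last 2 first.
  by move=> k _ _; rewrite lee_fin mulr_ge0 ?poisson_weight_ge0.
  by move=> k _ _; rewrite lee_fin poisson_weight_ge0.
by rewrite poisson_weight_mean poisson_weight_sum -EFinM; congr EFin; ring.
Qed.

Context d (T : measurableType d) (P : probability T R) (X : T -> \bar R).
Hypothesis mX : measurable_fun setT X.
Hypothesis PX : forall k : nat, P [set w | X w = k%:R%:E] = (poisson_weight k)%:E.

Let F k := [set w | X w = k%:R%:E].

Let mF k : measurable (F k).
Proof.
by rewrite -[F k]setTI; apply: measurable_eqe => //; exact: measurable_cst.
Qed.

Let tF : trivIset setT F.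
Proof.
by move=> i j _ _ [w [Fi]]; rewrite /F/= Fi => -[/eqP]; rewrite eqr_nat => /eqP.
Qed.

(** The weights sum to 1, so that the disjoint events X = k exhaust the probability; in particular X
    is almost surely finite. *)
Lemma poisson_ae_nat : {ae P, forall w, exists k : nat, X w = k%:R%:E}.
Proof.
exists (~` \bigcup_k F k); split.
- by apply: measurableC; exact: bigcup_measurable.
- rewrite probability_setC; last exact: bigcup_measurable.
  rewrite measure_bigcup//.
  rewrite (_ : limn _ = 1%E) ?subee//.
  rewrite -poisson_weight_sum; transitivity (\sum_(0 <= k <oo) P (F k))%E.
    by apply: eq_eseriesl => k; rewrite in_setT.
  by apply: eq_eseriesr => k _; exact: PX.
- by move=> w /= nw [k _ /= kw]; apply: nw; exists k.
Qed.

Lemma poisson_expectation (phi : R -> R) : measurable_fun setT phi ->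
  (forall x, 0 <= phi x) ->
  (\int[P]_w (phi (fine (X w)))%:E = \sum_(0 <= k <oo) (phi k%:R * poisson_weight k)%:E)%E.
Proof.
move=> mphi phi0.
have mpX : measurable_fun setT (fun w => (phi (fine (X w)))%:E).
  apply/measurable_EFinP; apply: measurableT_comp => //.
  by apply: measurableT_comp.
have mU : measurable (\bigcup_k F k) by exact: bigcup_measurable.
transitivity (\int[P]_(w in \bigcup_k F k) (phi (fine (X w)))%:E)%E.
  rewrite (@ge0_negligible_integral _ _ _ _ _ (~` \bigcup_k F k))//.
  - by rewrite setTD setCK.
  - exact: measurableC.
  - by move=> *; rewrite lee_fin.
  - have [N [mN N0 sN]] := poisson_ae_nat.
    apply: (subset_measure0 _ mN _ N0); first exact: measurableC.
    by move=> w nw; apply: sN => -[k kw]; apply: nw; exists k.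
rewrite ge0_integral_bigcup//; last 2 first.
  by apply: measurable_funTS mpX.
  by move=> *; rewrite lee_fin.
apply: eq_eseriesr => k _.
rewrite (eq_integral (fun=> (phi k%:R)%:E)).
  by rewrite integral_cst// EFinM -PX.
by move=> w; rewrite inE => /= ->.
Qed.

Lemma poisson_Lfun2 : (fine \o X) \in Lfun P 2%:E.
Proof.
apply/Lfun2P; split; first by apply: measurableT_comp.
rewrite (poisson_expectation (phi := fun x => x ^+ 2))//; last first.
  by move=> x; rewrite sqr_ge0.
by rewrite poisson_weight_sqr ltry.
Qed.

Lemma poisson_sqr : ip P (fine \o X) (fine \o X) = q ^+ 2 + q.
Proof.
apply: EFin_inj; rewrite -integral_sqr_ip; last exact: poisson_Lfun2.
rewrite (poisson_expectation (phi := fun x => x ^+ 2)) ?poisson_weight_sqr// => x.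
by rewrite sqr_ge0.
Qed.

Lemma poisson_mean : \int[P]_w fine (X w) = q.
Proof.
have : (\int[P]_w `|fine (X w)|%:E = q%:E)%E.
  rewrite (poisson_expectation (phi := fun x => `|x|))//.
  by under eq_eseriesr do rewrite normr_nat; exact: poisson_weight_mean.
rewrite /Rintegral => h; apply: EFin_inj; rewrite -[RHS]h.
rewrite (_ : integral _ _ _ = q%:E)//.
rewrite -h; apply: ae_eq_integral => //.
- by apply/measurable_EFinP; apply: measurableT_comp.
- apply/measurable_EFinP; apply: measurableT_comp => //; exact: measurableT_comp.
by apply: filterS poisson_ae_nat => w [k ->] _ /=; rewrite normr_nat.
Qed.

End poisson_moments.

Import HBSimple HBNNSimple.

(** * Simple functions as sums over their nonzero values *)

Section simple_integral.
Context d (E : measurableType d) (R : realType).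
Implicit Types (f : {sfun E >-> R}) (phi : R -> R).

(** The value 0 is left out because its level set may have infinite measure; hence the condition
    [phi 0 = 0] below. *)
Definition supp_range f := [seq x <- (fset_set (range f) : seq R) | x != 0].

Lemma supp_range_uniq f : uniq (supp_range f).
Proof. by rewrite filter_uniq// fset_uniq. Qed.

Lemma supp_range_neq0 f x : x \in supp_range f -> x != 0.
Proof. by rewrite mem_filter => /andP[]. Qed.

Lemma simple_decomp f phi z : phi 0 = 0 ->
  phi (f z) = \sum_(x <- supp_range f) phi x * \1_(f @^-1` [set x]) z.
Proof.
move=> phi0; have [fz0|fz0] := eqVneq (f z) 0.
  rewrite fz0 phi0 big_seq big1// => x /supp_range_neq0 x0.
  rewrite indicE memNset ?mulr0//= => fzx.
  by move: x0; rewrite -fzx fz0 eqxx.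
rewrite (bigD1_seq (f z)) ?supp_range_uniq//=; last first.
  rewrite mem_filter fz0/= in_fset_set//; apply/mem_set.
  by exists z.
rewrite indicE mem_set//= mulr1 big1 ?addr0// => x xfz.
by rewrite indicE memNset ?mulr0//= => fzx; rewrite fzx eqxx in xfz.
Qed.

Lemma integral_simple (m : {measure set E -> \bar R}) f phi :
  phi 0 = 0 -> (forall x, x \in supp_range f -> 0 <= phi x) ->
  (\int[m]_z (phi (f z))%:E =
   \sum_(x <- supp_range f) (phi x)%:E * m (f @^-1` [set x]))%E.
Proof.
move=> phi0 phige0.
under eq_integral do rewrite simple_decomp// big_seq -sumEFin.
under eq_integral do rewrite -big_seq.
(* [ge0_integral_sum] asks for nonnegativity at every index and not only at those in the list,
   whence the maximum with 0. *)
under [LHS]eq_integral => z _.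
  rewrite (eq_big_seq (fun x => ((Num.max 0 (phi x))%:E * (\1_(f @^-1` [set x]) z)%:E)%E)).
    over.
  by move=> x /phige0 h; rewrite EFinM max_r.
rewrite ge0_integral_sum//; last 2 first.
- move=> x; apply/measurable_EFinP; apply: measurable_funM => //.
- by move=> x z _; rewrite -EFinM lee_fin mulr_ge0// le_max lexx.
apply: eq_big_seq => x xr.
rewrite ge0_integralZl_EFin//; last 2 first.
- exact/measurable_EFinP.
- by rewrite le_max lexx.
by rewrite integral_indic// setIT max_r// phige0.
Qed.

End simple_integral.

(** * Poisson random measures: counts and simple integrands *)

Section prm.
Context d (T : measurableType d) (R : realType) (P : probability T R).
Context d' (E : measurableType d') (q : {measure set E -> \bar R}).
Variable N : R.-ker T ~> E.
Hypothesis hN : poisson_random_measure P q N.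

Definition prm_count B w : R := fine (N w B).

Lemma measurable_prm_count B : measurable B -> measurable_fun setT (prm_count B).
Proof. by move=> mB; apply: measurableT_comp => //; exact: measurable_kernel. Qed.

Section one.
Variables (B : set E) (mB : measurable B) (qB : (q B < +oo)%E).

Let b := fine (q B).
Let b0 : 0 <= b. Proof. exact: fine_ge0. Qed.
Let PB (k : nat) : P [set w | N w B = k%:R%:E] = (poisson_weight b k)%:E.
Proof. by case: hN => + _ _; exact. Qed.
Let mNB : measurable_fun setT (N ^~ B). Proof. exact: measurable_kernel. Qed.

Lemma prm_count_Lfun2 : prm_count B \in Lfun P 2%:E.
Proof. exact: (poisson_Lfun2 b0 mNB PB). Qed.

Lemma prm_count_sqr : ip P (prm_count B) (prm_count B) = fine (q B) ^+ 2 + fine (q B).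
Proof. exact: (poisson_sqr b0 mNB PB). Qed.

Lemma prm_count_mean : \int[P]_w prm_count B w = fine (q B).
Proof. exact: (poisson_mean b0 mNB PB). Qed.

Lemma prm_count_ae_fin : {ae P, forall w, N w B \is a fin_num}.
Proof. by apply: filterS (poisson_ae_nat b0 mNB PB) => w [k ->]. Qed.

End one.

Lemma prm_count_ip (B C : set E) : measurable B -> measurable C ->
  (q B < +oo)%E -> (q C < +oo)%E -> B `&` C = set0 ->
  ip P (prm_count B) (prm_count C) = fine (q B) * fine (q C).
Proof.
move=> mB mC qB qC BC.
pose XB : {RV P >-> R} := HB.pack (prm_count B) (isMeasurableFun.Build _ _ _ _ _ (measurable_prm_count mB)).
pose XC : {RV P >-> R} := HB.pack (prm_count C) (isMeasurableFun.Build _ _ _ _ _ (measurable_prm_count mC)).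
rewrite -prm_count_mean// -(prm_count_mean mC)//.
apply: (@ip_indep _ _ _ _ XB XC); [|exact: prm_count_Lfun2..].
move=> U V mU mV /=; case: hN => _ _ /(_ 2%N (fun i => if i == ord0 then B else C)
  (fun i => if i == ord0 then fine @^-1` U else fine @^-1` V)).
rewrite !big_ord_recl big_ord0 mule1/= => <-.
- congr (P _); apply/seteqP; split => [w [Uw Vw] i _|w h]; first by case: ifPn.
  by have /= := h ord0 I; have /= := h (lift ord0 ord0) I.
- by move=> i; case: ifPn.
- move=> i j _ _ [z [Bi Cj]]; apply/eqP; move: Bi Cj.
  case: (unliftP ord0 i) => [i'|] ->; case: (unliftP ord0 j) => [j'|] -> //=.
  + by rewrite !ord1.
  + by move=> Cz Bz; exfalso; have : (B `&` C) z by []; rewrite BC.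
  + by move=> Bz Cz; exfalso; have : (B `&` C) z by []; rewrite BC.
- move=> i; have mf : measurable_fun [set: \bar R] (@fine R) by [].
  by case: ifPn => _; rewrite -[X in measurable X]setTI; exact: mf.
Qed.

Lemma ae_forall_seq (I : eqType) (s : seq I) (Q : I -> T -> Prop) :
  (forall i, i \in s -> {ae P, forall w, Q i w}) ->
  {ae P, forall w, forall i, i \in s -> Q i w}.
Proof.
elim: s => [|i s ih] h; first exact: aeW.
have h1 : {ae P, forall w, Q i w} by apply: h; rewrite mem_head.
have h2 : {ae P, forall w, forall i, i \in s -> Q i w}.
  by apply: ih => j js; apply: h; rewrite in_cons js orbT.
apply: filterS2 h1 h2 => w Qi Qs j; rewrite in_cons => /predU1P[->//|].
exact: Qs.
Qed.

Section simple.
Variables (h : {nnsfun E >-> R}) (D : set E).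
Hypotheses (mD : measurable D) (qD : (q D < +oo)%E) (hD : forall z, ~ D z -> h z = 0).

Let r := supp_range h.
Let B x := h @^-1` [set x].
Let b x := fine (q (B x)).

Let mB x : measurable (B x). Proof. exact: measurable_sfunP. Qed.

Let qB x : x \in r -> (q (B x) < +oo)%E.
Proof.
move=> /supp_range_neq0 x0; apply: le_lt_trans qD; apply: le_measure; rewrite ?inE//.
by move=> z /= hz; apply: contrapT => /hD; rewrite hz => /eqP; rewrite (negbTE x0).
Qed.

Let r_ge0 x : x \in r -> 0 <= x.
Proof.
rewrite mem_filter => /andP[_]; rewrite in_fset_set// inE => -[z _ <-]//.
Qed.

(** Extended by 0 off [r]: [ip_suml] requires square integrability at all indices, whereas the other
    level sets may have infinite intensity. *)
Let F (x : R) : T -> R := if x \in r then (fun w => x * prm_count (B x) w) else (fun=> 0).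
Let S w := \sum_(x <- r) F x w.

Let F2 x : F x \in Lfun P 2%:E.
Proof.
rewrite /F; case: ifPn => xr; last exact: Lfun2_0.
by apply: Lfun2Z; apply: prm_count_Lfun2 => //; exact: qB.
Qed.

Let S2 : S \in Lfun P 2%:E.
Proof. exact: (Lfun2_sum r F2). Qed.

Let JS : {ae P, forall w, (\int[N w]_z (h z)%:E)%E = (S w)%:E}.
Proof.
have := ae_forall_seq (s := r) (fun x xr => prm_count_ae_fin (mB x) (qB xr)).
apply: filterS => w Nw.
rewrite (integral_simple (N w) (phi := idfun)) -?sumEFin//.
apply: eq_big_seq => x xr; rewrite /F xr EFinM; congr (_ * _)%E.
by rewrite /prm_count fineK//; exact: Nw.
Qed.

(** Counts of distinct level sets are independent, so that off-diagonal terms are products of means;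
    a diagonal term exceeds the product by the Poisson variance times x^2, which gives the second
    sum. *)
Let ipS : ip P S S = (\sum_(x <- r) x * b x) ^+ 2 + \sum_(x <- r) x ^+ 2 * b x.
Proof.
rewrite ip_suml//.
transitivity (\sum_(x <- r) (x * b x * (\sum_(y <- r) y * b y) + x ^+ 2 * b x)).
  apply: eq_big_seq => x xr; rewrite ipC ip_suml//.
  rewrite [in LHS](bigD1_seq x) ?supp_range_uniq//=.
  rewrite [X in _ = x * b x * X + _](bigD1_seq x) ?supp_range_uniq//=.
  rewrite /F xr ipZl ?ipZr ?prm_count_sqr ?Lfun2Z ?prm_count_Lfun2 ?qB//.
  rewrite [X in _ + X](_ : _ = x * b x * \sum_(i <- r | i != x) i * b i).
    by rewrite /b; ring.
  rewrite mulr_sumr [LHS]big_seq_cond [RHS]big_seq_cond; apply: eq_bigr => y /andP[yr yx]; rewrite yr.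
  rewrite ipZl ?ipZr ?prm_count_ip ?Lfun2Z ?prm_count_Lfun2 ?qB//; first by rewrite /b; ring.
  by apply/seteqP; split => // z []; rewrite /B/= => -> /eqP; rewrite (negbTE yx).
by rewrite big_split/= -mulr_suml expr2.
Qed.

Let sumr1 : (\int[q]_z (h z)%:E)%E = (\sum_(x <- r) x * b x)%:E.
Proof.
rewrite (integral_simple q (phi := idfun))// -sumEFin; apply: eq_big_seq => x xr.
by rewrite EFinM fineK// ge0_fin_numE// qB.
Qed.

Let sumr2 : (\int[q]_z (h z ^+ 2)%:E)%E = (\sum_(x <- r) x ^+ 2 * b x)%:E.
Proof.
rewrite (integral_simple q (phi := fun x => x ^+ 2)) ?expr0n//; last first.
  by move=> *; exact: sqr_ge0.
rewrite -sumEFin; apply: eq_big_seq => x xr.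
by rewrite [RHS]EFinM fineK// ge0_fin_numE// qB.
Qed.

Let mJ : measurable_fun setT (fun w => \int[N w]_z (h z)%:E)%E.
Proof.
apply: measurable_fun_integral_kernel; first by move=> U mU; exact: measurable_kernel.
  by move=> z; rewrite lee_fin.
exact/measurable_EFinP.
Qed.

(** Stated for extended-valued integrals rather than for [ip], because it is to be passed to
    increasing limits by monotone convergence. *)
Lemma prm_simple_sqr :
  (\int[P]_w ((\int[N w]_z (h z)%:E) * (\int[N w]_z (h z)%:E)) =
   (\int[q]_z (h z)%:E) * (\int[q]_z (h z)%:E) + \int[q]_z (h z ^+ 2)%:E)%E.
Proof.
rewrite sumr1 sumr2 -EFinM -EFinD -expr2 -ipS -integral_sqr_ip//.
apply: ae_eq_integral => //.
- exact: emeasurable_funM.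
- apply/measurable_EFinP; apply: measurable_funX; apply: Lfun2_measurable.
  exact: S2.
- by apply: filterS JS => w -> _; rewrite -EFinM expr2.
Qed.

Lemma prm_simple_mean : (\int[P]_w \int[N w]_z (h z)%:E = \int[q]_z (h z)%:E)%E.
Proof.
have iS x : P.-integrable setT (EFin \o F x).
  apply/Lfun1_integrable; apply: (Lfun_subset12 (fin_num_measure P _ measurableT)).
  exact: F2.
rewrite sumr1; transitivity (\int[P]_w (S w)%:E)%E.
  apply: ae_eq_integral => //; last by apply: filterS JS => w -> _.
  by apply/measurable_EFinP/Lfun2_measurable/S2.
rewrite /S; under eq_integral do rewrite -sumEFin.
rewrite integral_sum// -sumEFin; apply: eq_big_seq => x xr.
rewrite -(fineK (integrable_fin_num _ (iS x)))//; congr EFin.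
rewrite -[LHS]/(\int[P]_w F x w) /F xr RintegralZl//; first by rewrite prm_count_mean// qB.
apply/Lfun1_integrable; apply: (Lfun_subset12 (fin_num_measure P _ measurableT)).
by apply: prm_count_Lfun2 => //; exact: qB.
Qed.

End simple.

End prm.

Lemma ge0_cvg_integral d (T : measurableType d) (R : realType)
    (mu : {measure set T -> \bar R}) (F : nat -> T -> \bar R) (G : T -> \bar R) :
  (forall n, measurable_fun setT (F n)) -> (forall n x, (0 <= F n x)%E) ->
  (forall x, nondecreasing_seq (F ^~ x)) -> (forall x, F ^~ x @ \oo --> G x) ->
  (\int[mu]_x F n x @[n --> \oo] --> \int[mu]_x G x)%E.
Proof.
move=> mF F0 ndF FG.
rewrite (_ : integral _ _ G = \int[mu]_x limn (F ^~ x))%E.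
  by apply: cvg_monotone_convergence => // x _; exact: ndF.
by apply: eq_integral => x _; apply/esym/cvg_lim => //; exact: FG.
Qed.

(** * Poisson integrals of square-integrable functions *)

Section prm_general.
Context d (T : measurableType d) (R : realType) (P : probability T R).
Context d' (E : measurableType d') (q : {measure set E -> \bar R}).
Variable N : R.-ker T ~> E.
Hypothesis hN : poisson_random_measure P q N.

(** Vanishing off a set D of finite intensity makes h integrable, by |h| <= 1_D + h^2, and gives
    finite intensity to the nonzero level sets of its simple approximations. *)
Definition prm_integrand (h : E -> R) := h \in Lfun q 2%:E /\
  exists2 D, measurable D & (q D < +oo)%E /\ forall z, ~ D z -> h z = 0.

Lemma prm_integrand_le h (k : E -> R) : prm_integrand h -> measurable_fun setT k -> (forall z, `|k z| <= `|h z|) ->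
  prm_integrand k.
Proof.
move=> [h2 [D mD [qD hD]]] mk kh; split; last first.
  exists D => //; split => // z /hD hz; apply/eqP; rewrite -normr_le0.
  by rewrite (le_trans (kh z))// hz normr0.
apply/Lfun2P; split => //; apply: le_lt_trans (integrable_lty _ (Lfun2_integrable_sqr h2)) => //.
apply: ge0_le_integral => //.
- by move=> z _; rewrite lee_fin sqr_ge0.
- by apply/measurable_EFinP; exact: measurable_funX.
- by apply/measurable_EFinP; apply: measurable_funX; exact: Lfun2_measurable h2.
- by move=> z _; rewrite lee_fin -(real_normK (num_real (k z))) -(real_normK (num_real (h z))) ler_sqr ?nnegrE.
Qed.

Lemma prm_integrand_lin a b h k : prm_integrand h -> prm_integrand k -> prm_integrand (fun z => a * h z + b * k z).
Proof.
move=> [h2 [D mD [qD hD]]] [k2 [C mC [qC kC]]]; split.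
  by apply: Lfun2D; exact: Lfun2Z.
exists (D `|` C); first exact: measurableU.
split; first by rewrite (le_lt_trans (measureU2 _ _ _))// lte_add_pinfty.
by move=> z nDC; rewrite hD ?kC ?mulr0 ?addr0// => ?; apply: nDC; [right|left].
Qed.

Lemma prm_integrand_sub h k : prm_integrand h -> prm_integrand k -> prm_integrand (fun z => h z - k z).
Proof.
move=> gh gk; rewrite (_ : (fun z => _) = (fun z => 1 * h z + (-1) * k z)).
  exact: prm_integrand_lin.
by apply/funext => z; rewrite mul1r mulN1r.
Qed.

Lemma prm_integrand_abs h : prm_integrand h -> prm_integrand (fun z => `|h z|).
Proof.
move=> gh; apply: (prm_integrand_le gh); last by move=> z; rewrite normr_id.
by apply: measurableT_comp => //; case: gh => /Lfun2_measurable.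
Qed.

Lemma prm_integrand_integrable h : prm_integrand h -> q.-integrable setT (EFin \o h).
Proof.
move=> [h2 [D mD [qD hD]]].
have iD : q.-integrable setT (EFin \o (fun z => \1_D z + h z ^+ 2)).
  apply: (@integrableD _ _ _ _ _ _ (EFin \o \1_D) (EFin \o (fun z => h z ^+ 2))) => //; last exact: Lfun2_integrable_sqr.
  apply/integrableP; split; first exact/measurable_EFinP.
  under eq_integral do rewrite /= ger0_norm//.
  by rewrite integral_indic// setIT.
apply: le_integrable iD => //; first exact/measurable_EFinP/Lfun2_measurable/h2.
move=> z _ /=; rewrite lee_fin [leRHS]ger0_norm; last by rewrite addr_ge0 ?sqr_ge0.
have [Dz|Dz] := pselect (D z); last by rewrite (hD _ Dz) normr0 addr_ge0 ?sqr_ge0.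
rewrite indicE mem_set//= -(real_normK (num_real (h z))).
have := sqr_ge0 (`|h z| - 1); have := normr_ge0 (h z); nra.
Qed.

(** An infinite integral counts as 0, so that linearity in h is claimed only where h is integrable
    for [N w], hence almost surely. *)
Definition prm_int (h : E -> R) (w : T) : R := \int[N w]_z h z.

Section nonneg.
Variables (h : E -> R) (gh : prm_integrand h) (h0 : forall z, 0 <= h z).

Let mh : measurable_fun setT (EFin \o h).
Proof. by case: gh => /Lfun2_measurable mh _; exact/measurable_EFinP. Qed.
Let g n := nnsfun_approx measurableT mh n.

Let gcvg z : (g n z)%:E @[n --> \oo] --> (h z)%:E.
Proof.
by apply: (@cvg_nnsfun_approx _ _ _ _ measurableT _ mh) => // x _; rewrite lee_fin.
Qed.

Let gnd z : nondecreasing_seq (fun n => g n z).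
Proof. by move=> m n mn; have /lefP := nd_nnsfun_approx measurableT mh mn; exact. Qed.

Let gle n z : g n z <= h z.
Proof.
by rewrite -lee_fin /g nnsfun_approxE; apply: le_approx => // x _; rewrite lee_fin.
Qed.

Let gD n z : h z = 0 -> g n z = 0.
Proof. by move=> hz; apply/eqP; rewrite eq_le -{1}hz gle/=. Qed.

Let J w := (\int[N w]_z (h z)%:E)%E.
Let Jn n w := (\int[N w]_z (g n z)%:E)%E.

Let mJn n : measurable_fun setT (Jn n).
Proof.
apply: measurable_fun_integral_kernel; first by move=> U mU; exact: measurable_kernel.
  by move=> z; rewrite lee_fin.
exact/measurable_EFinP.
Qed.

Let mJ : measurable_fun setT J.
Proof.
apply: measurable_fun_integral_kernel => //; by move=> U mU; exact: measurable_kernel.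
Qed.

Let J0 w : (0 <= J w)%E. Proof. by apply: integral_ge0 => z _; rewrite lee_fin. Qed.
Let Jn0 n w : (0 <= Jn n w)%E. Proof. by apply: integral_ge0 => z _; rewrite lee_fin. Qed.

Let Jnd w : nondecreasing_seq (Jn ^~ w).
Proof.
move=> m n mn; apply: ge0_le_integral => //.
- by move=> z _; rewrite lee_fin.
- exact/measurable_EFinP.
- exact/measurable_EFinP.
- by move=> z _; rewrite lee_fin; exact: gnd.
Qed.

Let approx_cvg (m : {measure set E -> \bar R}) :
  (\int[m]_z (g n z)%:E @[n --> \oo] --> \int[m]_z (h z)%:E)%E.
Proof.
apply: ge0_cvg_integral => //.
- by move=> n; exact/measurable_EFinP.
- by move=> n z; rewrite lee_fin.
Qed.

Let approx_sqr_cvg :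
  (\int[q]_z (g n z ^+ 2)%:E @[n --> \oo] --> \int[q]_z (h z ^+ 2)%:E)%E.
Proof.
apply: ge0_cvg_integral => //.
- by move=> n; apply/measurable_EFinP; exact: measurable_funX.
- by move=> n z; rewrite lee_fin sqr_ge0.
- move=> z m' n mn; rewrite lee_fin ler_sqr ?nnegrE//; exact: gnd.
- move=> z; apply: cvg_EFin; first exact: nearW.
  rewrite (_ : _ \o _ = (fun n => g n z * g n z)); last exact/funext.
  rewrite expr2; have /fine_cvgP[_ c] := @gcvg z; exact: cvgM.
Qed.

(** Campbell's formula, carried over from simple functions by monotone convergence on both sides. *)
Lemma prm_ge0_mean : (\int[P]_w \int[N w]_z (h z)%:E = \int[q]_z (h z)%:E)%E.
Proof.
have c : (\int[P]_w Jn n w @[n --> \oo] --> \int[P]_w J w)%E.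
  by apply: ge0_cvg_integral => // w; exact: approx_cvg.
have e n : (\int[P]_w Jn n w = \int[q]_z (g n z)%:E)%E.
  case: gh => _ [D mD [qD hD]]; apply: (prm_simple_mean hN mD) => //.
  by move=> z /hD; exact: gD.
rewrite -(cvg_lim _ c)//; under eq_fun do rewrite e.
by rewrite (cvg_lim _ (@approx_cvg q)).
Qed.

Let fq : (\int[q]_z (h z)%:E)%E \is a fin_num.
Proof. by apply: integrable_fin_num => //; exact: prm_integrand_integrable. Qed.

Lemma prm_ge0_sqr : (\int[P]_w ((\int[N w]_z (h z)%:E) * (\int[N w]_z (h z)%:E)) =
   (\int[q]_z (h z)%:E) * (\int[q]_z (h z)%:E) + \int[q]_z (h z ^+ 2)%:E)%E.
Proof.
have c : (\int[P]_w (Jn n w * Jn n w) @[n --> \oo] --> \int[P]_w (J w * J w))%E.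
  apply: ge0_cvg_integral => //.
  - by move=> n; exact: emeasurable_funM.
  - by move=> n w; exact: mule_ge0.
  - by move=> w m n mn; apply: lee_pmul => //; exact: Jnd.
  (* The limit of a product could fail at 0 times infinity; the two factors being equal, an infinite
     one is nonzero. *)
  - move=> w; apply: cvgeM; [|exact: approx_cvg..].
    have [fin|inf] := boolP (J w \is a fin_num); first by rewrite mule_def_fin.
    by apply: mule_def_neq0_infty (inf); apply/eqP => J_eq0; rewrite J_eq0 in inf.
have e n : (\int[P]_w (Jn n w * Jn n w) = (\int[q]_z (g n z)%:E) * (\int[q]_z (g n z)%:E) +
    \int[q]_z (g n z ^+ 2)%:E)%E.
  case: gh => _ [D mD [qD hD]]; apply: (prm_simple_sqr hN mD) => //.
  by move=> z /hD; exact: gD.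
rewrite -(cvg_lim _ c)//; under eq_fun do rewrite e.
apply: cvg_lim => //; apply: cvgeD => //; last first.
  by apply: cvgeM; [rewrite mule_def_fin|exact: approx_cvg..].
by rewrite fin_num_adde_defr// fin_numM.
Qed.

Lemma prm_ge0_ae_fin : {ae P, forall w, (\int[N w]_z (h z)%:E)%E \is a fin_num}.
Proof.
have iJ : P.-integrable setT J.
  apply/integrableP; split => //; rewrite (eq_integral J) => [|w _]; last by rewrite gee0_abs.
  by rewrite prm_ge0_mean ltey_eq fq.
by have := integrable_ae measurableT iJ; apply: filterS => w; exact.
Qed.

Lemma prm_ge0_Lfun2 : prm_int h \in Lfun P 2%:E.
Proof.
have mI : measurable_fun setT (prm_int h) by apply: measurableT_comp mJ.
apply/Lfun2P; split => //.
rewrite (_ : integral _ _ _ = \int[P]_w (J w * J w))%E.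
  rewrite prm_ge0_sqr lte_add_pinfty ?lte_mul_pinfty ?integral_ge0//.
  - by move=> z _; rewrite lee_fin.
  - by rewrite ltey_eq fq.
  - by apply: integrable_lty => //; apply: Lfun2_integrable_sqr; case: gh.
apply: ae_eq_integral => //.
- by apply/measurable_EFinP; exact: measurable_funX.
- exact: (emeasurable_funM mJ mJ).
- by apply: filterS prm_ge0_ae_fin => w Jw _; rewrite expr2 EFinM /prm_int /Rintegral fineK.
Qed.

Lemma prm_ge0_ip : ip P (prm_int h) (prm_int h) = (\int[q]_z h z) ^+ 2 + ip q h h.
Proof.
apply: EFin_inj; rewrite -integral_sqr_ip; last exact: prm_ge0_Lfun2.
rewrite (_ : integral _ _ _ = \int[P]_w (J w * J w))%E.
  rewrite prm_ge0_sqr integral_sqr_ip; last by case: gh.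
  by rewrite -(fineK fq) -EFinM expr2.
apply: ae_eq_integral => //.
- apply/measurable_EFinP; apply: measurable_funX; exact: Lfun2_measurable prm_ge0_Lfun2.
- exact: (emeasurable_funM mJ mJ).
- by apply: filterS prm_ge0_ae_fin => w Jw _; rewrite expr2 EFinM /prm_int /Rintegral fineK.
Qed.

Lemma prm_ge0_Rmean : \int[P]_w prm_int h w = \int[q]_z h z.
Proof.
apply: EFin_inj; rewrite /Rintegral !fineK//; last first.
  apply: integrable_fin_num => //; apply/Lfun1_integrable.
  by apply: (Lfun_subset12 (fin_num_measure P _ measurableT)); exact: prm_ge0_Lfun2.
rewrite -prm_ge0_mean; apply: ae_eq_integral => //.
- by apply/measurable_EFinP; exact: Lfun2_measurable prm_ge0_Lfun2.
- by apply: filterS prm_ge0_ae_fin => w Jw _; rewrite /prm_int /Rintegral fineK.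
Qed.

Lemma prm_integrand_approx : exists g : nat -> {nnsfun E >-> R},
  [/\ forall n z, 0 <= g n z <= h z,
      \int[q]_z g n z @[n --> \oo] --> \int[q]_z h z &
      ip q (g n) (g n) @[n --> \oo] --> ip q h h].
Proof.
have gg n : prm_integrand (g n).
  apply: (prm_integrand_le gh) => // z; rewrite !ger0_norm//; exact: gle.
exists g; split.
- by move=> n z; rewrite gle andbT.
- have c := @approx_cvg q.
  rewrite (_ : \int[q]_z h z = fine (\int[q]_z (h z)%:E)%E)//.
  by apply: fine_cvg; rewrite fineK.
- have c := approx_sqr_cvg.
  have fs (k : E -> R) : prm_integrand k -> (\int[q]_z (k z ^+ 2)%:E)%E = (ip q k k)%:E.
    by case=> k2 _; exact: integral_sqr_ip.
  apply/fine_cvg; rewrite -fs//.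
Qed.

End nonneg.

Lemma prm_integrand_ae_integrable h : prm_integrand h -> {ae P, forall w, (N w).-integrable setT (EFin \o h)}.
Proof.
move=> gh; have := prm_ge0_ae_fin (prm_integrand_abs gh) (fun z => normr_ge0 (h z)).
apply: filterS => w hw; apply/integrableP; split.
  by apply/measurable_EFinP/Lfun2_measurable; case: gh => h2 _; exact: h2.
by rewrite ltey_eq hw.
Qed.

Lemma prm_int_lin a b h k : prm_integrand h -> prm_integrand k -> {ae P, forall w,
  prm_int (fun z => a * h z + b * k z) w = a * prm_int h w + b * prm_int k w}.
Proof.
move=> gh gk; apply: filterS2 (prm_integrand_ae_integrable gh) (prm_integrand_ae_integrable gk) => w ih ik.
rewrite /prm_int RintegralD ?RintegralZl//.
  by have := integrableZl measurableT a ih.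
by have := integrableZl measurableT b ik.
Qed.

Lemma measurable_prm_int h : measurable_fun setT h -> measurable_fun setT (prm_int h).
Proof.
move=> mh; apply: measurableT_comp => //.
under eq_fun do rewrite integralE.
by apply: emeasurable_funB; (apply: measurable_fun_integral_kernel => //;
  [by move=> U mU; exact: measurable_kernel|
   try (apply: measurable_funepos); try (apply: measurable_funeneg);
   exact/measurable_EFinP]).
Qed.

Section signed.
Variables (h : E -> R) (gh : prm_integrand h).

(** Positive and negative parts, written as linear combinations of |h| and h so that
    [prm_integrand_lin] applies. *)
Let hp z := 2^-1 * `|h z| + 2^-1 * h z.
Let hm z := 2^-1 * `|h z| + (- 2^-1) * h z.
Let gp : prm_integrand hp. Proof. by apply: prm_integrand_lin => //; exact: prm_integrand_abs. Qed.
Let gm : prm_integrand hm. Proof. by apply: prm_integrand_lin => //; exact: prm_integrand_abs. Qed.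
Let hp0 z : 0 <= hp z.
Proof. by rewrite /hp -mulrDr mulr_ge0// -lerBlDr sub0r ler_normr lexx orbT. Qed.
Let hm0 z : 0 <= hm z.
Proof. by rewrite /hm mulNr -mulrBr mulr_ge0// subr_ge0 ler_norm. Qed.

Let hE : h = (fun z => 1 * hp z + (-1) * hm z).
Proof. by apply/funext => z; rewrite /hp /hm; field. Qed.
Let absE : (fun z => `|h z|) = (fun z => 1 * hp z + 1 * hm z).
Proof. by apply/funext => z; rewrite /hp /hm; field. Qed.

Let Ih : {ae P, forall w, prm_int h w = prm_int hp w - prm_int hm w}.
Proof.
have := prm_int_lin 1 (-1) gp gm; rewrite -hE; apply: filterS => w ->.
by rewrite mul1r mulN1r.
Qed.

Let Iabs : {ae P, forall w, prm_int (fun z => `|h z|) w = prm_int hp w + prm_int hm w}.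
Proof.
have := prm_int_lin 1 1 gp gm; rewrite -absE; apply: filterS => w ->.
by rewrite !mul1r.
Qed.

Let mh : measurable_fun setT h.
Proof. by case: gh => /Lfun2_measurable. Qed.

Lemma prm_int_Lfun2 : prm_int h \in Lfun P 2%:E.
Proof.
apply: (Lfun2_ae (measurable_prm_int mh) _
  (Lfun2B (prm_ge0_Lfun2 gp hp0) (prm_ge0_Lfun2 gm hm0))).
by apply: filterS Ih => w ->.
Qed.

Let iq := prm_integrand_integrable.

Let Rint_lin a b f k : prm_integrand f -> prm_integrand k ->
  \int[q]_z (a * f z + b * k z) = a * \int[q]_z f z + b * \int[q]_z k z.
Proof.
move=> gf gk; rewrite RintegralD ?RintegralZl//; try exact: iq.
  by have := integrableZl measurableT a (iq gf).
by have := integrableZl measurableT b (iq gk).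
Qed.

Lemma prm_int_mean : \int[P]_w prm_int h w = \int[q]_z h z.
Proof.
have i1 f : f \in Lfun P 2%:E -> P.-integrable setT (EFin \o f).
  by move=> f2; apply/Lfun1_integrable/(Lfun_subset12 (fin_num_measure P _ measurableT)).
have pL := prm_ge0_Lfun2 gp hp0; have mL := prm_ge0_Lfun2 gm hm0.
rewrite [in RHS]hE Rint_lin// -!prm_ge0_Rmean// mul1r mulN1r.
rewrite -RintegralB//; [|exact: i1..].
congr fine; apply: ae_eq_integral => //.
- by apply/measurable_EFinP; exact: measurable_prm_int.
- by apply/measurable_EFinP; apply: measurable_funB; [exact: Lfun2_measurable pL|exact: Lfun2_measurable mL].
- by apply: filterS Ih => w ->.
Qed.

(* The positive and negative parts a and b are not known to be uncorrelated at this point: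
   (a - b)^2 = 2 a^2 + 2 b^2 - (a + b)^2 reduces the claim to nonnegative integrands. *)
Lemma prm_int_sqr : ip P (prm_int h) (prm_int h) = (\int[q]_z h z) ^+ 2 + ip q h h.
Proof.
have pL := prm_ge0_Lfun2 gp hp0; have mL := prm_ge0_Lfun2 gm hm0.
have p2 : hp \in Lfun q 2%:E by case: gp.
have m2 : hm \in Lfun q 2%:E by case: gm.
have aL := prm_ge0_Lfun2 (prm_integrand_abs gh) (fun z => normr_ge0 (h z)).
have e1 : ip P (prm_int h) (prm_int h) =
    ip P (fun w => prm_int hp w - prm_int hm w) (fun w => prm_int hp w - prm_int hm w).
  apply: ip_ae => //; try exact: measurable_prm_int.
  - exact: Lfun2_measurable (Lfun2B pL mL).
  - exact: Lfun2_measurable (Lfun2B pL mL).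
have e2 : ip P (prm_int (fun z => `|h z|)) (prm_int (fun z => `|h z|)) =
    ip P (fun w => prm_int hp w + prm_int hm w) (fun w => prm_int hp w + prm_int hm w).
  apply: ip_ae => //; try exact: Lfun2_measurable aL.
  - exact: Lfun2_measurable (Lfun2D pL mL).
  - exact: Lfun2_measurable (Lfun2D pL mL).
move: e2; rewrite e1 ip_sqrB// ip_sqrD// !prm_ge0_ip//; last exact: prm_integrand_abs.
rewrite [X in X ^+ 2 + _ = _](_ : _ = \int[q]_z hp z + \int[q]_z hm z); last first.
  by rewrite absE Rint_lin// !mul1r.
rewrite (_ : \int[q]_z h z = \int[q]_z hp z - \int[q]_z hm z); last first.
  by rewrite {1}hE Rint_lin// mul1r mulN1r.
have -> : ip q (fun z => `|h z|) (fun z => `|h z|) = ip q hp hp + ip q hm hm + 2 * ip q hp hm.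
  by rewrite -ip_sqrD//; congr ip; rewrite absE; apply/funext => z; rewrite !mul1r.
have -> : ip q h h = ip q hp hp + ip q hm hm - 2 * ip q hp hm.
  by rewrite -ip_sqrB// {1 2}hE; congr ip; apply/funext => z; rewrite mul1r mulN1r.
have -> : ip q hp hm = 0.
  rewrite /ip (_ : (fun z => _) = (fun=> 0)) ?Rintegral_cst ?mul0r//.
  apply/funext => z; rewrite /hp /hm; by case: (ger0P (h z)) => _; field.
lra.
Qed.

End signed.

(** Polarization of [prm_int_sqr], applied to h + k. *)
Lemma prm_int_ip h k : prm_integrand h -> prm_integrand k ->
  ip P (prm_int h) (prm_int k) = (\int[q]_z h z) * (\int[q]_z k z) + ip q h k.
Proof.
move=> gh gk; have := prm_int_sqr (prm_integrand_lin 1 1 gh gk).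
have hL := prm_int_Lfun2 gh; have kL := prm_int_Lfun2 gk.
have h2 : h \in Lfun q 2%:E by case: gh.
have k2 : k \in Lfun q 2%:E by case: gk.
rewrite (_ : ip P _ _ = ip P (fun w => prm_int h w + prm_int k w) (fun w => prm_int h w + prm_int k w)).
  rewrite ip_sqrD// !prm_int_sqr//.
  have -> : (fun z => 1 * h z + 1 * k z) = (fun z => h z + k z).
    by apply/funext => z; rewrite !mul1r.
  rewrite ip_sqrD// RintegralD//; [|exact: prm_integrand_integrable..].
  lra.
have mm : {ae P, forall w, prm_int (fun z => 1 * h z + 1 * k z) w = prm_int h w + prm_int k w}.
  by have := prm_int_lin 1 1 gh gk; apply: filterS => w ->; rewrite !mul1r.
have m1 := Lfun2_measurable (prm_int_Lfun2 (prm_integrand_lin 1 1 gh gk)).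
have m2 := Lfun2_measurable (Lfun2D hL kL).
exact: ip_ae.
Qed.

Lemma prm_count_prm_int B : measurable B -> (q B < +oo)%E -> prm_int \1_B = prm_count N B.
Proof.
move=> mB qB; apply/funext => w; rewrite /prm_int /Rintegral /prm_count.
by rewrite integral_indic// setIT.
Qed.

Lemma prm_integrand_indic B : measurable B -> (q B < +oo)%E -> prm_integrand \1_B.
Proof.
move=> mB qB; split; last first.
  by exists B => //; split => // z Bz; rewrite indicE memNset.
apply/Lfun2P; split; first exact: measurable_indic.
rewrite (_ : (fun x => _) = (fun x => (\1_B x)%:E)); last first.
  by apply/funext => x; rewrite indicE; case: (_ \in _); rewrite ?expr1n ?expr0n.
by rewrite integral_indic// setIT.
Qed.

Section orth.
Variables (X : T -> R) (X2 : X \in Lfun P 2%:E).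
Hypothesis XN : forall B, measurable B -> (q B < +oo)%E -> ip P X (prm_count N B) = 0.

Let orth_lin a b h k : prm_integrand h -> prm_integrand k ->
  ip P X (prm_int h) = 0 -> ip P X (prm_int k) = 0 ->
  ip P X (prm_int (fun z => a * h z + b * k z)) = 0.
Proof.
move=> gh gk Xh Xk.
have hL := prm_int_Lfun2 gh; have kL := prm_int_Lfun2 gk.
rewrite (@ip_ae _ _ _ _ _ _ X (fun w => a * prm_int h w + b * prm_int k w)).
- by rewrite ipDr ?ipZr ?Xh ?Xk ?Lfun2Z// !mulr0 addr0.
- exact: Lfun2_measurable X2.
- exact: Lfun2_measurable (prm_int_Lfun2 (prm_integrand_lin a b gh gk)).
- exact: Lfun2_measurable X2.
- exact: Lfun2_measurable (Lfun2D (Lfun2Z a hL) (Lfun2Z b kL)).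
- exact: aeW.
- exact: prm_int_lin.
Qed.

Let orth_simple (h : {nnsfun E >-> R}) : prm_integrand h -> ip P X (prm_int h) = 0.
Proof.
move=> [_ [D mD [qD hD]]].
rewrite (_ : h = (fun z => \sum_(x <- supp_range h) x * \1_(h @^-1` [set x]) z) :> (_ -> _)); last first.
  by apply/funext => z; rewrite -(simple_decomp h (phi := idfun)).
(* Sets up an induction over sublists of the values, during which the level sets remain those of
   h. *)
have : {subset supp_range h <= supp_range h} by [].
suff H s : {subset s <= supp_range h} -> let k := (fun z => \sum_(x <- s) x * \1_(h @^-1` [set x]) z) in
    prm_integrand k /\ ip P X (prm_int k) = 0 by move=> /H[].
elim: s => [_|x s ih xs] k.
  have k0 : k = (fun=> 0) by apply/funext => z; rewrite /k big_nil.
  split.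
    rewrite k0; split; first exact: Lfun2_0.
    by exists set0 => //; split => //; rewrite measure0.
  rewrite (_ : prm_int k = (fun=> 0)).
    by rewrite /ip (_ : (fun w => _) = (fun=> 0)) ?Rintegral_cst ?mul0r//; apply/funext => w; rewrite mulr0.
  by apply/funext => w; rewrite k0 /prm_int Rintegral_cst// mul0r.
have [gk Xk] : prm_integrand (fun z => \sum_(x <- s) x * \1_(h @^-1` [set x]) z) /\
    ip P X (prm_int (fun z => \sum_(x <- s) x * \1_(h @^-1` [set x]) z)) = 0.
  by apply: ih => y ys; apply: xs; rewrite in_cons ys orbT.
have mB : measurable (h @^-1` [set x]) by exact: measurable_sfunP.
have qB : (q (h @^-1` [set x]) < +oo)%E.
  apply: le_lt_trans qD; apply: le_measure; rewrite ?inE//.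
  move=> z /= hz; apply: contrapT => /hD; rewrite hz => /eqP.
  by rewrite (negbTE (supp_range_neq0 (xs _ (mem_head _ _)))).
have gB := prm_integrand_indic mB qB.
have -> : k = (fun z => x * \1_(h @^-1` [set x]) z + 1 * \sum_(x <- s) x * \1_(h @^-1` [set x]) z).
  by apply/funext => z; rewrite /k big_cons mul1r.
split; first exact: prm_integrand_lin.
by apply: orth_lin => //; rewrite prm_count_prm_int// XN.
Qed.

(** The independence of the noise and N is phrased through counts. Orthogonality to the counts
    extends to Poisson integrals by linearity and mean-square approximation, without any appeal to
    independence of the integrals themselves. *)
Lemma prm_int_orth h : prm_integrand h -> ip P X (prm_int h) = 0.
Proof.
have main k : prm_integrand k -> (forall z, 0 <= k z) -> ip P X (prm_int k) = 0.
  move=> gk k0; have [g [gle cg cg2]] := prm_integrand_approx gk k0.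
  have gg n : prm_integrand (g n).
    apply: (prm_integrand_le gk) => // z; rewrite !ger0_norm//; by have /andP[] := gle n z.
  have kL := prm_int_Lfun2 gk; have gL n := prm_int_Lfun2 (gg n).
  have cv : ip P (fun w => prm_int (g n) w - prm_int k w)
      (fun w => prm_int (g n) w - prm_int k w) @[n --> \oo] --> 0.
    have e n : ip P (fun w => prm_int (g n) w - prm_int k w)
        (fun w => prm_int (g n) w - prm_int k w) =
        (\int[q]_z g n z - \int[q]_z k z) ^+ 2 + ip q (fun z => g n z - k z) (fun z => g n z - k z).
      rewrite -RintegralB//; [|exact: prm_integrand_integrable..].
      rewrite -prm_int_sqr; last exact: prm_integrand_sub.
      have mm : {ae P, forall w, prm_int (g n) w - prm_int k w = prm_int (fun z => g n z - k z) w}.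
        have := prm_int_lin 1 (-1) (gg n) gk; apply: filterS => w.
        rewrite mul1r mulN1r => <-; congr prm_int; apply/funext => z.
        by rewrite mul1r mulN1r.
      have m1 := Lfun2_measurable (Lfun2B (gL n) kL).
      have m2 := Lfun2_measurable (prm_int_Lfun2 (prm_integrand_sub (gg n) gk)).
      exact: ip_ae.
    (* As 0 <= g_n <= k, the cross term [ip q (g n) k] is at least [ip q (g n) (g n)]. *)
    have up n : ip q (fun z => g n z - k z) (fun z => g n z - k z) <= ip q k k - ip q (g n) (g n).
      have k2 : k \in Lfun q 2%:E by case: gk.
      have g2 : (g n : E -> R) \in Lfun q 2%:E by case: (gg n).
      rewrite ip_sqrB// (_ : ip q k k - _ = ip q (g n) (g n) + ip q k k - 2 * ip q (g n) (g n)); last ring.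
      rewrite lerB// ler_pM2l// /ip; apply: le_Rintegral => //; try exact: Lfun2_integrableM.
      by move=> z _; have /andP[? ?] := gle n z; exact: ler_wpM2l.
    apply: (@squeeze_cvgr _ _ _ _ (fun=> 0) (fun n => (\int[q]_z g n z - \int[q]_z k z) ^+ 2 + (ip q k k - ip q (g n) (g n)))).
    - by apply: nearW => n; rewrite ip_ge0 e lerD.
    - exact: cvg_cst.
    - rewrite (_ : 0 = (\int[q]_z k z - \int[q]_z k z) * (\int[q]_z k z - \int[q]_z k z) + (ip q k k - ip q k k)); last by ring.
      apply: cvgD; last by apply: cvgB => //; exact: cvg_cst.
      under eq_fun do rewrite expr2.
      by apply: cvgM; apply: cvgB => //; exact: cvg_cst.
  have := ip_cvgl gL kL X2 cv; rewrite (_ : (fun n => _) = (fun=> 0)).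
    by move=> c; rewrite ipC -(cvg_lim _ c)//; exact: lim_cst.
  by apply/funext => n; rewrite ipC; exact: orth_simple.
move=> gh; pose hp z := 2^-1 * `|h z| + 2^-1 * h z.
pose hm z := 2^-1 * `|h z| + (- 2^-1) * h z.
have gp : prm_integrand hp by apply: prm_integrand_lin => //; exact: prm_integrand_abs.
have gm : prm_integrand hm by apply: prm_integrand_lin => //; exact: prm_integrand_abs.
rewrite (_ : h = (fun z => 1 * hp z + (-1) * hm z)).
  apply: orth_lin => //; apply: main => // z.
    by rewrite /hp -mulrDr mulr_ge0// -lerBlDr sub0r ler_normr lexx orbT.
  by rewrite /hm mulNr -mulrBr mulr_ge0// subr_ge0 ler_norm.
by apply/funext => z; rewrite /hp /hm; field.
Qed.

End orth.

End prm_general.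

(** * Product measures, densities and increasing exhaustions *)

Section prod_integral.
Context d1 d2 (T1 : measurableType d1) (T2 : measurableType d2) (R : realType).
Variables (m1 : {sigma_finite_measure set T1 -> \bar R})
  (m2 : {sigma_finite_measure set T2 -> \bar R}).
Variables (f : T1 -> R) (k : T2 -> R).
Hypotheses (f1 : m1.-integrable setT (EFin \o f)) (k1 : m2.-integrable setT (EFin \o k)).

Let g (x : T1 * T2) := (f x.1 * k x.2)%:E.

Lemma prod_integrable : (m1 \x m2)%E.-integrable setT (EFin \o (fun x => f x.1 * k x.2)).
Proof.
have [/measurable_EFinP mf xfin] := integrableP _ _ _ f1.
have [/measurable_EFinP mk yfin] := integrableP _ _ _ k1.
have mg : measurable_fun setT g.
  apply/measurable_EFinP; apply: measurable_funM.
    exact: measurableT_comp mf _.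
  exact: measurableT_comp mk _.
apply/integrable12ltyP => //.
have E x : (\int[m2]_y `|g (x, y)| = `|f x|%:E * \int[m2]_y `|(EFin \o k) y|)%E.
  rewrite -ge0_integralZl_EFin//; last by do 2 apply: measurableT_comp => //.
  by apply: eq_integral => y _; rewrite /g/= normrM EFinM.
under eq_integral do rewrite E.
rewrite ge0_integralZr//; last 2 first.
- by do 2 apply: measurableT_comp => //.
- exact: integral_ge0.
by rewrite lte_mul_pinfty// ?ge0_fin_numE// integral_ge0.
Qed.

Lemma prod_Rintegral : \int[(m1 \x m2)%E]_x (f x.1 * k x.2) =
  (\int[m1]_x f x) * (\int[m2]_y k y).
Proof.
rewrite /Rintegral -(@integral12_prod_meas1 _ _ _ _ _ m1 m2 g); last exact: prod_integrable.
rewrite /fubini_F.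
have E x : (\int[m2]_y g (x, y) = (f x)%:E * \int[m2]_y (k y)%:E)%E.
  by rewrite -integralZl//; apply: eq_integral => y _; rewrite /g/= EFinM.
have KE := fineK (integrable_fin_num measurableT k1).
set K := fine _ in KE.
transitivity (fine (\int[m1]_x ((f x)%:E * K%:E))%E).
  by congr fine; apply: eq_integral => x _; rewrite E -KE.
by rewrite integralZr// -KE fineM//; exact: integrable_fin_num.
Qed.

End prod_integral.

(** On simple functions this is the hypothesis applied to level sets; monotone convergence on both
    sides carries it to f. *)
Lemma ge0_integral_density d (T : measurableType d) (R : realType)
    (mu nu : {measure set T -> \bar R}) (p : T -> R) (f : T -> R) :
  measurable_fun setT p -> (forall x, 0 <= p x) ->
  (forall V, measurable V -> nu V = \int[mu]_(x in V) (p x)%:E)%E ->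
  measurable_fun setT f -> (forall x, 0 <= f x) ->
  (\int[nu]_x (f x)%:E = \int[mu]_x (f x * p x)%:E)%E.
Proof.
move=> mp p0 nuE mf f0.
have mf' : measurable_fun setT (EFin \o f) by exact/measurable_EFinP.
pose g n := nnsfun_approx measurableT mf' n.
have gcvg x : EFin \o g^~ x @ \oo --> (f x)%:E.
  by apply: (@cvg_nnsfun_approx _ _ _ _ measurableT _ mf') => // z _; rewrite lee_fin.
have gnd x : nondecreasing_seq (fun n => g n x).
  by move=> m n mn; have /lefP := nd_nnsfun_approx measurableT mf' mn; exact.
have c1 : (\int[nu]_x (g n x)%:E @[n --> \oo] --> \int[nu]_x (f x)%:E)%E.
  apply: ge0_cvg_integral => //.
  - by move=> n; exact/measurable_EFinP.
  - by move=> n x; rewrite lee_fin.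
have c2 : (\int[mu]_x (g n x * p x)%:E @[n --> \oo] --> \int[mu]_x (f x * p x)%:E)%E.
  apply: ge0_cvg_integral => //.
  - by move=> n; apply/measurable_EFinP; exact: measurable_funM.
  - by move=> n x; rewrite lee_fin mulr_ge0.
  - by move=> x m n mn; rewrite lee_fin ler_wpM2r//; exact: gnd.
  - move=> x; apply: cvg_EFin; first exact: nearW.
    have /fine_cvgP[_ c] := @gcvg x.
    by apply: cvgM => //; exact: cvg_cst.
rewrite -(cvg_lim _ c1)// -(cvg_lim _ c2)//; congr (limn _); apply/funext => n.
rewrite (integral_simple nu (phi := idfun))//; last first.
  by move=> x; rewrite mem_filter => /andP[_]; rewrite in_fset_set// inE => -[z _ <-]/=.
transitivity (\int[mu]_x (\sum_(y <- supp_range (g n)) (y * (\1_(g n @^-1` [set y]) x * p x))%:E))%E.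
  have y0 y : y \in supp_range (g n) -> 0 <= y.
    by rewrite mem_filter => /andP[_]; rewrite in_fset_set// inE => -[z _ <-]/=.
  transitivity (\sum_(y <- supp_range (g n)) \int[mu]_x (Num.max 0 y * (\1_(g n @^-1` [set y]) x * p x))%:E)%E.
    apply: eq_big_seq => y yr; rewrite max_r ?y0//.
    rewrite nuE; last exact: measurable_sfunP.
    under [RHS]eq_integral do rewrite EFinM.
    rewrite ge0_integralZl_EFin ?y0//; last 2 first.
    - by move=> x _; rewrite lee_fin mulr_ge0.
    - apply/measurable_EFinP; apply: measurable_funM => //.
    congr (_ * _)%E; rewrite integral_mkcond; apply: eq_integral => x _.
    by rewrite patchE indicE; case: (_ \in _); rewrite ?mul1r ?mul0r.
  rewrite -ge0_integral_sum//; last 2 first.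
  - move=> y; apply/measurable_EFinP; apply: measurable_funM => //.
    exact: measurable_funM.
  - by move=> y x _; rewrite lee_fin mulr_ge0 ?mulr_ge0// le_max lexx.
  by apply: eq_integral => x _; apply: eq_big_seq => y yr; rewrite max_r ?y0.
apply: eq_integral => x _; rewrite sumEFin; congr EFin.
rewrite [X in X * p x](simple_decomp (g n) (phi := idfun))// mulr_suml.
by apply: eq_bigr => y _; rewrite mulrA.
Qed.

Lemma FTC2_is_derive (R : realType) (f F : R -> R) (a b : R) : a < b ->
  continuous f -> (forall x : R, is_derive x (1 : R) F (f x)) ->
  (\int[lebesgue_measure]_(x in `[a, b]) (f x)%:E = (F b - F a)%:E)%E.
Proof.
move=> ab cf dF.
have cF : continuous F.
  by move=> x; apply: differentiable_continuous; apply/derivable1_diffP; case: (dF x).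
rewrite EFinB; apply: continuous_FTC2 => //.
- exact: continuous_subspaceT.
- split; first by move=> x _; case: (dF x).
    by apply: cvg_at_right_filter; exact: cF.
  by apply: cvg_at_left_filter; exact: cF.
- by move=> x _; rewrite derive1E; case: (dF x).
Qed.

Lemma ge0_cvg_integral_nd d (T : measurableType d) (R : realType)
    (mu : {measure set T -> \bar R}) (A : nat -> set T) (D : set T) (f : T -> R) :
  (forall n, measurable (A n)) -> measurable D ->
  (forall m n, (m <= n)%N -> A m `<=` A n) -> (forall n, A n `<=` D) ->
  (forall x, D x -> exists n, A n x) ->
  measurable_fun setT f -> (forall x, 0 <= f x) ->
  (\int[mu]_(x in A n) (f x)%:E @[n --> \oo] --> \int[mu]_(x in D) (f x)%:E)%E.
Proof.
move=> mA mD ndA AD DA mf f0.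
have mf' : measurable_fun setT (EFin \o f) by exact/measurable_EFinP.
rewrite integral_mkcond; under eq_fun do rewrite integral_mkcond.
apply: ge0_cvg_integral.
- by move=> n; apply/(measurable_restrictT _ (mA n)); exact: measurable_funTS.
- by move=> n x; rewrite patchE; case: ifPn => // _; rewrite lee_fin.
- move=> x m n mn; rewrite !patchE; case: ifPn => [/set_mem Amx|_].
    by rewrite mem_set//; exact: ndA mn _ Amx.
  by case: ifPn => // _; rewrite lee_fin.
- move=> x; have [Dx|Dx] := pselect (D x); last first.
    rewrite patchE memNset//; apply: cvg_near_cst; apply: nearW => n.
    by rewrite patchE memNset// => /AD.
  have [m Amx] := DA x Dx; apply: cvg_near_cst; exists m => // n /= mn.
  by rewrite !patchE !mem_set//; exact: ndA mn _ Amx.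
Qed.

(** * Second moment of the centred normal law *)

Section normal_moment.
Context (R : realType) (s : R) (s0 : 0 < s).
Notation mu := (@lebesgue_measure R).
Let p := normal_pdf 0 s.

Let pE x : p x = normal_peak s * expR (- (s ^+ 2 *+ 2)^-1 * x ^+ 2).
Proof.
rewrite /p normal_pdfE ?gt_eqF// /normal_fun subr0; congr (_ * expR _).
by rewrite mulNr mulNr mulrC.
Qed.

Let cp : continuous p. Proof. by apply: continuous_normal_pdf; rewrite gt_eqF. Qed.
Let mp : measurable_fun setT p. Proof. exact: measurable_normal_pdf. Qed.
Let p0 x : 0 <= p x. Proof. exact: normal_pdf_ge0. Qed.

(** Gaussian integration by parts in differentiated form: over a symmetric interval, the second
    moment is s^2 times the mass plus a boundary term. *)
Let dp (x : R) : is_derive x (1 : R) (fun x => - s ^+ 2 * (x * p x)) ((x ^+ 2 - s ^+ 2) * p x).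
Proof.
have -> : (fun x => - s ^+ 2 * (x * p x)) =
    (fun x => (- s ^+ 2 * normal_peak s) * (x * expR (- (s ^+ 2 *+ 2)^-1 * x ^+ 2))).
  by apply/funext => y; rewrite pE; ring.
rewrite pE.
apply: is_derive_eq.
rewrite /GRing.scale/= -mulr_natl; field; exact: lt0r_neq0.
Qed.

Lemma normal_second_moment : (\int[normal_prob 0 s]_x (x ^+ 2)%:E = (s ^+ 2)%:E)%E.
Proof.
have mq : measurable_fun setT (fun x : R => x ^+ 2 * p x).
  by apply: measurable_funM => //; exact: measurable_funX.
have q0 x : 0 <= x ^+ 2 * p x by rewrite mulr_ge0 ?sqr_ge0.
pose A n := `[(- n.+1%:R : R), n.+1%:R]%classic.
have mA n : measurable (A n) by exact: measurable_itv.
have ndA m n : (m <= n)%N -> A m `<=` A n.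
  move=> mn x; rewrite /A/= !in_itv/= => /andP[h1 h2]; apply/andP; split.
    by rewrite (le_trans _ h1)// lerN2 ler_nat.
  by rewrite (le_trans h2)// ler_nat.
have AT x : exists n, A n x.
  have [n xn] : exists n : nat, `|x| <= n.+1%:R.
    exists (Num.truncn `|x|); have := truncnS_gt `|x|; exact: ltW.
  by exists n; rewrite /A/= in_itv/=; move: xn; rewrite ler_norml.
have c1 : (\int[mu]_(x in A n) (x ^+ 2 * p x)%:E @[n --> \oo] -->
    \int[mu]_x (x ^+ 2 * p x)%:E)%E by apply: ge0_cvg_integral_nd.
have c2 : (\int[mu]_(x in A n) (p x)%:E @[n --> \oo] --> 1%:E)%E.
  by rewrite -(integral_normal_pdf 0 s); apply: ge0_cvg_integral_nd.
have cont (k : R -> R) n : continuous k -> mu.-integrable (A n) (EFin \o k).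
  move=> ck; apply: continuous_compact_integrable; first exact: segment_compact.
  exact: continuous_subspaceT.
have cq : continuous (fun x : R => (x ^+ 2 - s ^+ 2) * p x).
  move=> x; apply: cvgM; last exact: cp.
  by apply: cvgB; [exact: exprn_continuous|exact: cvg_cst].
have E n : (\int[mu]_(x in A n) (x ^+ 2 * p x)%:E =
    (s ^+ 2)%:E * \int[mu]_(x in A n) (p x)%:E + (- (2 * s ^+ 2 * (n.+1%:R * p n.+1%:R)))%:E)%E.
  have nn : - n.+1%:R < n.+1%:R :> R by rewrite gtrN.
  rewrite -integralZl; [|exact: mA|exact: cont].
  rewrite (_ : - (2 * s ^+ 2 * (n.+1%:R * p n.+1%:R)) =
     - s ^+ 2 * (n.+1%:R * p n.+1%:R) - (- s ^+ 2) * (- n.+1%:R * p (- n.+1%:R))); last first.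
    by rewrite !pE sqrrN; ring.
  rewrite -(FTC2_is_derive nn cq dp) -integralD; [|exact: mA| |exact: cont].
    by apply: eq_integral => x _; rewrite -EFinM -EFinD; congr EFin; ring.
  by apply: integrableZl; [exact: mA|exact: cont].
(* The boundary term vanishes in the limit: e^u >= 1 + u bounds x p(x) by a multiple of 1/x. *)
have c3 : n.+1%:R * p n.+1%:R @[n --> \oo] --> (0 : R).
  apply: (@squeeze_cvgr _ _ _ _ (fun=> 0) (fun n => normal_peak s * (s ^+ 2 *+ 2) * n.+1%:R^-1)).
  - apply: nearW => n; rewrite mulr_ge0//= pE mulrCA -mulrA.
    apply: ler_wpM2l; first exact: normal_peak_ge0.
    rewrite mulNr expRN.
    have n0 : 0 < n.+1%:R :> R by rewrite ltr0n.
    have c0 : 0 < s ^+ 2 *+ 2 by rewrite pmulrn_lgt0// exprn_gt0.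
    rewrite ler_pdivrMr ?expR_gt0//.
    have := expR_ge1Dx ((s ^+ 2 *+ 2)^-1 * n.+1%:R ^+ 2).
    move=> h; apply: (@le_trans _ _ (s ^+ 2 *+ 2 / n.+1%:R * ((s ^+ 2 *+ 2)^-1 * n.+1%:R ^+ 2))).
      rewrite le_eqVlt; apply/orP; left; apply/eqP; field.
      by rewrite !gt_eqF.
    by apply: ler_wpM2l; [rewrite divr_ge0 ?ltW|rewrite (le_trans _ h)// lerDr].
  - exact: cvg_cst.
  - rewrite -[X in _ --> X](mulr0 (normal_peak s * (s ^+ 2 *+ 2))).
    by apply: cvgMr; exact: cvg_harmonic.
rewrite (@ge0_integral_density _ _ _ mu _ p)//; last by move=> x; exact: sqr_ge0.
rewrite -(cvg_lim _ c1)//; under eq_fun do rewrite E.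
apply: cvg_lim => //; rewrite [X in _ --> X](_ : _ = (s ^+ 2)%:E * 1%:E + (- (2 * s ^+ 2 * 0))%:E)%E; last first.
  by rewrite mule1 mulr0 oppr0 adde0.
apply: cvgeD => //; first by apply: cvgeZl.
by apply: cvg_EFin; [exact: nearW|apply: cvgN; apply: cvgMr].
Qed.

End normal_moment.

(** * Lebesgue measure on the plane and bounded Borel sets *)

Section leb2.
Context (R : realType).

Notation RT := (measurableTypeR R).
Notation lebRT := (@lebesgue_measure R \x @lebesgue_measure R)%E.

Let Leb2_0 : @Leb2 R set0 = 0%E. Proof. exact: (measure0 lebRT). Qed.
Let Leb2_ge0 A : (0 <= @Leb2 R A)%E. Proof. exact: (measure_ge0 lebRT). Qed.
Let Leb2_sigma_additive : semi_sigma_additive (@Leb2 R).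
Proof. exact: (@measure_semi_sigma_additive _ _ _ lebRT). Qed.

(* [lebesgue_measure] lives on [measurableTypeR R], whereas [R * R] carries the product of
   the default structure of [R]: the measurable sets are convertible but the integrals have
   to be transferred, see [integral_Leb2]. *)
HB.instance Definition _ := isMeasure.Build _ (R * R)%type R (@Leb2 R)
  Leb2_0 Leb2_ge0 Leb2_sigma_additive.

Definition square (M : R) : set (R * R) := `[- M, M]%classic `*` `[- M, M]%classic.

Lemma measurable_square M : measurable (square M).
Proof. by apply: measurableX; exact: (measurable_itv (`[- M, M]%R : interval RT)). Qed.

Let square_lty M : (@Leb2 R (square M) < +oo)%E.
Proof.
have mK : measurable (`[- M, M]%classic : set RT) by exact: measurable_itv.
rewrite /Leb2/= product_measure1E//.
have h : (lebesgue_measure (`[(- M)%R, M]%classic : set RT) < +oo)%E.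
  by rewrite lebesgue_measure_itv/=; case: ifPn => _//; rewrite -EFinD ltry.
by rewrite lte_mul_pinfty// ge0_fin_numE.
Qed.

Lemma norm_square M x : `|x| <= M -> square M x.
Proof.
by rewrite [leLHS]prod_normE ge_max => /andP[h1 h2]; split; rewrite /= in_itv/= -ler_norml.
Qed.

Let Leb2_sigma_finite : sigma_finite setT (@Leb2 R).
Proof.
exists (fun n => square n%:R); last by move=> n; split; [exact: measurable_square|exact: square_lty].
apply/esym/seteqP; split => // x _; exists (Num.truncn `|x|).+1 => //.
by apply: norm_square; exact/ltW/truncnS_gt.
Qed.

HB.instance Definition _ := Measure_isSigmaFinite.Build _ (R * R)%type R (@Leb2 R)
  Leb2_sigma_finite.

Let phi (x : RT * RT) : R * R := x.
Let mphi : measurable_fun setT phi.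
Proof. by move=> _ Y mY; rewrite setTI. Qed.

Lemma integrable_Leb2 (f : R * R -> \bar R) :
  lebRT.-integrable setT f -> (@Leb2 R).-integrable setT f.
Proof.
move=> fi; apply: (@integrable_pushforward _ _ _ _ _ phi mphi lebRT setT f) => //.
by have := measurable_int _ fi.
Qed.

Lemma integral_Leb2 (f : R * R -> \bar R) :
  lebRT.-integrable setT f -> (\int[@Leb2 R]_x f x = \int[lebRT]_x f x)%E.
Proof.
move=> fi; apply: (@integral_pushforward _ _ _ _ _ phi mphi lebRT setT f) => //.
by have := measurable_int _ fi.
Qed.

Lemma bounded_Borel_lty (A : set (R * R)) : bounded_Borel A -> (Leb2 A < +oo)%E.
Proof.
move=> [mA [M [Mr bA]]].
apply: (@le_lt_trans _ _ (@Leb2 R (square (M + 1)))); last exact: square_lty.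
apply: le_measure; rewrite ?inE//; first exact: measurable_square.
by move=> x Ax; apply: norm_square; apply: bA Ax; rewrite ltrDl.
Qed.

Lemma bounded_Borel_square M : bounded_Borel (square M).
Proof.
split; first exact: measurable_square.
exists M; split; first exact: num_real.
move=> y My x []; rewrite /= !in_itv/= -!ler_norml => x1 x2.
by rewrite [leLHS]prod_normE ge_max !(ltW (le_lt_trans _ My)).
Qed.

Lemma integrable_indic_Borel (A : set (R * R)) : bounded_Borel A ->
  (@Leb2 R).-integrable setT (EFin \o \1_A).
Proof.
move=> bA; have [mA _] := bA; apply/integrableP; split; first exact/measurable_EFinP.
under eq_integral do rewrite /= ger0_norm//.
by rewrite integral_indic// setIT bounded_Borel_lty.
Qed.

Lemma bounded_BorelI (A B : set (R * R)) : measurable A -> bounded_Borel B ->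
  bounded_Borel (A `&` B).
Proof.
move=> mA [mB [M [Mr bB]]]; split; first exact: measurableI.
by exists M; split => // x Mx y [_ By]; exact: bB.
Qed.

End leb2.

(** * Moments of the Gaussian white noise *)

Section normal_law.
Context d (T : measurableType d) (R : realType) (P : probability T R).

Lemma normal_law_sqr (X : T -> R) v : measurable_fun setT X -> has_normal_law P X 0 v ->
  (\int[P]_w (X w ^+ 2)%:E = v%:E)%E.
Proof.
move=> mX [[-> X0]|[v0 XB]].
  rewrite (ae_eq_integral (cst 0%E))//; first exact: integral0.
    by apply/measurable_EFinP; exact: measurable_funX.
  by apply: filterS X0 => w -> _; rewrite expr0n.
have s0 : 0 < Num.sqrt v by rewrite sqrtr_gt0.
rewrite -(sqr_sqrtr (ltW v0)) -(normal_second_moment s0).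
have mf : measurable_fun setT (fun x : R => (x ^+ 2)%:E).
  by apply/measurable_EFinP; exact: measurable_funX.
pose XX : {mfun T >-> measurableTypeR R} :=
  HB.pack X (isMeasurableFun.Build _ _ T (measurableTypeR R) X mX).
transitivity (\int[distribution P XX]_x (x ^+ 2)%:E)%E.
  by rewrite ge0_integral_distribution// => x; rewrite lee_fin sqr_ge0.
by apply: eq_measure_integral => B mB _; exact: XB.
Qed.

(** X and -X have the same law, so that the mean equals its own opposite. The law of -X is a
    separate hypothesis; for the white noise it comes from the coefficient -1 in the definition. *)
Lemma normal_law_mean (X : T -> R) v : X \in Lfun P 2%:E -> has_normal_law P X 0 v ->
  has_normal_law P (fun w => - X w) 0 v -> \int[P]_w X w = 0.
Proof.
move=> X2 hX hNX; have mX := Lfun2_measurable X2.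
have iX : P.-integrable setT (EFin \o X).
  by apply/Lfun1_integrable/(Lfun_subset12 (fin_num_measure P _ measurableT)).
suff : \int[P]_w X w = - \int[P]_w X w by lra.
rewrite -mulN1r -RintegralZl//.
case: hX => [[v0 X0]|[v0 XB]].
  congr fine; apply: ae_eq_integral => //.
  - exact/measurable_EFinP.
  - by apply/measurable_EFinP; exact: measurable_funM.
  - by apply: filterS X0 => w -> _; rewrite mulr0.
case: hNX => [[v1]|[_ NXB]]; first by rewrite v1 ltxx in v0.
have mNX : measurable_fun setT (fun w => - X w) by exact: measurableT_comp.
have iNX : P.-integrable setT (EFin \o (fun w => - X w)).
  by have := integrableN iX; congr (integrable _ _ _); apply/funext.
pose XX : {RV P >-> R} := HB.pack X (isMeasurableFun.Build _ _ _ _ _ mX).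
pose NX : {RV P >-> R} := HB.pack (fun w => - X w) (isMeasurableFun.Build _ _ _ _ _ mNX).
transitivity (fine (\int[P]_w (EFin \o NX) w)%E); last first.
  by congr fine; apply: eq_integral => w _; rewrite /= mulN1r.
rewrite -integral_distribution//; transitivity (fine (\int[P]_w (EFin \o XX) w)%E); first by [].
rewrite -integral_distribution//; congr fine.
by apply: eq_measure_integral => B mB _; rewrite -[LHS]/(P (X @^-1` B)) XB// -NXB.
Qed.

End normal_law.

Section white_noise.
Context d (T : measurableType d) (R : realType) (P : probability T R).
Variable W : set (R * R) -> {RV P >-> R}.
Hypothesis gW : gaussian_white_noise W.

Lemma noise_law A (c : R) : bounded_Borel A ->
  has_normal_law P (fun w => c * W A w) 0 (c ^+ 2 * fine (@Leb2 R A)).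
Proof.
move=> bA; have := gW (n := 1) (A := fun=> A) (fun=> c) (fun=> bA).
rewrite !big_ord_recl !big_ord0 !addr0 setIid expr2.
by under eq_fun do rewrite big_ord_recl big_ord0 addr0.
Qed.

Lemma noise_Lfun2 A : bounded_Borel A -> (W A : T -> R) \in Lfun P 2%:E.
Proof.
move=> bA; apply/Lfun2P; split => //.
have := noise_law 1 bA; rewrite (_ : (fun w => _) = W A); last first.
  by apply/funext => w; rewrite mul1r.
by move/(normal_law_sqr (measurable_funPT (W A))) => ->; rewrite ltry.
Qed.

Lemma noise_mean A : bounded_Borel A -> \int[P]_w W A w = 0.
Proof.
move=> bA; apply: (normal_law_mean (v := fine (@Leb2 R A)) (noise_Lfun2 bA)).
  have := noise_law 1 bA; rewrite (_ : (fun w => _) = W A) ?expr1n ?mul1r//.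
  by apply/funext => w; rewrite mul1r.
have := noise_law (-1) bA; rewrite (_ : (fun w => _) = (fun w => - W A w)) ?sqrrN ?expr1n ?mul1r//.
by apply/funext => w; rewrite mulN1r.
Qed.

Lemma noise_sqr A : bounded_Borel A -> ip P (W A) (W A) = fine (@Leb2 R A).
Proof.
move=> bA; apply: EFin_inj; rewrite -integral_sqr_ip; last exact: noise_Lfun2.
have := noise_law 1 bA; rewrite (_ : (fun w => _) = W A) ?expr1n ?mul1r.
  exact: (normal_law_sqr (measurable_funPT (W A))).
by apply/funext => w; rewrite mul1r.
Qed.

(* Polarization of the variances of [W A], [W B] and [W A + W B]. *)
Lemma noise_ip A B : bounded_Borel A -> bounded_Borel B ->
  ip P (W A) (W B) = fine (@Leb2 R (A `&` B)).
Proof.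
move=> bA bB; have wA := noise_Lfun2 bA; have wB := noise_Lfun2 bB.
pose C (i : 'I_2) := if i == ord0 then A else B.
have bC i : bounded_Borel (C i) by rewrite /C; case: ifP.
have := gW (n := 2) (A := C) (fun=> 1) bC.
have S2 (F : 'I_2 -> R) : \sum_(i < 2) F i = F ord0 + F (lift ord0 ord0).
  by rewrite !big_ord_recl big_ord0 addr0.
rewrite !S2 (_ : (fun w => _) = (fun w => W A w + W B w)); last first.
  by apply/funext => w; rewrite S2 !mul1r.
have AB := Lfun2D wA wB.
move/(normal_law_sqr (Lfun2_measurable AB)); rewrite integral_sqr_ip// => -[].
have K (a b c x : R) : a + b + 2 * x = 1 * 1 * a + 1 * 1 * c + (1 * 1 * c + 1 * 1 * b) -> x = c.
  lra.
rewrite ip_sqrD// !noise_sqr// -[C ord0]/A -[C (lift _ _)]/B (setIid A) (setIid B) (setIC B A).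
exact: K.
Qed.

End white_noise.

(** * Square integrability by comparison and under a probability *)

Section L2_more.
Context d (T : measurableType d) (R : realType).

Lemma Lfun2_le (mu : {measure set T -> \bar R}) (f g : T -> R) :
  measurable_fun setT f -> (forall x, `|f x| <= `|g x|) ->
  g \in Lfun mu 2%:E -> f \in Lfun mu 2%:E.
Proof.
move=> mf fg g2; apply/Lfun2P; split => //.
apply: le_lt_trans (integrable_lty _ (Lfun2_integrable_sqr g2)) => //.
apply: ge0_le_integral => //.
- by move=> z _; rewrite lee_fin sqr_ge0.
- by apply/measurable_EFinP; exact: measurable_funX.
- by apply/measurable_EFinP; apply: measurable_funX; exact: Lfun2_measurable g2.
- move=> z _; rewrite lee_fin -(real_normK (num_real (f z))) -(real_normK (num_real (g z))).
  by rewrite ler_sqr ?nnegrE.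
Qed.

Variable P : probability T R.

Lemma Lfun2_cst (c : R) : (fun=> c) \in Lfun P 2%:E.
Proof. exact: (Lfun_cst P c 2). Qed.

Lemma Lfun2_integrable (f : T -> R) : f \in Lfun P 2%:E -> P.-integrable setT (EFin \o f).
Proof. by move=> f2; apply/Lfun1_integrable/(Lfun_subset12 (fin_num_measure P _ measurableT)). Qed.

Lemma ip_cstl (c : R) (f : T -> R) : f \in Lfun P 2%:E -> ip P (fun=> c) f = c * \int[P]_w f w.
Proof. by move=> f2; rewrite /ip RintegralZl//; exact: Lfun2_integrable. Qed.

Lemma Rmean_cst (c : R) : \int[P]_w c = c.
Proof.
rewrite Rintegral_cst// -[RHS]mulr1; congr (_ * _).
by rewrite -[RHS]/(fine 1%E); congr fine; exact: probability_setT.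
Qed.

End L2_more.

Section sigma_finite_of.
Context d (T : measurableType d) (R : realType) (mu : {measure set T -> \bar R}).

(* Turns a measure into a sigma-finite one, as Fubini's theorem requires; the proof only
   serves to key the instances. *)
Definition sigma_finite_of of sigma_finite setT mu : set T -> \bar R := mu.

Hypothesis h : sigma_finite setT mu.

HB.instance Definition _ := isMeasure.Build _ T R (sigma_finite_of h)
  (measure0 mu) (measure_ge0 mu) (@measure_semi_sigma_additive _ _ _ mu).

HB.instance Definition _ := Measure_isSigmaFinite.Build _ T R (sigma_finite_of h) h.

End sigma_finite_of.

(** * Moments of the Levy basis *)

Section levy.
Context d (T : measurableType d) (R : realType) (P : probability T R).
Variables (beta sigma : R) (nu : {measure set R -> \bar R}).
Variables (Lambda W : set (R * R) -> {RV P >-> R}) (N : R.-ker T ~> (R * R * R)%type).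
Hypotheses (nu2 : finite_second_moment nu) (nulevy : levy_measure nu).
Hypothesis gW : gaussian_white_noise W.
Hypothesis hN : poisson_random_measure P (@Leb2 R \x nu)%E N.
Hypothesis WN : independent_sigma_algebras P
  (events_of_noise W) (events_of_random_measure N).
Hypothesis hLambda : forall A, bounded_Borel A ->
  exists2 Z : {RV P >-> R},
    is_compensated_integral P (@Leb2 R \x nu)%E N
      (fun x => \1_A x.1 * x.2 * \1_[set z | `|z| <= 1] x.2) Z &
    {ae P, forall w,
      Lambda A w = beta * fine (Leb2 A) + sigma * W A w + Z w +
        fine (\int[N w]_x
          (\1_A x.1 * x.2 * \1_[set z | 1 < `|z|] x.2)%:E)%E}.

Let sqr2 : (fun z : R => z) \in Lfun nu 2%:E.
Proof. by apply/Lfun2P; split. Qed.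

Let tail (a : R) := [set z : R | a < `|z|].

Let mtail a : measurable (tail a).
Proof.
rewrite -[tail a]setTI (_ : tail a = (fun z : R => `|z|) @^-1` `]a, +oo[%classic).
  by apply: (normr_measurable (D := setT)) => //; exact: measurable_itv.
by apply/seteqP; split => z /=; rewrite in_itv/= andbT.
Qed.

Let tail_lty a : 0 < a -> (nu (tail a) < +oo)%E.
Proof.
move=> a0; have a20 : 0 < a ^+ 2 by rewrite exprn_gt0.
have mf : measurable_fun [set: R] (fun z : R => (z ^+ 2)%:E).
  by apply/measurable_EFinP; exact: measurable_funX.
have := le_integral_abse nu measurableT mf a20; rewrite setTI => h.
have : ((a ^+ 2)%:E * nu (tail a) < +oo)%E.
  apply: (@le_lt_trans _ _ (\int[nu]_z `|(z ^+ 2)%:E|)%E); last first.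
    by under eq_integral do rewrite /= ger0_norm ?sqr_ge0//.
  apply: le_trans h; rewrite lee_pmul2l//; apply: le_measure; rewrite ?inE//.
  - rewrite -[X in measurable X]setTI.
    by apply: measurable_lee => //; apply: measurableT_comp.
  move=> z /= az; rewrite lee_fin ger0_norm ?sqr_ge0// -(real_normK (num_real z)).
  by rewrite ler_sqr ?nnegrE ?ltW// (lt_trans a0 az).
move=> hlt; rewrite ltey; apply/eqP => tt; move: hlt.
by rewrite tt gt0_muley ?lte_fin// ltxx.
Qed.

Let nu_sigma_finite : sigma_finite setT nu.
Proof.
exists (fun n => [set 0] `|` tail n.+1%:R^-1).
  apply/esym/seteqP; split => // z _; have [->|z0] := eqVneq z 0; first by exists 0%N => //; left.
  have z0' : 0 < `|z| by rewrite normr_gt0.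
  exists (Num.truncn `|z|^-1) => //; right; rewrite /tail/= invf_plt ?posrE//.
  exact: truncnS_gt.
move=> n; split; first exact: measurableU.
rewrite (le_lt_trans (measureU2 _ _ _))//.
have nu0 : (nu [set 0%R] < +oo)%E by case: nulevy => ->.
by apply: lte_add_pinfty => //; exact: tail_lty.
Qed.

Let nuS : {sigma_finite_measure set R -> \bar R} := sigma_finite_of nu_sigma_finite.

Let q : {measure set (R * R * R)%type -> \bar R} := (@Leb2 R \x nuS)%E.

Let hNq : poisson_random_measure P q N.
Proof. exact: hN. Qed.

Let hK (k : R -> R) (A : set (R * R)) (x : R * R * R) := \1_A x.1 * k x.2.

(** Functions of the jump size cut off near 0: square integrable for nu by |k z| <= |z|, and
    integrable by |k z| <= z^2 / a. *)
Definition jump_fun a (k : R -> R) := [/\ measurable_fun setT k, 0 < a,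
  (forall z, `|k z| <= `|z|) & forall z, ~ tail a z -> k z = 0].

Let jump_Lfun2 a k : jump_fun a k -> k \in Lfun nu 2%:E.
Proof. by move=> [mk _ kz _]; exact: Lfun2_le sqr2. Qed.

Let jump_integrable a k : jump_fun a k -> nu.-integrable setT (EFin \o k).
Proof.
move=> [mk a0 kz kt].
have i2 : nu.-integrable setT (EFin \o (fun z : R => a^-1 * (z ^+ 2))).
  by have := integrableZl measurableT a^-1 (Lfun2_integrable_sqr sqr2).
apply: le_integrable i2 => //; first exact/measurable_EFinP.
move=> z _; rewrite /= lee_fin normrM normrX gtr0_norm ?invr_gt0//.
have [tz|tz] := pselect (tail a z); last first.
  by rewrite (kt _ tz) normr0; apply: mulr_ge0; [rewrite invr_ge0 ltW|exact: exprn_ge0].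
rewrite (le_trans (kz z))// ler_pdivlMl// expr2 ler_wpM2r//.
exact: ltW.
Qed.

Let prm_integrand_hK a k A : jump_fun a k -> bounded_Borel A -> prm_integrand q (hK k A).
Proof.
move=> jk bA; have [mA _] := bA; have [mk a0 kz kt] := jk; split.
  apply/Lfun2P; split.
    by apply: measurable_funM; apply: measurableT_comp.
  rewrite (eq_integral (fun x => (\1_A x.1 * (k x.2 ^+ 2))%:E)); last first.
    move=> x _; rewrite exprMn indicE; case: (_ \in _); rewrite ?expr1n ?expr0n//=.
  apply: integrable_lty => //.
  apply: (@prod_integrable _ _ _ _ _ (@Leb2 R) nuS \1_A (fun z => k z ^+ 2)).
    exact: integrable_indic_Borel.
  exact: Lfun2_integrable_sqr (jump_Lfun2 jk).
exists (A `*` tail a); first exact: measurableX.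
split; last first.
  move=> x nx; rewrite /hK; have [Ax|Ax] := pselect (A x.1).
    by rewrite (kt x.2) ?mulr0// => tx; apply: nx.
  by rewrite indicE memNset// mul0r.
rewrite [X in (X < _)%E](product_measure1E (@Leb2 R) nuS mA (mtail a)).
rewrite lte_mul_pinfty//.
  by rewrite ge0_fin_numE// bounded_Borel_lty.
exact: tail_lty.
Qed.

Let ip_hK a k a' k' A B : jump_fun a k -> jump_fun a' k' -> bounded_Borel A -> bounded_Borel B ->
  ip q (hK k A) (hK k' B) = fine (Leb2 (A `&` B)) * ip nu k k'.
Proof.
move=> jk jk' bA bB; have [mA _] := bA.
have bAB := bounded_BorelI mA bB; have [mAB _] := bAB.
transitivity (\int[q]_x (\1_(A `&` B) x.1 * (k x.2 * k' x.2))).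
  apply: eq_Rintegral => x _; rewrite indicI /hK/=; ring.
rewrite (prod_Rintegral (m1 := @Leb2 R) (m2 := nuS) (f := \1_(A `&` B)) (k := fun z => k z * k' z)).
- by congr (_ * _); rewrite /Rintegral integral_indic// setIT.
- exact: integrable_indic_Borel.
- exact: Lfun2_integrableM (jump_Lfun2 jk) (jump_Lfun2 jk').
Qed.

Let mean_hK a k A : jump_fun a k -> bounded_Borel A ->
  \int[q]_x hK k A x = fine (Leb2 A) * \int[nu]_z k z.
Proof.
move=> jk bA; have [mA _] := bA.
rewrite (prod_Rintegral (m1 := @Leb2 R) (m2 := nuS) (f := \1_A) (k := k)).
- by congr (_ * _); rewrite /Rintegral integral_indic// setIT.
- exact: integrable_indic_Borel.
- exact: jump_integrable jk.
Qed.

(** The white noise is centred and independent of the counts, hence orthogonal to them;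
    [prm_int_orth] carries this to the jump integrals. *)
Let W_orth A k a B : jump_fun a k -> bounded_Borel A -> bounded_Borel B ->
  ip P (W A) (prm_int N (hK k B)) = 0.
Proof.
move=> jk bA bB; apply: (prm_int_orth hNq (noise_Lfun2 gW bA)); last exact: prm_integrand_hK jk bB.
move=> C mC qC.
pose XC : {RV P >-> R} := HB.pack (prm_count N C) (isMeasurableFun.Build _ _ _ _ _ (measurable_prm_count N mC)).
rewrite (@ip_indep _ _ _ _ (W A) XC).
- by rewrite (noise_mean gW bA) mul0r.
- move=> U V mU mV; apply: WN; apply: sub_gen_smallest.
    by exists A, U; split.
  exists C, (fine @^-1` V); split => //.
  rewrite -[X in measurable X]setTI.
  have mf : measurable_fun [set: \bar R] (@fine R) by [].
  exact: mf.
- exact: noise_Lfun2.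
- exact: (prm_count_Lfun2 hNq).
Qed.

(** The small jumps above 1/(n+1), the large jumps, and their sum [kT n]: all jumps above 1/(n+1)
    enter through one Poisson integral. *)
Let kS n (z : R) := z * \1_[set z | `|z| <= 1] z * \1_(tail n.+1%:R^-1) z.
Let kL (z : R) := z * \1_(tail 1) z.
Let kT n (z : R) := z * \1_(tail n.+1%:R^-1) z.

Let indic_le (A : set R) z x : `|x * \1_A z| <= `|x| :> R.
Proof. by rewrite normrM indicE; case: (_ \in _); rewrite ?normr1 ?normr0 ?mulr1 ?mulr0. Qed.

Let jL : jump_fun 1 kL.
Proof.
split => //; first by apply: measurable_funM => //.
  by move=> z; exact: indic_le.
by move=> z tz; rewrite /kL indicE memNset// mulr0.
Qed.

Let jT n : jump_fun n.+1%:R^-1 (kT n).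
Proof.
split => //; first by apply: measurable_funM => //.
  by move=> z; exact: indic_le.
by move=> z tz; rewrite /kT indicE memNset// mulr0.
Qed.

Let kTE n z : kT n z = 1 * kS n z + 1 * kL z.
Proof.
rewrite !mul1r /kT /kS /kL !indicE; have [z1|z1] := leP `|z| 1.
  have -> : (z \in [set z0 | `|z0| <= 1]) = true by exact/mem_set.
  have -> : (z \in tail 1) = false by apply/negP => /set_mem; rewrite /tail/= ltNge z1.
  by rewrite mulr0 addr0 mulr1.
have -> : (z \in [set z0 | `|z0| <= 1]) = false.
  by apply/negP => /set_mem /=; rewrite leNgt z1.
rewrite mulr0 mul0r add0r !mem_set//.
by rewrite /tail/= (le_lt_trans _ z1)// invf_le1// ler1n.
Qed.

Let mle1 : measurable [set z : R | `|z| <= 1].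
Proof.
rewrite (_ : [set z | _] = ~` tail 1); first exact: measurableC.
by apply/seteqP; split => z /=; rewrite /tail/= => h; [apply/negP; rewrite -leNgt|rewrite leNgt; apply/negP].
Qed.

Let jS n : jump_fun n.+1%:R^-1 (kS n).
Proof.
split => //.
- by apply: measurable_funM => //; apply: measurable_funM => //.
- by move=> z; rewrite /kS (le_trans (indic_le _ _ _)).
- by move=> z tz; rewrite /kS [X in _ * X]indicE memNset// mulr0.
Qed.

(** The mean of [Lambda] per unit area: the compensated small jumps are centred, so that only the
    large ones add to beta. *)
Definition levy_drift : R := beta + \int[nu]_z kL z.
Notation m := levy_drift.

(** Approximates [Lambda A] by removing the jumps of size at most 1/(n+1); the constant [c n] takes
    up beta and the compensator. *)
Let U (c : nat -> R) A n w := sigma * W A w + (prm_int N (hK (kT n) A) w + c n).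

Let U_Lfun2 c A n : bounded_Borel A -> U c A n \in Lfun P 2%:E.
Proof.
move=> bA; apply: Lfun2D; first by apply: Lfun2Z; exact: noise_Lfun2.
apply: Lfun2D; last exact: Lfun2_cst.
by apply: (prm_int_Lfun2 hNq); exact: prm_integrand_hK (jT n) bA.
Qed.

(** The constant is beta Leb A minus the mean of the truncated small jumps. With it, the error is
    almost surely that of the compensated small jumps, which tends to 0 in mean square, and the mean
    is m Leb A for every n, not only in the limit. *)
Let levy_approx A : bounded_Borel A -> exists c : nat -> R,
  [/\ (Lambda A : T -> R) \in Lfun P 2%:E,
     forall n, c n + \int[q]_x hK (kT n) A x = m * fine (Leb2 A) &
     ip P (fun w => U c A n w - Lambda A w) (fun w => U c A n w - Lambda A w) @[n --> \oo] --> 0].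
Proof.
move=> bA; have [mA _] := bA; have [Z hZ hL] := hLambda bA.
pose mS n := \int[q]_x hK (kS n) A x.
pose V n w := prm_int N (hK (kS n) A) w - mS n - Z w.
have hV : ('E_P[fun w => (V n w ^+ 2)%R] @[n --> \oo] --> (0 : \bar R))%E.
  apply: cvg_trans hZ; apply: near_eq_cvg; apply: nearW => n; congr expectation; apply/funext => w; congr (_ ^+ 2).
  (* Restricting the domain to |z| > 1/(n+1) amounts to the last indicator in [kS n], for [N w] as
     well as for q. *)
  have E (mu : {measure set (R * R * R)%type -> \bar R}) :
    fine (\int[mu]_(x in [set x | (n.+1%:R^-1 < `|x.2|)%R])
      (\1_A x.1 * x.2 * \1_[set z | `|z| <= 1] x.2)%:E)%E = \int[mu]_x hK (kS n) A x.
    rewrite -[LHS]/(Rintegral _ _ _) Rintegral_mkcond; apply: eq_Rintegral => x _.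
    rewrite patchE /hK /kS [X in _ = _ * (_ * X)]indicE.
    rewrite (_ : (x.2 \in tail n.+1%:R^-1) = (x \in [set x | n.+1%:R^-1 < `|x.2|])); last first.
      by apply/idP/idP => /set_mem h; exact/mem_set.
    by case: ifPn => _; rewrite ?mulr1 ?mulr0// mulrA.
  by rewrite /V; congr (_ - _ - _); [exact: (E (N w))|exact: (E q)].
have mV n : measurable_fun setT (V n).
  apply: measurable_funB => //; apply: measurable_funB => //.
  exact: Lfun2_measurable (prm_int_Lfun2 hNq (prm_integrand_hK (jS n) bA)).
have hV' : (\int[P]_w (V n w ^+ 2)%:E @[n --> \oo] --> (0 : \bar R))%E.
  apply: cvg_trans hV; apply: near_eq_cvg; apply: nearW => n.
  by rewrite unlock.
have SL n := prm_int_Lfun2 hNq (prm_integrand_hK (jS n) bA).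
have LL := prm_int_Lfun2 hNq (prm_integrand_hK jL bA).
(* Z is known only as a limit. Convergence to 0 gives some error [V n] a finite second moment, and Z
   is a square-integrable variable minus that error. *)
have Z2 : (Z : T -> R) \in Lfun P 2%:E.
  have /fine_cvgP[[n _ /(_ n (leqnn n))/= Vn] _] := hV'.
  have Vn2 : V n \in Lfun P 2%:E by apply/Lfun2P; split => //; rewrite ltey_eq Vn.
  rewrite [X in X \in _](_ : _ = (fun w => prm_int N (hK (kS n) A) w - mS n - V n w)).
    exact: Lfun2B (Lfun2B (SL n) (Lfun2_cst P (mS n))) Vn2.
  by apply/funext => w; rewrite /V; ring.
have V2 n : V n \in Lfun P 2%:E by apply: Lfun2B => //; apply: Lfun2B (SL n) (Lfun2_cst P _).
have hL' : {ae P, forall w, beta * fine (Leb2 A) + sigma * W A w + Z w + prm_int N (hK kL A) w = Lambda A w}.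
  apply: filterS hL => w ->; congr (_ + _); rewrite /prm_int /Rintegral; congr fine.
  by apply: eq_integral => x _; congr EFin; rewrite /hK /kL mulrA.
have L2 : (Lambda A : T -> R) \in Lfun P 2%:E.
  apply: (Lfun2_ae _ hL') => //; apply: Lfun2D => //; apply: Lfun2D => //.
  apply: Lfun2D; first exact: Lfun2_cst.
  by apply: Lfun2Z; exact: noise_Lfun2.
exists (fun n => beta * fine (Leb2 A) - mS n); split => //.
  move=> n; rewrite /mS (mean_hK (jS n) bA) (mean_hK (jT n) bA).
  rewrite /levy_drift; set L := fine _.
  rewrite (_ : \int[nu]_z kT n z = \int[nu]_z kS n z + \int[nu]_z kL z); first by ring.
  rewrite -RintegralD//; [|exact: jump_integrable (jS n)|exact: jump_integrable jL].
  by apply: eq_Rintegral => z _; rewrite kTE !mul1r.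
have e n : ip P (fun w => U (fun n => beta * fine (Leb2 A) - mS n) A n w - Lambda A w)
    (fun w => U (fun n => beta * fine (Leb2 A) - mS n) A n w - Lambda A w) = ip P (V n) (V n).
  have mU : measurable_fun setT (fun w => U (fun n => beta * fine (Leb2 A) - mS n) A n w - Lambda A w).
    exact: Lfun2_measurable (Lfun2B (U_Lfun2 _ n bA) L2).
  have ae1 : {ae P, forall w, U (fun n => beta * fine (Leb2 A) - mS n) A n w - Lambda A w = V n w}.
    have := prm_int_lin hNq 1 1 (prm_integrand_hK (jS n) bA) (prm_integrand_hK jL bA).
    rewrite (_ : (fun z => _) = hK (kT n) A); last first.
      by apply/funext => x; rewrite /hK kTE; ring.
    apply: filterS2 hL' => w <- h; rewrite /U h /V; ring.
  exact: ip_ae.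
under eq_fun do rewrite e.
have /fine_cvgP[_ h] := hV'; apply: cvg_trans h; apply: near_eq_cvg; apply: nearW => n.
by rewrite /= integral_sqr_ip.
Qed.

Let U_mean c A n : bounded_Borel A -> c n + \int[q]_x hK (kT n) A x = m * fine (Leb2 A) ->
  ip P (fun=> 1) (U c A n) = m * fine (Leb2 A).
Proof.
move=> bA <-; have W2 := noise_Lfun2 gW bA.
have I2 := prm_int_Lfun2 hNq (prm_integrand_hK (jT n) bA).
rewrite ipDr ?ipZr ?ipDr ?Lfun2Z ?Lfun2D ?Lfun2_cst// !ip_cstl ?Lfun2_cst//.
rewrite (noise_mean gW bA) (prm_int_mean hNq (prm_integrand_hK (jT n) bA)) Rmean_cst; ring.
Qed.

(** Noise and jumps are orthogonal, the jumps contribute their covariance, and the constants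
    complete the product of the two means. *)
Let U_ip cA cB A B n : bounded_Borel A -> bounded_Borel B ->
  cA n + \int[q]_x hK (kT n) A x = m * fine (Leb2 A) ->
  cB n + \int[q]_x hK (kT n) B x = m * fine (Leb2 B) ->
  ip P (U cA A n) (U cB B n) = (sigma ^+ 2 + ip nu (kT n) (kT n)) * fine (Leb2 (A `&` B)) +
    m * fine (Leb2 A) * (m * fine (Leb2 B)).
Proof.
move=> bA bB <- <-; have WA2 := noise_Lfun2 gW bA; have WB2 := noise_Lfun2 gW bB.
have gA := prm_integrand_hK (jT n) bA; have gB := prm_integrand_hK (jT n) bB.
have IA2 := prm_int_Lfun2 hNq gA; have IB2 := prm_int_Lfun2 hNq gB.
have cA2 := Lfun2_cst P (cA n); have cB2 := Lfun2_cst P (cB n).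
have sA := Lfun2Z sigma WA2; have sB := Lfun2Z sigma WB2.
have rA := Lfun2D IA2 cA2; have rB := Lfun2D IB2 cB2.
have UB := U_Lfun2 cB n bB.
rewrite ipDl// ipDl// !ipDr// !ipZl// !ipZr//.
rewrite (noise_ip gW bA bB) (W_orth (jT n) bA bB).
rewrite [ip P (prm_int N _) (W B)]ipC (W_orth (jT n) bB bA).
rewrite [ip P _ (fun=> cB n)]ipC [ip P (prm_int N _) (fun=> cB n)]ipC.
rewrite !ip_cstl// (noise_mean gW bA) (noise_mean gW bB) (prm_int_ip hNq gA gB).
rewrite (prm_int_mean hNq gA) (prm_int_mean hNq gB) Rmean_cst.
rewrite (ip_hK (jT n) (jT n) bA bB); ring.
Qed.

Let kT_cvg : ip nu (kT n) (kT n) @[n --> \oo] --> ip nu (fun z => z) (fun z => z).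
Proof.
have e k : k \in Lfun nu 2%:E -> ip nu k k = fine (\int[nu]_z (k z ^+ 2)%:E)%E.
  by move=> k2; rewrite integral_sqr_ip.
rewrite e//; under eq_fun do rewrite (e _ (jump_Lfun2 (jT _))).
apply: fine_cvg; rewrite fineK; last first.
  by apply: integrable_fin_num => //; exact: Lfun2_integrable_sqr sqr2.
apply: ge0_cvg_integral.
- by move=> n; apply/measurable_EFinP; apply: measurable_funX; case: (jT n).
- by move=> n z; rewrite lee_fin sqr_ge0.
- move=> z n1 n2 n12; rewrite lee_fin /kT !exprMn ler_wpM2l ?sqr_ge0//.
  rewrite !indicE; have [h|h] := pselect (tail n1.+1%:R^-1 z); last first.
    by rewrite memNset// expr0n sqr_ge0.
  rewrite !mem_set//; rewrite /tail/= in h *; apply: le_lt_trans h.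
  by rewrite lef_pV2 ?posrE// ler_nat.
- move=> z; have [->|z0] := eqVneq z 0.
    by apply: cvg_near_cst; apply: nearW => n; rewrite /kT mul0r.
  have z0' : 0 < `|z| by rewrite normr_gt0.
  apply: cvg_near_cst; exists (Num.truncn `|z|^-1) => // n /= hn.
  rewrite /kT indicE mem_set ?mulr1// /tail/= invf_plt ?posrE//.
  by rewrite (lt_le_trans (truncnS_gt _))// ler_nat.
Qed.

Let kappaE : kappa2 sigma nu = sigma ^+ 2 + ip nu (fun z => z) (fun z => z).
Proof. by rewrite /kappa2 integral_sqr_ip. Qed.

Lemma levy_Lfun2_aux A : bounded_Borel A -> (Lambda A : T -> R) \in Lfun P 2%:E.
Proof. by move=> /levy_approx[c []]. Qed.

Lemma levy_mean_aux A : bounded_Borel A -> \int[P]_w Lambda A w = levy_drift * fine (Leb2 A).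
Proof.
move=> bA; have [c [L2 cE cv]] := levy_approx bA.
rewrite -[LHS]mul1r -ip_cstl// ipC.
have := ip_cvgl (fun n => U_Lfun2 c n bA) L2 (Lfun2_cst P 1) cv.
under eq_fun do rewrite ipC (U_mean bA (cE _)).
by move=> h; rewrite -(cvg_lim _ h)//; exact: lim_cst.
Qed.

Lemma levy_ip_aux A B : bounded_Borel A -> bounded_Borel B ->
  ip P (Lambda A) (Lambda B) = kappa2 sigma nu * fine (Leb2 (A `&` B)) +
    levy_drift * fine (Leb2 A) * (levy_drift * fine (Leb2 B)).
Proof.
move=> bA bB; have [cA [LA2 cAE cvA]] := levy_approx bA; have [cB [LB2 cBE cvB]] := levy_approx bB.
have := ip_cvg (fun n => U_Lfun2 cA n bA) LA2 (fun n => U_Lfun2 cB n bB) LB2 cvA cvB.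
under eq_fun do rewrite (U_ip bA bB (cAE _) (cBE _)).
move=> h; rewrite -(cvg_lim _ h)//; apply: cvg_lim => //.
rewrite kappaE; apply: cvgD; last exact: cvg_cst.
apply: cvgMl; apply: cvgD => //; exact: cvg_cst.
Qed.

End levy.

Lemma levy_basis_moments d (T : measurableType d) (R : realType) (P : probability T R)
    (beta sigma : R) (nu : {measure set R -> \bar R}) (Lambda : set (R * R) -> {RV P >-> R}) :
  homogeneous_levy_basis beta sigma nu Lambda -> finite_second_moment nu ->
  exists m : R, [/\ forall A, bounded_Borel A -> (Lambda A : T -> R) \in Lfun P 2%:E,
    forall A, bounded_Borel A -> \int[P]_w Lambda A w = m * fine (Leb2 A) &
    forall A B, bounded_Borel A -> bounded_Borel B ->
      ip P (Lambda A) (Lambda B) = kappa2 sigma nu * fine (Leb2 (A `&` B)) +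
        m * fine (Leb2 A) * (m * fine (Leb2 B))].
Proof.
move=> [s0 nul [W [N [gW hN WN hL]]]] nu2.
exists (levy_drift beta nu); split.
- move=> A bA; exact: (levy_Lfun2_aux nu2 nul gW hN hL).
- move=> A bA; exact: (levy_mean_aux nu2 nul gW hN hL).
- move=> A B bA bB; exact: (levy_ip_aux nu2 nul gW hN WN hL).
Qed.

(** * Convergence in probability against convergence in mean square *)

Section prob_tools.
Context d (T : measurableType d) (R : realType) (P : probability T R).
Implicit Types X Y Z : T -> R.

Definition tail_prob (e : R) X : \bar R := P [set w | e <= `|X w|].

Lemma measurable_tail_prob (e : R) X : measurable_fun setT X -> measurable [set w | e <= `|X w|].
Proof.
move=> mX; rewrite -[X in measurable X]setTI; apply: measurable_fun_le => //.
exact: measurableT_comp.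
Qed.

Lemma tail_prob_le_add (e e1 e2 : R) X Y Z : measurable_fun setT X -> measurable_fun setT Y ->
  measurable_fun setT Z -> e1 + e2 <= e -> (forall w, `|X w| <= `|Y w| + `|Z w|) ->
  (tail_prob e X <= tail_prob e1 Y + tail_prob e2 Z)%E.
Proof.
move=> mX mY mZ ee XYZ.
apply: (@le_trans _ _ (P ([set w | e1 <= `|Y w|] `|` [set w | e2 <= `|Z w|]))).
  apply: le_measure; rewrite ?inE; [exact: measurable_tail_prob| |].
    by apply: measurableU; exact: measurable_tail_prob.
  move=> w /= eX; have [Y1|Y1] := leP e1 `|Y w|; [by left|right].
  by have := XYZ w; rewrite /=; lra.
by apply: measureU2; exact: measurable_tail_prob.
Qed.

Lemma chebyshev_ip (e : R) X : 0 < e -> X \in Lfun P 2%:E -> (tail_prob e X <= (ip P X X / e ^+ 2)%:E)%E.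
Proof.
move=> e0 X2; have mX := Lfun2_measurable X2.
have e20 : 0 < e ^+ 2 by rewrite exprn_gt0.
have mf : measurable_fun setT (fun w => (X w ^+ 2)%:E).
  by apply/measurable_EFinP; exact: measurable_funX.
have := le_integral_abse P measurableT mf e20; rewrite setTI.
under eq_integral do rewrite /= ger0_norm ?sqr_ge0//.
rewrite integral_sqr_ip// => h.
have fX : tail_prob e X \is a fin_num by rewrite fin_num_measure//; exact: measurable_tail_prob.
rewrite -(fineK fX) lee_fin ler_pdivlMr// mulrC -lee_fin EFinM fineK//; apply: le_trans h.
rewrite lee_pmul2l ?lte_fin//; apply: le_measure; rewrite ?inE.
- exact: measurable_tail_prob.
- rewrite -[X in measurable X]setTI.
  by apply: measurable_lee => //; apply: measurableT_comp.
- move=> w /= eX; rewrite lee_fin ger0_norm ?sqr_ge0// -(real_normK (num_real (X w))).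
  by rewrite ler_sqr ?nnegrE// ltW.
Qed.

(** A form of Fatou's lemma without almost surely convergent subsequences: (U_n - Y)^2 is truncated
    at K, U_k replaces Y off the event |U_k - Y| >= dl, with k depending on K, and K tends to
    infinity last. *)
Lemma prob_L2_complete (U : nat -> T -> R) Y :
  (forall n, U n \in Lfun P 2%:E) -> measurable_fun setT Y ->
  (forall e : R, 0 < e -> tail_prob e (fun w => U n w - Y w) @[n --> \oo] --> 0%E) ->
  (forall e : R, 0 < e -> exists n0, forall n k, (n0 <= n)%N -> (n0 <= k)%N ->
     ip P (fun w => U n w - U k w) (fun w => U n w - U k w) <= e) ->
  Y \in Lfun P 2%:E /\ ip P (fun w => U n w - Y w) (fun w => U n w - Y w) @[n --> \oo] --> 0.
Proof.
move=> U2 mY UY Uc.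
have mU n : measurable_fun setT (U n) by exact: Lfun2_measurable.
have mD n : measurable_fun setT (fun w => U n w - Y w) by exact: measurable_funB.
have key (e : R) : 0 < e -> exists n0, forall n, (n0 <= n)%N ->
    (\int[P]_w ((U n w - Y w) ^+ 2)%:E <= e%:E)%E.
  move=> e0; have e4 : 0 < e / 4 by rewrite divr_gt0.
  have [n0 hn0] := Uc _ e4; exists n0 => n n0n.
  pose F (K : nat) w := (Num.min ((U n w - Y w) ^+ 2) K%:R)%:E.
  have mF K : measurable_fun setT (F K).
    by apply/measurable_EFinP; apply: measurable_minr => //; exact: measurable_funX.
  have F0 K w : (0 <= F K w)%E by rewrite lee_fin le_min sqr_ge0/=.
  have c : (\int[P]_w F K w @[K --> \oo] --> \int[P]_w ((U n w - Y w) ^+ 2)%:E)%E.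
    apply: ge0_cvg_integral => //.
    - move=> w K L KL; rewrite lee_fin le_min ge_min lexx/= ge_min.
      by rewrite ler_nat KL orbT.
    - move=> w; apply: cvg_near_cst; exists (Num.truncn ((U n w - Y w) ^+ 2)).+1 => // K /= hK.
      rewrite /F; congr EFin; apply/min_idPl; apply: ltW; apply: lt_le_trans (truncnS_gt _) _.
      by rewrite ler_nat.
  suff FK K : (\int[P]_w F K w <= e%:E)%E.
    rewrite -(cvg_lim _ c)//; apply: lime_le; last exact: nearW.
    by apply/cvg_ex; eexists; exact: c.
  (* The budget e is spent as 2 dl^2 = e/4, twice e/4 for the Cauchy term, and e/4 for K times the
     probability of the bad event. Dividing by K + 1 covers K = 0. *)
  pose dl := Num.sqrt (e / 8); have dl0 : 0 < dl by rewrite sqrtr_gt0 divr_gt0.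
  have K1 : 0 < K.+1%:R :> R by rewrite ltr0n.
  have e8 : 0 < e / 4 / K.+1%:R by rewrite divr_gt0.
  have /fine_cvgP[Pfin /cvgrPdist_lt /(_ _ e8) Pcv] := UY _ dl0.
  near \oo => k.
  have n0k : (n0 <= k)%N by near: k; exact: nbhs_infty_ge.
  have pk : (tail_prob dl (fun w => (U k w - Y w)%R) <= (e / 4 / K.+1%:R)%:E)%E.
    have fk : tail_prob dl (fun w => U k w - Y w) \is a fin_num by near: k.
    rewrite -(fineK fk) lee_fin ltW//.
    have : `|0 - fine (tail_prob dl (fun w => U k w - Y w))| < e / 4 / K.+1%:R by near: k.
    by rewrite sub0r normrN; apply: le_lt_trans; exact: ler_norm.
  have UU2 := Lfun2B (U2 n) (U2 k).
  pose B := [set w | dl <= `|U k w - Y w|].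
  have mB : measurable B by exact: measurable_tail_prob.
  apply: (@le_trans _ _ (\int[P]_w ((2 * dl ^+ 2 + 2 * (U n w - U k w) ^+ 2) + K%:R * \1_B w)%:E)%E).
    apply: ge0_le_integral => //.
    - apply/measurable_EFinP; apply: measurable_funD.
        apply: measurable_funD => //; apply: measurable_funM => //.
        by apply: measurable_funX; exact: measurable_funB.
      by apply: measurable_funM.
    - move=> w _; rewrite /F lee_fin ge_min.
      have [Bw|Bw] := pselect (B w).
        rewrite [\1_B w]indicE mem_set// mulr1; apply/orP; right.
        by rewrite lerDr addr_ge0// mulr_ge0// sqr_ge0.
      rewrite [\1_B w]indicE memNset// mulr0 addr0; apply/orP; left.
      have : `|U k w - Y w| < dl by rewrite ltNge; apply/negP.
      rewrite ltr_norml => /andP[h1 h2].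
      have : (U k w - Y w) ^+ 2 <= dl ^+ 2 by nra.
      have := sqr_ge0 ((U n w - U k w) - (U k w - Y w)); nra.
  have i1 : P.-integrable setT (EFin \o (fun w => 2 * dl ^+ 2 + 2 * (U n w - U k w) ^+ 2)).
    have := Lfun2_integrable (Lfun2_cst P (2 * dl ^+ 2)) => i1.
    have i2 := integrableZl measurableT 2 (Lfun2_integrable_sqr UU2).
    exact: (integrableD measurableT i1 i2).
  have i3 : P.-integrable setT (EFin \o (fun w => K%:R * \1_B w)).
    have i3 : P.-integrable setT (EFin \o \1_B) by exact: integrable_indic.
    exact: (integrableZl measurableT K%:R i3).
  rewrite (_ : integral _ _ _ = (2 * dl ^+ 2 + 2 * ip P (fun w => U n w - U k w) (fun w => U n w - U k w) + K%:R * fine (P B))%:E).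
    rewrite lee_fin sqr_sqrtr; last by rewrite divr_ge0// ltW.
    have h1 := hn0 n k n0n n0k.
    have h2 : K%:R * fine (P B) <= e / 4.
      apply: (@le_trans _ _ (K.+1%:R * (e / 4 / K.+1%:R))).
        apply: ler_pM => //; first by rewrite fine_ge0.
          by rewrite ler_nat.
        by rewrite -lee_fin fineK// fin_num_measure.
      by rewrite mulrC divfK// gt_eqF.
    lra.
  rewrite -[LHS](fineK) -?[X in X%:E = _]/(Rintegral _ _ _); last first.
    apply: integrable_fin_num => //.
    exact: (integrableD measurableT i1 i3).
  congr EFin; rewrite RintegralD// RintegralZl//; last exact: integrable_indic.
  rewrite RintegralD//; last 2 first.
  - exact: Lfun2_integrable (Lfun2_cst P _).
  - exact: (integrableZl measurableT 2 (Lfun2_integrable_sqr UU2)).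
  rewrite Rmean_cst RintegralZl//; last exact: Lfun2_integrable_sqr UU2.
  congr (_ + _ + _).
  by congr (_ * _); rewrite /Rintegral integral_indic// setIT.
have D2 : exists n0, forall n, (n0 <= n)%N -> (fun w => U n w - Y w) \in Lfun P 2%:E.
  have [n0 h] := key 1 ltr01; exists n0 => n n0n; apply/Lfun2P; split => //.
  by rewrite (le_lt_trans (h n n0n))// ltry.
have Y2 : Y \in Lfun P 2%:E.
  have [n0 h] := D2.
  rewrite [X in X \in _](_ : _ = (fun w => U n0 w - (U n0 w - Y w))).
    exact: Lfun2B (h n0 (leqnn _)).
  by apply/funext => w; ring.
split => //; apply/cvgrPdist_le => e e0.
have [n0 h] := key e e0; exists n0 => // n /= n0n.
rewrite sub0r normrN ger0_norm ?ip_ge0// -lee_fin -integral_sqr_ip; first exact: h.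
exact: Lfun2B.
Unshelve. all: by end_near. Qed.

End prob_tools.

(** * Vanishing of set functions controlled by submeasures *)

Section gliding_hump.
Context d (T : measurableType d) (R : realType) (P : probability T R).
Context d' (E : measurableType d').
Variables (M : nat -> set E -> T -> R) (v : nat -> set E -> \bar R) (D : nat -> set E).
Hypothesis mM : forall n A, measurable A -> measurable_fun setT (M n A).
Hypothesis vS : forall n A B, measurable A -> measurable B -> A `<=` B -> (v n A <= v n B)%E.
Hypothesis vU : forall n A B, measurable A -> measurable B -> (v n (A `|` B) <= v n A + v n B)%E.
Hypothesis Mv : forall e : R, 0 < e -> exists2 h : R, 0 < h &
  forall n A B, measurable A -> measurable B -> B `<=` A -> (v n (A `\` B) <= h%:E)%E ->
    (tail_prob P e (fun w => (M n A w - M n B w)%R) <= e%:E)%E.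
Hypothesis Mv0 : forall e : R, 0 < e -> exists2 h : R, 0 < h &
  forall n A, measurable A -> (v n A <= h%:E)%E -> (tail_prob P e (M n A) <= e%:E)%E.
Hypothesis Mcauchy : forall A (e : R), measurable A -> 0 < e -> exists n0, forall n k,
  (n0 <= n)%N -> (n0 <= k)%N -> (tail_prob P e (fun w => (M n A w - M k A w)%R) <= e%:E)%E.
Hypothesis mD : forall j, measurable (D j).
Hypothesis ndD : forall i j, (i <= j)%N -> D i `<=` D j.
Hypothesis Dv : forall j (h : R), 0 < h -> exists n0, forall n, (n0 <= n)%N -> (v n (D j) <= h%:E)%E.
Hypothesis DCv : forall n (h : R), 0 < h -> exists j0, forall j, (j0 <= j)%N -> (v n (~` D j) <= h%:E)%E.

(* If M n setT did not tend to 0, one could pick indices n_k and shells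
   D (j_k.+1) `\` D j_k that carry almost all of M n_k.+1; on the union of every
   other shell the sequence would then not be Cauchy. *)
Lemma gliding_hump (e : R) : 0 < e -> tail_prob P e (M n setT) @[n --> \oo] --> 0%E.
Proof.
move=> e0.
have finP n (A : set E) a : measurable A -> tail_prob P a (M n A) \is a fin_num.
  by move=> mA; rewrite fin_num_measure//; apply: measurable_tail_prob; exact: mM.
apply/fine_cvgP; split; first by apply: nearW => n; exact: finP.
apply/cvgrPdist_lt => dl dl0; apply: contrapT => nh.
have bad n0 : exists n, (n0 <= n)%N /\ (dl%:E <= tail_prob P e (M n setT))%E.
  apply: contrapT => nn; apply: nh; exists n0 => // n /= n0n.
  rewrite sub0r normrN ger0_norm ?fine_ge0// ltNge; apply/negP => h; apply: nn.
  by exists n; split => //; rewrite -(fineK (finP n setT e measurableT)) lee_fin.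
(* Three tails at level a <= e/3 will be added up, with total probability at most 3 dl / 4 < dl. *)
pose a := Num.min (e / 3) (dl / 4).
have a0 : 0 < a by rewrite lt_min !divr_gt0.
have ae : a <= e / 3 by rewrite ge_min lexx.
have adl : a <= dl / 4 by rewrite ge_min lexx orbT.
have [ha ha0 hM1] := Mv a0; have [hb hb0 hM2] := Mv0 a0.
pose h := Num.min ha hb; have h0 : 0 < h by rewrite lt_min ha0.
have hM n A B : measurable A -> measurable B -> B `<=` A -> (v n (A `\` B) <= h%:E)%E ->
    (tail_prob P a (fun w => (M n A w - M n B w)%R) <= a%:E)%E.
  move=> mA mB BA hv; apply: hM1 => //; apply: le_trans hv _.
  by rewrite lee_fin ge_min lexx.
have hM0 n A : measurable A -> (v n A <= h%:E)%E -> (tail_prob P a (M n A) <= a%:E)%E.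
  move=> mA hv; apply: hM2 => //; apply: le_trans hv _.
  by rewrite lee_fin ge_min lexx orbT.
have h20 : 0 < h / 2 by rewrite divr_gt0.
(* From a state (n, j), a bad index r.1 > n with little mass on D j is chosen, and then r.2 so large
   that little of its mass lies off D r.2. *)
have step (p : nat * nat) : exists r : nat * nat, [/\ (p.1 < r.1)%N, (p.2 <= r.2)%N,
    (dl%:E <= tail_prob P e (M r.1 setT))%E, (v r.1 (D p.2) <= (h / 2)%:E)%E &
    (v r.1 (~` D r.2) <= (h / 2)%:E)%E].
  have [n1 hn1] := Dv p.2 h20.
  have [n [nn1 nbad]] := bad (maxn p.1.+1 n1).
  move: nn1; rewrite geq_max => /andP[pn n1n].
  have [j1 hj1] := DCv n h20.
  exists (n, maxn p.2 j1); split => //=; first exact: leq_maxl.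
    exact: hn1.
  by apply: hj1; exact: leq_maxr.
have [f hf] := choice step.
pose s k := iter k f (0%N, 0%N).
have hs k := hf (s k).
(* [n_] is shifted by one against [j_], so that nearly all the mass of index [n_ k] lies between D
   (j_ k) and D (j_ k.+1). *)
pose n_ k := (s k.+1).1; pose j_ k := (s k).2.
have n_ge k : (k <= n_ k)%N.
  by rewrite /n_; elim: k => // k ih; have [h1 _ _ _ _] := hs k.+1; exact: leq_ltn_trans h1.
have ndj i k : (i <= k)%N -> (j_ i <= j_ k)%N.
  elim: k => [|k ih]; first by rewrite leqn0 => /eqP ->.
  rewrite leq_eqVlt => /predU1P[->//|]; rewrite ltnS => /ih h1.
  by have [_ h2 _ _ _] := hs k; exact: leq_trans h1 h2.
pose A := \bigcup_(k in [set k | ~~ odd k]) (D (j_ k.+1) `\` D (j_ k)).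
have mA : measurable A.
  by apply: bigcup_measurable => k _; exact: measurableD.
have small k B : measurable B -> B `<=` D (j_ k) `|` ~` D (j_ k.+1) -> (v (n_ k) B <= h%:E)%E.
  move=> mB BD; have [_ _ _ h1 h2] := hs k.
  apply: le_trans (vS _ mB (measurableU _ _ (mD _) (measurableC (mD _))) BD) _.
  apply: le_trans (vU _ (mD _) (measurableC (mD _))) _.
  by rewrite (splitr h) EFinD; exact: leeD.
have even_k k : ~~ odd k -> (tail_prob P a (fun w => (M (n_ k) setT w - M (n_ k) A w)%R) <= a%:E)%E.
  move=> ek; apply: hM => //; apply: small; first exact: measurableD.
  move=> x [_ Ax]; have [Dx|Dx] := pselect (D (j_ k) x); [by left|right => Dx'].
  by apply: Ax; exists k.
have odd_k k : odd k -> (tail_prob P a (M (n_ k) A) <= a%:E)%E.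
  move=> ok; apply: hM0 => //; apply: small => // x [i /= ei [Dx nDx]]; have [ik|ki|ik] := ltngtP i k.
  - by left; apply: ndD Dx; exact: ndj.
  - by right => Dx'; apply: nDx; apply: ndD Dx'; exact: ndj.
  - by rewrite ik ok in ei.
have [n0 hn0] := Mcauchy mA a0.
(* An even k and its successor: [A] carries nearly all of [M (n_ k)] and almost nothing of
   [M (n_ k.+1)], against the Cauchy property on [A]. *)
pose k := n0.*2; have ek : ~~ odd k by rewrite odd_double.
have n0k : (n0 <= k)%N by rewrite /k -addnn leq_addr.
have h1 := even_k _ ek; have h2 := odd_k k.+1 ek.
have h3 := hn0 _ _ (leq_trans n0k (n_ge k)) (leq_trans (leqW n0k) (n_ge k.+1)).
have [_ _ hbad _ _] := hs k.
have mT n := mM n measurableT; have mMA n := mM n mA.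
have m1 : measurable_fun setT (fun w => M (n_ k) setT w - M (n_ k) A w) by exact: measurable_funB.
have m3 : measurable_fun setT (fun w => M (n_ k) A w - M (n_ k.+1) A w) by exact: measurable_funB.
have m4 : measurable_fun setT (fun w => (M (n_ k) A w - M (n_ k.+1) A w) + M (n_ k.+1) A w).
  exact: measurable_funD.
have : (tail_prob P e (M (n_ k) setT) <= a%:E + (a%:E + a%:E))%E.
  apply: le_trans (tail_prob_le_add P (e := e) (e1 := a) (e2 := a + a) (mT _) m1 m4 _ _) _.
  - by move: ae; lra.
  - by move=> w; rewrite -[X in `|X| <= _](subrK (M (n_ k) A w)) (le_trans (ler_normD _ _))// lerD2l subrK.
  apply: leeD h1 _.
  apply: le_trans (tail_prob_le_add P (e := a + a) (e1 := a) (e2 := a) m4 m3 (mMA _) _ _) _ => //.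
    by move=> w; exact: ler_normD.
  exact: leeD.
move=> /(le_trans hbad); rewrite -!EFinD lee_fin => h4.
by move: adl dl0 h4; lra.
Qed.

End gliding_hump.

Import HBSimple.

(** * Finite sums of values of the basis, and their kernels *)

Section levy_sums.
Context d (T : measurableType d) (R : realType) (P : probability T R).
Variables (Lambda : set (R * R) -> {RV P >-> R}) (m kappa : R).
Hypothesis Lambda_Lfun2 : forall A, bounded_Borel A -> (Lambda A : T -> R) \in Lfun P 2%:E.
Hypothesis Lambda_mean : forall A, bounded_Borel A -> \int[P]_w Lambda A w = m * fine (Leb2 A).
Hypothesis Lambda_ip : forall A B, bounded_Borel A -> bounded_Borel B ->
  ip P (Lambda A) (Lambda B) = kappa * fine (Leb2 (A `&` B)) +
    m * fine (Leb2 A) * (m * fine (Leb2 B)).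
Notation leb := (@Leb2 R).

(* A finite sum of multiples of [Lambda A], together with the simple function it
   integrates. *)
Inductive levy_sum : (T -> R) -> (R * R -> R) -> Prop :=
| levy_sum0 : levy_sum (fun=> 0) (fun=> 0)
| levy_sum_add c A X f : bounded_Borel A -> levy_sum X f ->
    levy_sum (fun w => c * Lambda A w + X w) (fun x => c * \1_A x + f x).

Lemma levy_sumD X f Y g : levy_sum X f -> levy_sum Y g ->
  levy_sum (fun w => X w + Y w) (fun x => f x + g x).
Proof.
move=> Xf Yg; elim: Xf => [|c A {}X {}f bA _ ih].
  by under eq_fun do rewrite add0r; under [X in levy_sum _ X]eq_fun do rewrite add0r.
under eq_fun do rewrite -addrA; under [X in levy_sum _ X]eq_fun do rewrite -addrA.
exact: levy_sum_add.
Qed.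

Lemma levy_sumZ a X f : levy_sum X f -> levy_sum (fun w => a * X w) (fun x => a * f x).
Proof.
elim=> [|c A {}X {}f bA _ ih].
  under eq_fun do rewrite mulr0; under [X in levy_sum _ X]eq_fun do rewrite mulr0.
  exact: levy_sum0.
under eq_fun do rewrite mulrDr mulrA; under [X in levy_sum _ X]eq_fun do rewrite mulrDr mulrA.
exact: levy_sum_add.
Qed.

Lemma levy_sumB X f Y g : levy_sum X f -> levy_sum Y g ->
  levy_sum (fun w => X w - Y w) (fun x => f x - g x).
Proof.
move=> Xf /(levy_sumZ (-1)) /(levy_sumD Xf).
by under eq_fun do rewrite mulN1r; under [X in levy_sum _ X]eq_fun do rewrite mulN1r.
Qed.

Lemma levy_sum_sum (I : eqType) (s : seq I) (X : I -> T -> R) (f : I -> R * R -> R) :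
  (forall i, i \in s -> levy_sum (X i) (f i)) ->
  levy_sum (fun w => \sum_(i <- s) X i w) (fun x => \sum_(i <- s) f i x).
Proof.
elim: s => [|i s ih] h.
  under eq_fun do rewrite big_nil; under [X in levy_sum _ X]eq_fun do rewrite big_nil.
  exact: levy_sum0.
under eq_fun do rewrite big_cons; under [X in levy_sum _ X]eq_fun do rewrite big_cons.
apply: levy_sumD; first by apply: h; rewrite mem_head.
by apply: ih => j js; apply: h; rewrite in_cons js orbT.
Qed.

(** Only the nonzero values contribute, and their level sets within A are bounded. *)
Lemma levy_sum_simple (f : {sfun (R * R)%type >-> R}) A : measurable A -> bounded_set (A `&` [set s | f s != 0]) ->
  levy_sum (simple_levy_integral Lambda f A) (fun x => f x * \1_A x).
Proof.
move=> mA bf.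
have b x : x \in supp_range f -> bounded_Borel (A `&` f @^-1` [set x]).
  move=> /supp_range_neq0 x0; split; first by apply: measurableI => //; exact: measurable_sfunP.
  have [M [Mr bM]] := bf; exists M; split => // y My z [Az /= fz].
  by apply: (bM _ My); split => //=; rewrite fz.
have -> : simple_levy_integral Lambda f A =
    (fun w => \sum_(x <- supp_range f) x * Lambda (A `&` f @^-1` [set x]) w).
  apply/funext => w; rewrite /simple_levy_integral.
  rewrite (@fsbigE _ _ _ _ _ (supp_range f)) ?supp_range_uniq//.
  - by rewrite [LHS]big_seq_cond [RHS]big_seq; apply: eq_bigl => x; rewrite andb_idr// mem_filter in_fset_set// => /andP[_ ->].
  - by move=> x; rewrite /= /supp_range mem_filter in_fset_set// => /andP[_ /set_mem].
  - move=> x fx; rewrite mem_filter in_fset_set// mem_set// andbT negbK => /eqP ->.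
    by rewrite mul0r.
have -> : (fun x => f x * \1_A x) =
    (fun z => \sum_(x <- supp_range f) x * \1_(A `&` f @^-1` [set x]) z).
  apply/funext => z; rewrite -[f z]/(idfun (f z)) simple_decomp// mulr_suml.
  by apply: eq_bigr => x _; rewrite indicI mulrAC -mulrA mulrC.
apply: levy_sum_sum => x xf.
have := levy_sum_add x (b x xf) levy_sum0.
by under eq_fun do rewrite addr0; under [X in levy_sum _ X]eq_fun do rewrite addr0.
Qed.

Lemma indic_Lfun2 A : bounded_Borel A -> (\1_A : R * R -> R) \in Lfun leb 2%:E.
Proof.
move=> bA; have [mA _] := bA; apply/Lfun2P; split => //.
rewrite (eq_integral (fun x => (\1_A x)%:E)); last first.
  by move=> x _; rewrite indicE; case: (_ \in _); rewrite ?expr1n ?expr0n.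
by rewrite integral_indic// setIT bounded_Borel_lty.
Qed.

Lemma levy_sum_Lfun2 X f : levy_sum X f -> X \in Lfun P 2%:E.
Proof.
elim=> [|c A {}X {}f bA _ ih]; first exact: Lfun2_0.
by apply: Lfun2D => //; apply: Lfun2Z; exact: Lambda_Lfun2.
Qed.

Lemma levy_sum_kernel_Lfun2 X f : levy_sum X f -> f \in Lfun leb 2%:E.
Proof.
elim=> [|c A {}X {}f bA _ ih]; first exact: Lfun2_0.
by apply: Lfun2D => //; apply: Lfun2Z; exact: indic_Lfun2.
Qed.

Lemma levy_sum_integrable X f : levy_sum X f -> leb.-integrable setT (EFin \o f).
Proof.
elim=> [|c A {}X {}f bA _ ih].
  by rewrite (_ : _ \o _ = cst 0%E)//; exact: integrable0.
have h := integrableZl measurableT c (integrable_indic_Borel bA).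
exact: (integrableD measurableT h ih).
Qed.

Lemma levy_sum_mean X f : levy_sum X f -> \int[P]_w X w = m * \int[leb]_x f x.
Proof.
elim=> [|c A {}X {}f bA Xf ih].
  by rewrite !Rintegral_cst// !mul0r mulr0.
have [mA _] := bA.
have iL := Lfun2_integrable (Lambda_Lfun2 bA).
have i1 := integrableZl measurableT c (integrable_indic_Borel bA).
have i2 := integrableZl measurableT c iL.
rewrite RintegralD//; last exact: Lfun2_integrable (levy_sum_Lfun2 Xf).
rewrite RintegralZl// Lambda_mean// ih RintegralD//; last exact: levy_sum_integrable Xf.
rewrite RintegralZl//; last exact: integrable_indic_Borel.
have -> : \int[leb]_x \1_A x = fine (leb A) by rewrite /Rintegral integral_indic// setIT.
ring.
Qed.

(** Bilinear extension of [Lambda_ip], by induction on Y against a single set and then on X. The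
    moments are computed along the representations, so that no agreement between sums with the same
    kernel is presupposed. *)
Lemma levy_sum_ip X f Y g : levy_sum X f -> levy_sum Y g ->
  ip P X Y = kappa * ip leb f g + m * \int[leb]_x f x * (m * \int[leb]_x g x).
Proof.
move=> Xf Yg.
have iE A : bounded_Borel A -> \int[leb]_x \1_A x = fine (leb A).
  by move=> [mA _]; rewrite /Rintegral integral_indic// setIT.
have i0 (mu : {measure set (R * R) -> \bar R}) (h : R * R -> R) : ip mu (fun=> 0) h = 0.
  by rewrite /ip; under eq_Rintegral do rewrite mul0r; rewrite Rintegral_cst// mul0r.
have zero : \int[leb]_x (0 : R) = 0 by rewrite Rintegral_cst// mul0r.
have LY A : bounded_Borel A -> ip P (Lambda A) Y =
    kappa * ip leb (\1_A) g + m * fine (leb A) * (m * \int[leb]_x g x).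
  move=> bA; elim: Yg => [|c B {}Y {}g bB Yg ih].
    rewrite ipC (ipC leb) i0 zero /ip; under eq_Rintegral do rewrite mul0r.
    by rewrite Rintegral_cst// !mul0r !mulr0 addr0.
  have L2 := Lambda_Lfun2 bB; have LA2 := Lambda_Lfun2 bA.
  rewrite ipDr ?ipZr ?Lfun2Z ?(levy_sum_Lfun2 Yg)// Lambda_ip// ih.
  rewrite ipDr ?ipZr ?Lfun2Z ?indic_Lfun2 ?(levy_sum_kernel_Lfun2 Yg)//.
  have -> : ip leb (\1_A) (\1_B) = fine (leb (A `&` B)).
    rewrite -iE; last by apply: bounded_BorelI => //; case: bA.
    by apply: eq_Rintegral => x _; rewrite indicI.
  rewrite RintegralD//; last 2 first.
  - exact: (integrableZl measurableT c (integrable_indic_Borel bB)).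
  - exact: levy_sum_integrable Yg.
  by rewrite RintegralZl ?iE//; [ring|exact: integrable_indic_Borel].
have Y2 := levy_sum_Lfun2 Yg; have g2 := levy_sum_kernel_Lfun2 Yg.
elim: Xf => [|c A {}X {}f bA Xf ih].
  rewrite i0 zero /ip; under eq_Rintegral do rewrite mul0r.
  by rewrite Rintegral_cst// !(mul0r, mulr0) addr0.
have L2 := Lambda_Lfun2 bA.
rewrite ipDl ?ipZl ?Lfun2Z ?(levy_sum_Lfun2 Xf)// LY// ih.
rewrite ipDl ?ipZl ?Lfun2Z ?indic_Lfun2 ?(levy_sum_kernel_Lfun2 Xf)//.
rewrite RintegralD//; last 2 first.
- exact: (integrableZl measurableT c (integrable_indic_Borel bA)).
- exact: levy_sum_integrable Xf.
by rewrite RintegralZl ?iE//; [ring|exact: integrable_indic_Borel].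
Qed.

End levy_sums.

Lemma dominated_cvg0 d (T : measurableType d) (R : realType) (mu : {measure set T -> \bar R})
    (F : nat -> T -> R) (G : T -> R) :
  (forall n, measurable_fun setT (F n)) -> {ae mu, forall x, F n x @[n --> \oo] --> 0} ->
  mu.-integrable setT (EFin \o G) -> (forall n x, `|F n x| <= G x) ->
  (\int[mu]_x (F n x)%:E @[n --> \oo] --> 0)%E.
Proof.
move=> mF F0 iG FG.
have [||||_ _] := @dominated_convergence _ _ _ mu setT measurableT (fun n => EFin \o F n)
    (cst 0%E) (EFin \o G) _ _ _ iG.
- by move=> n; exact/measurable_EFinP.
- by [].
- apply: filterS F0 => x Fx _; exact: (cvg_comp _ _ Fx).
- by apply: nearW => x n _; rewrite lee_fin.
by rewrite integral0.
Qed.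

Section levy_sum_approximation.
Context d (T : measurableType d) (R : realType) (P : probability T R).
Variables (Lambda : set (R * R) -> {RV P >-> R}).
Notation leb := (@Leb2 R).

(** Restricting simple approximations to growing squares makes their supports bounded; the two signs
    are treated apart. Integrals over every Borel set are kept because the gliding hump compares
    sequences set by set, and |h_n| <= |f| supplies the domination that the given approximations
    lack. *)
Lemma levy_sum_approximation (f : R * R -> R) : measurable_fun setT f ->
  exists (S : nat -> set (R * R) -> T -> R) (h : nat -> R * R -> R), [/\
    forall n A, measurable A -> levy_sum Lambda (S n A) (fun x => h n x * \1_A x),
    forall n x, `|h n x| <= `|f x| &
    forall x, h n x @[n --> \oo] --> f x].
Proof.
move=> mf.
have pos (g : R * R -> R) : measurable_fun setT g -> (forall x, 0 <= g x) ->
    exists (S : nat -> set (R * R) -> T -> R) (h : nat -> R * R -> R), [/\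
      forall n A, measurable A -> levy_sum Lambda (S n A) (fun x => h n x * \1_A x),
      forall n x, 0 <= h n x <= g x & forall x, h n x @[n --> \oo] --> g x].
  move=> mg g0.
  have mEg : measurable_fun setT (EFin \o g) by exact/measurable_EFinP.
  pose a := nnsfun_approx measurableT mEg.
  have ac x : a n x @[n --> \oo] --> g x.
    have := cvg_nnsfun_approx measurableT mEg (fun x _ => g0 x) (x := x) I.
    by move/fine_cvg; apply: cvg_trans; exact: cvg_id.
  exists (fun n A => simple_levy_integral Lambda (a n) (square n%:R `&` A)).
  exists (fun n x => a n x * \1_(square n%:R) x); split.
  - move=> n A mA.
    rewrite (_ : (fun x => _) = (fun x => a n x * \1_(square n%:R `&` A) x)); last first.
      by apply/funext => x; rewrite indicI mulrA.
    apply: levy_sum_simple; first by apply: measurableI => //; exact: measurable_square.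
    have [_ [M [Mr bM]]] := bounded_Borel_square (n%:R : R).
    by exists M; split => // y My x [[sx _] _]; exact: (bM y My).
  - move=> n x; rewrite mulr_ge0//=.
    apply: (@le_trans _ _ (a n x)).
      by rewrite -[leRHS]mulr1 ler_wpM2l// indicE; case: (_ \in _).
    have nd : {homo a ^~ x : i j / (i <= j)%N >-> i <= j}.
      by move=> i j ij; have := nd_nnsfun_approx measurableT mEg ij => /lefP; exact.
    rewrite -(cvg_lim _ (ac x))//; apply: nondecreasing_cvgn_le => //.
    by apply/cvg_ex; eexists; exact: ac.
  - move=> x; apply: cvg_trans (ac x); apply: near_eq_cvg.
    exists (Num.truncn `|x|).+1 => // n /= hn.
    rewrite indicE mem_set ?mulr1//; apply: norm_square; apply/ltW.
    by apply: lt_le_trans (truncnS_gt _) _; rewrite ler_nat.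
have [Sp [hp [hp1 hp2 hp3]]] := pos (fun x => Num.max (f x) 0) (measurable_maxr mf (measurable_cst _)) (fun x => ltac:(by rewrite le_max lexx orbT)).
have mNf : measurable_fun setT (fun x => Num.max (- f x) 0).
  by apply: measurable_maxr => //; exact: measurableT_comp.
have [Sn [hn [hn1 hn2 hn3]]] := pos (fun x => Num.max (- f x) 0) mNf (fun x => ltac:(by rewrite le_max lexx orbT)).
exists (fun n A w => Sp n A w - Sn n A w), (fun n x => hp n x - hn n x); split.
- move=> n A mA; have := levy_sumB (hp1 n A mA) (hn1 n A mA).
  by under [X in levy_sum _ _ X]eq_fun do rewrite -mulrBl.
- move=> n x; have := hp2 n x; have := hn2 n x; rewrite ler_norml.
  have [f0|f0] := leP 0 (f x).
    by rewrite max_r ?oppr_le0// (ger0_norm f0) => /andP[? ?] /andP[? ?]; apply/andP; split; lra.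
  by rewrite max_l ?oppr_ge0 ?(ltW f0)// (ltr0_norm f0) => /andP[? ?] /andP[? ?]; apply/andP; split; lra.
- move=> x; have fE : Num.max (f x) 0 - Num.max (- f x) 0 = f x.
    have [f0|f0] := leP 0 (f x); first by rewrite max_r ?subr0// oppr_le0.
    by rewrite max_l ?oppr_ge0 ?(ltW f0)// sub0r opprK.
  by rewrite -fE; apply: cvgB; [exact: hp3|exact: hn3].
Qed.

End levy_sum_approximation.

Lemma ge0_cvge0P (R : realType) (u : nat -> \bar R) : (forall n, 0 <= u n)%E ->
  (u n @[n --> \oo] --> 0%E) <->
  (forall e : R, 0 < e -> exists n0, forall n, (n0 <= n)%N -> (u n <= e%:E)%E).
Proof.
move=> u0; split.
  move=> /fine_cvgP[ufin /cvgrPdist_le ucv] e e0.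
  have [n1 _ h1] := ufin; have [n2 _ h2] := ucv e e0.
  exists (maxn n1 n2) => n; rewrite geq_max => /andP[n1n n2n].
  have := h2 n n2n; rewrite /= sub0r normrN ger0_norm ?fine_ge0//.
  by rewrite -lee_fin fineK//; exact: h1.
move=> h; apply/fine_cvgP; split.
  have [n0 h0] := h 1 ltr01; exists n0 => // n /= n0n.
  by rewrite ge0_fin_numE// (le_lt_trans (h0 n n0n))// ltry.
apply/cvgrPdist_le => e e0; have [n0 h0] := h e e0; exists n0 => // n /= n0n.
rewrite sub0r normrN ger0_norm ?fine_ge0//.
rewrite -lee_fin fineK; first exact: h0.
by rewrite ge0_fin_numE// (le_lt_trans (h0 n n0n))// ltry.
Qed.

(** * Linear operations on limits in probability *)

Section pcvg.
Context d (T : measurableType d) (R : realType) (P : probability T R).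
Implicit Types (U V : nat -> T -> R) (X Y : T -> R).

(** One number serves both as threshold and as probability, as in the Ky Fan metric; [pcvgP] gives
    the equivalence with the usual form. *)
Definition pcvg U X := forall e : R, 0 < e -> exists n0, forall n, (n0 <= n)%N ->
  (tail_prob P e (fun w => (U n w - X w)%R) <= e%:E)%E.

Lemma tail_prob_le_eps (e e' : R) X : measurable_fun setT X -> e <= e' -> (tail_prob P e' X <= tail_prob P e X)%E.
Proof.
move=> mX ee; apply: le_measure; rewrite ?inE; [exact: measurable_tail_prob..|].
by move=> w /=; exact: le_trans.
Qed.

Lemma pcvgP U X : (forall n, measurable_fun setT (U n)) -> measurable_fun setT X ->
  pcvg U X <-> (forall e : R, 0 < e -> tail_prob P e (fun w => U n w - X w) @[n --> \oo] --> 0%E).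
Proof.
move=> mU mX; split=> h e e0.
  apply/ge0_cvge0P; first by move=> n; exact: measure_ge0.
  move=> e' e'0; have m0 : 0 < Num.min e e' by rewrite lt_min e0.
  have [n0 h0] := h _ m0; exists n0 => n /h0 h1.
  have mUX : measurable_fun setT (fun w => U n w - X w) by exact: measurable_funB.
  apply: (@le_trans _ _ (tail_prob P (Num.min e e') (fun w => (U n w - X w)%R))).
    by apply: tail_prob_le_eps => //; rewrite ge_min lexx.
  by apply: le_trans h1 _; rewrite lee_fin ge_min lexx orbT.
have /ge0_cvge0P := h e e0; apply => // n; exact: measure_ge0.
Qed.

Lemma pcvgD U X V Y : (forall n, measurable_fun setT (U n)) -> measurable_fun setT X ->
  (forall n, measurable_fun setT (V n)) -> measurable_fun setT Y ->
  pcvg U X -> pcvg V Y -> pcvg (fun n w => U n w + V n w) (fun w => X w + Y w).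
Proof.
move=> mU mX mV mY UX VY e e0; have e20 : 0 < e / 2 by rewrite divr_gt0.
have [n1 h1] := UX _ e20; have [n2 h2] := VY _ e20.
exists (maxn n1 n2) => n; rewrite geq_max => /andP[n1n n2n].
have m1 : measurable_fun setT (fun w => U n w - X w) by exact: measurable_funB.
have m2 : measurable_fun setT (fun w => V n w - Y w) by exact: measurable_funB.
rewrite [in leRHS](splitr e) EFinD; apply: le_trans (leeD (h1 n n1n) (h2 n n2n)).
apply: tail_prob_le_add => //; last first.
- by move=> w; apply: le_trans (ler_normD _ _); rewrite opprD addrACA.
- by rewrite -splitr.
- by apply: measurable_funB; exact: measurable_funD.
Qed.

Lemma pcvgZ (a : R) U X : (forall n, measurable_fun setT (U n)) -> measurable_fun setT X ->
  pcvg U X -> pcvg (fun n w => a * U n w) (fun w => a * X w).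
Proof.
move=> mU mX UX e e0.
(* Adding 1 avoids a division by zero when a = 0. *)
have a1 : 1 <= `|a| + 1 by rewrite lerDr.
have a0 : 0 < `|a| + 1 by exact: lt_le_trans a1.
have ea0 : 0 < e / (`|a| + 1) by rewrite divr_gt0.
have [n0 h0] := UX _ ea0; exists n0 => n n0n.
have m1 : measurable_fun setT (fun w => U n w - X w) by exact: measurable_funB.
apply: le_trans (le_trans (h0 n n0n) _); last first.
  by rewrite lee_fin ler_pdivrMr// ler_peMr// ltW.
apply: le_measure; rewrite ?inE; [|exact: measurable_tail_prob|].
  by apply: measurable_tail_prob; apply: measurable_funB; apply: measurable_funM.
move=> w /=; rewrite -mulrBr normrM ler_pdivrMr// => h.
by apply: le_trans h _; rewrite mulrC ler_wpM2l// lerDl.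
Qed.

Lemma pcvg_cauchy U X : (forall n, measurable_fun setT (U n)) -> measurable_fun setT X ->
  pcvg U X -> forall e : R, 0 < e -> exists n0, forall n k, (n0 <= n)%N -> (n0 <= k)%N ->
    (tail_prob P e (fun w => (U n w - U k w)%R) <= e%:E)%E.
Proof.
move=> mU mX UX e e0; have e20 : 0 < e / 2 by rewrite divr_gt0.
have [n0 h0] := UX _ e20; exists n0 => n k n0n n0k.
have m1 n' : measurable_fun setT (fun w => U n' w - X w) by exact: measurable_funB.
rewrite [in leRHS](splitr e) EFinD; apply: le_trans (leeD (h0 n n0n) (h0 k n0k)).
apply: tail_prob_le_add => //.
- exact: measurable_funB.
- by rewrite -splitr.
- by move=> w; rewrite (distrC (U k w)); exact: ler_distD.
Qed.

End pcvg.

(** * The stochastic integral as a linear relation *)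

Section levy_limit.
Context d (T : measurableType d) (R : realType) (P : probability T R).
Variable Lambda : set (R * R) -> {RV P >-> R}.
Hypothesis Lambda_Lfun2 : forall A, bounded_Borel A -> (Lambda A : T -> R) \in Lfun P 2%:E.
Notation leb := (@Leb2 R).
Notation levy_sum := (levy_sum Lambda).

(* The integral of Rajput and Rosinski, with arbitrary [levy_sum]s in place of integrals of
   simple functions: in this form it is linear in the integrand, so that it applies to
   [kernel_g] without any estimate on the components of [state_kernel]. *)
Definition levy_limit (f : R * R -> R) (X : T -> R) : Prop :=
  [/\ measurable_fun setT f, measurable_fun setT X &
  exists (S : nat -> set (R * R) -> T -> R) (F : nat -> R * R -> R), [/\
    forall n A, measurable A -> levy_sum (S n A) (fun x => F n x * \1_A x),
    {ae leb, forall x, F n x @[n --> \oo] --> f x},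
    forall A, measurable A -> exists2 Z, measurable_fun setT Z & pcvg P (S ^~ A) Z &
    pcvg P (S ^~ setT) X]].

Lemma levy_sum_measurable X f : levy_sum X f -> measurable_fun setT X.
Proof. by move=> /(levy_sum_Lfun2 Lambda_Lfun2); exact: Lfun2_measurable. Qed.

Lemma levy_limit0 : levy_limit (fun=> 0) (fun=> 0).
Proof.
have c0 : pcvg P (fun _ _ => 0) (fun=> 0).
  move=> e e0; exists 0%N => n _; rewrite /tail_prob (_ : [set w | _] = set0).
    by rewrite measure0 lee_fin ltW.
  by apply/seteqP; split => // w /=; rewrite subr0 normr0 leNgt e0.
split => //; exists (fun _ _ _ => 0), (fun _ _ => 0); split => //.
- move=> n A mA; under [X in levy_sum _ X]eq_fun do rewrite mul0r; exact: levy_sum0.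
- by apply: nearW => x; exact: cvg_cst.
- by move=> A mA; exists (fun=> 0).
Qed.

Lemma levy_limitD f X g Y : levy_limit f X -> levy_limit g Y ->
  levy_limit (fun x => f x + g x) (fun w => X w + Y w).
Proof.
move=> [mf mX [S [F [SF Ff SZ SX]]]] [mg mY [S' [G [SG Gg SZ' SY]]]].
have mS n A : measurable A -> measurable_fun setT (S n A) by move=> /(SF n)/levy_sum_measurable.
have mS' n A : measurable A -> measurable_fun setT (S' n A) by move=> /(SG n)/levy_sum_measurable.
split; [exact: measurable_funD..|].
exists (fun n A w => S n A w + S' n A w), (fun n x => F n x + G n x); split.
- move=> n A mA; have := levy_sumD (SF n A mA) (SG n A mA).
  by under [X in levy_sum _ X]eq_fun do rewrite -mulrDl.
- by apply: filterS2 Ff Gg => x Fx Gx; exact: cvgD.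
- move=> A mA; have [Z mZ hZ] := SZ A mA; have [Z' mZ' hZ'] := SZ' A mA.
  exists (fun w => Z w + Z' w); first exact: measurable_funD.
  by apply: pcvgD => // n; [exact: mS|exact: mS'].
- by apply: pcvgD => // n; [exact: mS|exact: mS'].
Qed.

Lemma levy_limitZ a f X : levy_limit f X -> levy_limit (fun x => a * f x) (fun w => a * X w).
Proof.
move=> [mf mX [S [F [SF Ff SZ SX]]]].
have mS n A : measurable A -> measurable_fun setT (S n A) by move=> /(SF n)/levy_sum_measurable.
split; [exact: measurable_funM..|].
exists (fun n A w => a * S n A w), (fun n x => a * F n x); split.
- move=> n A mA; have := levy_sumZ a (SF n A mA).
  by under [X in levy_sum _ X]eq_fun do rewrite mulrA.
- by apply: filterS Ff => x Fx; exact: (cvgM (cvg_cst a) Fx).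
- move=> A mA; have [Z mZ hZ] := SZ A mA.
  exists (fun w => a * Z w); first exact: measurable_funM.
  by apply: pcvgZ => // n; exact: mS.
- by apply: pcvgZ => // n; exact: mS.
Qed.

Lemma levy_limit_sum (I : Type) (s : seq I) (f : I -> R * R -> R) (X : I -> T -> R) :
  (forall i, levy_limit (f i) (X i)) ->
  levy_limit (fun x => \sum_(i <- s) f i x) (fun w => \sum_(i <- s) X i w).
Proof.
move=> fX; elim: s => [|i s ih].
  under [X in levy_limit X _]eq_fun do rewrite big_nil.
  by under [X in levy_limit _ X]eq_fun do rewrite big_nil; exact: levy_limit0.
under [X in levy_limit X _]eq_fun do rewrite big_cons.
by under [X in levy_limit _ X]eq_fun do rewrite big_cons; exact: levy_limitD.
Qed.

Lemma levy_limit_integral f (X : {RV P >-> R}) : is_levy_integral Lambda f X -> levy_limit f X.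
Proof.
move=> [mf [F [bF Ff FZ FX]]].
have SF n A : measurable A ->
    levy_sum (simple_levy_integral Lambda (F n) A) (fun x => F n x * \1_A x).
  move=> mA; apply: levy_sum_simple => //.
  have [M [Mr bM]] := bF n; exists M; split => // y My x [_ Fx]; exact: (bM y My).
have mS n A : measurable A -> measurable_fun setT (simple_levy_integral Lambda (F n) A).
  by move=> /(SF n)/levy_sum_measurable.
split => //; exists (fun n => simple_levy_integral Lambda (F n)), (fun n => F n : R * R -> R).
split => //.
- move=> A mA; have [Z hZ] := FZ A mA; exists Z => //.
  by apply/pcvgP => // n; exact: mS.
- by apply/pcvgP => // n; exact: mS.
Qed.

End levy_limit.

(** * Square integrability of the stochastic integral *)

Section levy_limit_L2.
Context d (T : measurableType d) (R : realType) (P : probability T R).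
Variables (Lambda : set (R * R) -> {RV P >-> R}) (m kappa : R).
Hypothesis Lambda_Lfun2 : forall A, bounded_Borel A -> (Lambda A : T -> R) \in Lfun P 2%:E.
Hypothesis Lambda_ip : forall A B, bounded_Borel A -> bounded_Borel B ->
  ip P (Lambda A) (Lambda B) = kappa * fine (Leb2 (A `&` B)) +
    m * fine (Leb2 A) * (m * fine (Leb2 B)).
Notation leb := (@Leb2 R).
Notation levy_sum := (levy_sum Lambda).

(* Its integral controls both the variance and the mean of a [levy_sum]. *)
Definition modular (z : R) := z ^+ 2 + `|z|.

Lemma modular_ge0 z : 0 <= modular z.
Proof. by rewrite addr_ge0 ?sqr_ge0. Qed.

Lemma modular_le x y : `|x| <= y -> modular x <= modular y.
Proof.
move=> xy; have y0 : 0 <= y by exact: le_trans (normr_ge0 x) xy.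
by rewrite /modular (ger0_norm y0) -(real_normK (num_real x)) lerD// lerXn2r ?nnegrE.
Qed.

Lemma modularD_le x y : modular (x + y) <= 2 * modular x + 2 * modular y.
Proof.
have := ler_normD x y; have := sqr_ge0 (x - y); rewrite /modular.
by have := normr_ge0 x; have := normr_ge0 y; nra.
Qed.

Lemma measurable_modular d' (E : measurableType d') (f : E -> R) : measurable_fun setT f ->
  measurable_fun setT (fun x => modular (f x)).
Proof.
move=> mf; apply: measurable_funD; first exact: measurable_funX.
exact: measurableT_comp.
Qed.

Lemma integrable_modular (f : R * R -> R) : f \in Lfun leb 2%:E ->
  leb.-integrable setT (EFin \o f) -> leb.-integrable setT (EFin \o (fun x => modular (f x))).
Proof.
move=> f2 f1; have i1 := integrable_abse f1.
exact: (integrableD measurableT (Lfun2_integrable_sqr f2) i1).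
Qed.

(** The condition h <= 1 bounds the squared mean, which is of order h^2, by h as well; |kappa|
    occurs because the sign of kappa is not known here. *)
Lemma levy_sum_ip_le X f h : levy_sum X f -> h <= 1 ->
  (\int[leb]_x (modular (f x))%:E <= h%:E)%E -> ip P X X <= (`|kappa| + m ^+ 2) * h.
Proof.
move=> Xf h1 fh; have f2 := levy_sum_kernel_Lfun2 Xf; have f1 := levy_sum_integrable Xf.
rewrite (levy_sum_ip Lambda_Lfun2 Lambda_ip Xf Xf).
have mf := Lfun2_measurable f2.
have mm : measurable_fun setT (fun x => (modular (f x))%:E).
  by apply/measurable_EFinP; exact: measurable_modular.
have fh2 : ip leb f f <= h.
  rewrite -lee_fin -integral_sqr_ip//; apply: le_trans fh; apply: ge0_le_integral => //.
  - by move=> x _; rewrite lee_fin sqr_ge0.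
  - by apply/measurable_EFinP; exact: measurable_funX.
  - by move=> x _; rewrite lee_fin lerDl.
have fh1 : `|\int[leb]_x f x| <= h.
  apply: le_trans (le_normr_Rintegral measurableT f1) _.
  rewrite -lee_fin /Rintegral fineK; last first.
    by apply: integrable_fin_num => //; exact: integrable_abse f1.
  apply: le_trans fh; apply: ge0_le_integral => //.
  - by apply/measurable_EFinP; exact: measurableT_comp.
  - by move=> x _; rewrite lee_fin lerDr sqr_ge0.
have ip0 := ip_ge0 leb f.
have k1 : kappa * ip leb f f <= `|kappa| * h.
  apply: (@le_trans _ _ (`|kappa| * ip leb f f)); first by rewrite ler_wpM2r// ler_norm.
  by rewrite ler_wpM2l.
have h0 : 0 <= h by exact: le_trans ip0 fh2.
have k2 : (\int[leb]_x f x) ^+ 2 <= h.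
  rewrite -(real_normK (num_real _)); apply: (@le_trans _ _ (h ^+ 2)).
    by rewrite lerXn2r ?nnegrE.
  by rewrite expr2 ler_piMr.
rewrite mulrDl lerD// [X in X <= _](_ : _ = m ^+ 2 * (\int[leb]_x f x) ^+ 2); last by ring.
by rewrite ler_wpM2l// sqr_ge0.
Qed.

Lemma levy_sum_tail_prob (e : R) : 0 < e -> exists2 h : R, 0 < h & forall X f, levy_sum X f ->
  (\int[leb]_x (modular (f x))%:E <= h%:E)%E -> (tail_prob P e X <= e%:E)%E.
Proof.
move=> e0; have e30 : 0 < e ^+ 3 by rewrite exprn_gt0.
pose K := `|kappa| + m ^+ 2 + 1.
have K0 : 0 < K by rewrite ltr_wpDl// addr_ge0// sqr_ge0.
(* Chebyshev's inequality divides by e^2 and a bound e must remain, whence e^3; the 1 added in K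
   ensures K > 0. *)
exists (Num.min 1 (e ^+ 3 / K)); first by rewrite lt_min ltr01 divr_gt0.
move=> X f Xf fh; have X2 := levy_sum_Lfun2 Lambda_Lfun2 Xf.
apply: le_trans (chebyshev_ip e0 X2) _; rewrite lee_fin ler_pdivrMr ?exprn_gt0// -exprS.
have h1 : Num.min 1 (e ^+ 3 / K) <= 1 by rewrite ge_min lexx.
apply: le_trans (levy_sum_ip_le Xf h1 fh) _.
apply: (@le_trans _ _ (K * (e ^+ 3 / K))).
  apply: ler_pM; rewrite ?addr_ge0 ?sqr_ge0//.
  - by rewrite le_min ler01 ltW// divr_gt0.
  - by rewrite /K lerDl.
  - by rewrite ge_min lexx orbT.
by rewrite mulrC divfK ?gt_eqF.
Qed.

Variables (f : R * R -> R) (X : T -> R).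
Hypotheses (f2 : f \in Lfun leb 2%:E) (f1 : leb.-integrable setT (EFin \o f)).
Hypothesis fX : levy_limit Lambda f X.

Let modular_cvg0 (F : nat -> R * R -> R) (G : R * R -> R) :
  (forall n, measurable_fun setT (F n)) -> G \in Lfun leb 2%:E ->
  leb.-integrable setT (EFin \o G) -> (forall n x, `|F n x| <= `|G x|) ->
  {ae leb, forall x, F n x @[n --> \oo] --> 0} ->
  forall e : R, 0 < e -> exists n0, forall n, (n0 <= n)%N ->
    (\int[leb]_x (modular (F n x))%:E <= e%:E)%E.
Proof.
move=> mF G2 G1 FG F0; apply/ge0_cvge0P.
  by move=> n; apply: integral_ge0 => x _; rewrite lee_fin modular_ge0.
apply: (dominated_cvg0 (G := fun x => modular (G x))).
- by move=> n; exact: measurable_modular.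
- apply: filterS F0 => x Fx.
  rewrite [X in _ --> X](_ : 0 = 0 * 0 + `|0 : R|); last by rewrite mul0r normr0 addr0.
  by apply: cvgD; [exact: cvgM|exact: cvg_norm].
- exact: integrable_modular.
- move=> n x; rewrite ger0_norm ?modular_ge0//.
  by rewrite [modular (G x)](_ : _ = modular `|G x|) ?modular_le// /modular normr_id real_normK// num_real.
Qed.

Lemma levy_limit_L2 : exists (U : nat -> T -> R) (h : nat -> R * R -> R), [/\
  forall n, levy_sum (U n) (h n), X \in Lfun P 2%:E,
  ip P (fun w => U n w - X w) (fun w => U n w - X w) @[n --> \oo] --> 0,
  ip leb (fun x => h n x - f x) (fun x => h n x - f x) @[n --> \oo] --> 0 &
  \int[leb]_x h n x @[n --> \oo] --> \int[leb]_x f x].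
Proof.
have [mf mX [S [F [SF Ff SZ SX]]]] := fX.
have [S' [h [Sh hf hcv]]] := levy_sum_approximation Lambda mf.
have setTE (k : R * R -> R) : (fun x => k x * \1_setT x) = k.
  by apply/funext => x; rewrite indicT mulr1.
have hT n : levy_sum (S' n setT) (h n) by have := Sh n _ measurableT; rewrite setTE.
have FT n : levy_sum (S n setT) (F n) by have := SF n _ measurableT; rewrite setTE.
have F2 n := levy_sum_kernel_Lfun2 (FT n); have F1 n := levy_sum_integrable (FT n).
have h2 n := levy_sum_kernel_Lfun2 (hT n); have h1 n := levy_sum_integrable (hT n).
have mh n := Lfun2_measurable (h2 n); have mF n := Lfun2_measurable (F2 n).
have mS n A : measurable A -> measurable_fun setT (S n A).
  by move=> mA; have := levy_sum_measurable Lambda_Lfun2 (SF n A mA).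
have mS' n A : measurable A -> measurable_fun setT (S' n A).
  by move=> mA; have := levy_sum_measurable Lambda_Lfun2 (Sh n A mA).
have hfcv (e : R) : 0 < e -> exists n0, forall n, (n0 <= n)%N ->
    (\int[leb]_x (modular (h n x - f x))%:E <= e%:E)%E.
  apply: (modular_cvg0 (F := fun n x => h n x - f x) (G := fun x => 2 * f x)).
  - by move=> n; exact: measurable_funB.
  - exact: Lfun2Z.
  - exact: (integrableZl measurableT 2 f1).
  - move=> n x; rewrite normrM (ger0_norm (ler0n R 2)); apply: le_trans (ler_normB _ _) _.
    by have := hf n x; lra.
  - apply: nearW => x; rewrite -[0](subrr (f x)).
    by apply: cvgB; [exact: hcv|exact: cvg_cst].
have hcauchy (e : R) : 0 < e -> exists n0, forall n k, (n0 <= n)%N -> (n0 <= k)%N ->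
    (\int[leb]_x (modular (h n x - h k x))%:E <= e%:E)%E.
  move=> e0; have e40 : 0 < e / 4 by rewrite divr_gt0.
  have [n0 hn0] := hfcv _ e40; exists n0 => n k n0n n0k.
  have mhf n' : measurable_fun setT (fun x => (modular (h n' x - f x))%:E).
    by apply/measurable_EFinP/measurable_modular; exact: measurable_funB.
  apply: (@le_trans _ _ (\int[leb]_x (2%:E * (modular (h n x - f x))%:E +
      2%:E * (modular (h k x - f x))%:E))%E).
    apply: ge0_le_integral => //.
    - by move=> x _; rewrite lee_fin modular_ge0.
    - by apply/measurable_EFinP/measurable_modular; exact: measurable_funB.
    - by apply: emeasurable_funD; apply: measurable_funeM.
    - move=> x _; rewrite -!EFinM -EFinD lee_fin.
      have -> : h n x - h k x = (h n x - f x) + - (h k x - f x) by ring.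
      have := modularD_le (h n x - f x) (- (h k x - f x)).
      by rewrite {3}/modular sqrrN normrN.
  rewrite ge0_integralD//; last 4 first.
  - by move=> x _; rewrite -EFinM lee_fin mulr_ge0// modular_ge0.
  - exact: measurable_funeM.
  - by move=> x _; rewrite -EFinM lee_fin mulr_ge0// modular_ge0.
  - exact: measurable_funeM.
  rewrite !ge0_integralZl//; try by move=> x _; rewrite lee_fin modular_ge0.
  apply: (@le_trans _ _ (2%:E * (e / 4)%:E + 2%:E * (e / 4)%:E)%E).
    by apply: leeD; apply: lee_wpmul2l; rewrite ?lee_fin// hn0.
  by rewrite -!EFinM -EFinD lee_fin; lra.
have hump (e : R) : 0 < e -> tail_prob P e (fun w => S n setT w - S' n setT w) @[n --> \oo] --> 0%E.
  pose H n x := F n x - h n x.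
  (* The points of a square at which the whole sequence [H] is bounded by j. Almost every point
     belongs to some D j, a convergent sequence being bounded, and on D j the modular of [H n] is
     dominated uniformly in n. *)
  pose D (j : nat) := square j%:R `&` [set x | forall n, `|H n x| <= j%:R].
  pose M n A w := S n A w - S' n A w.
  pose v n A := (\int[leb]_x (modular (H n x) * \1_A x)%:E)%E.
  have MH n A : measurable A -> levy_sum (M n A) (fun x => H n x * \1_A x).
    move=> mA; have := levy_sumB (SF n A mA) (Sh n A mA).
    by under [X in levy_sum _ X]eq_fun do rewrite -mulrBl.
  have mH n : measurable_fun setT (H n) by exact: measurable_funB.
  have mmH n : measurable_fun setT (fun x => modular (H n x)) by exact: measurable_modular.
  have mv n A : measurable A -> measurable_fun setT (fun x => (modular (H n x) * \1_A x)%:E).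
    by move=> mA; apply/measurable_EFinP; apply: measurable_funM.
  have v0 n A x : (0 <= (modular (H n x) * \1_A x)%:E)%E.
    by rewrite lee_fin mulr_ge0// modular_ge0.
  have vE n A : v n A = (\int[leb]_x (modular (H n x * \1_A x))%:E)%E.
    apply: eq_integral => x _; rewrite indicE; case: (_ \in _); rewrite ?mulr1// !mulr0.
    by rewrite /modular expr0n normr0 addr0.
  have mD j : measurable (D j).
    apply: measurableI; first exact: measurable_square.
    rewrite (_ : mkset _ = \bigcap_n [set x | `|H n x| <= j%:R]); last first.
      by apply/seteqP; split => x /= hx n; [move=> _|]; exact: hx.
    apply: bigcap_measurable => [|n _]; [by exists 0%N|rewrite -[X in measurable X]setTI].
    by apply: measurable_fun_le => //; exact: measurableT_comp.
  apply: (gliding_hump (M := M) (v := v) (D := D)) => //.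
  - by move=> n A mA; apply: measurable_funB; [exact: mS|exact: mS'].
  - move=> n A B mA mB AB; apply: ge0_le_integral => //; [exact: mv|exact: mv|].
    move=> x _; rewrite lee_fin ler_wpM2l ?modular_ge0// !indicE.
    case: (boolP (x \in A)) => [/set_mem/AB/mem_set ->//|_]; exact: ler0n.
  - move=> n A B mA mB; rewrite -ge0_integralD//; [|exact: mv..].
    apply: ge0_le_integral => //; first by apply: mv; exact: measurableU.
      by apply: emeasurable_funD; exact: mv.
    move=> x _; rewrite -EFinD lee_fin -mulrDr ler_wpM2l ?modular_ge0// !indicE in_setU.
    by case: (x \in A); case: (x \in B); rewrite /= ?addr0 ?add0r// lerDl.
  - move=> e' e'0; have [h0 h00 hh] := levy_sum_tail_prob e'0; exists h0 => // n A B mA mB BA vh.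
    apply: hh (levy_sumB (MH n A mA) (MH n B mB)) _; move: vh; rewrite vE; apply: le_trans.
    rewrite le_eqVlt; apply/orP; left; apply/eqP; apply: eq_integral => x _.
    congr ((modular _)%:E); rewrite -mulrBr; congr (_ * _); rewrite !indicE in_setD.
    case: (boolP (x \in B)) => [/set_mem/BA/mem_set ->|_]/=; rewrite ?andbF ?andbT ?subrr ?subr0//.
  - move=> e' e'0; have [h0 h00 hh] := levy_sum_tail_prob e'0; exists h0 => // n A mA vh.
    by apply: hh (MH n A mA) _; move: vh; rewrite vE.
  (* Cauchy on each A: for the given integrals because they converge in probability on A, for the
     comparison integrals by the modular estimate. *)
  - move=> A e' mA e'0; have e'20 : 0 < e' / 2 by rewrite divr_gt0.
    have [Z mZ hZ] := SZ A mA.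
    have [n1 hn1] := pcvg_cauchy (fun n => mS n A mA) mZ hZ e'20.
    have [h0 h00 hh] := levy_sum_tail_prob e'20; have [n2 hn2] := hcauchy _ h00.
    exists (maxn n1 n2) => n k; rewrite !geq_max => /andP[n1n n2n] /andP[n1k n2k].
    have h3 : (tail_prob P (e' / 2) (fun w => (S' n A w - S' k A w)%R) <= (e' / 2)%:E)%E.
      apply: hh (levy_sumB (Sh n A mA) (Sh k A mA)) _; apply: le_trans (hn2 n k n2n n2k).
      apply: ge0_le_integral => //.
      - by move=> x _; rewrite lee_fin modular_ge0.
      - apply/measurable_EFinP/measurable_modular.
        by apply: measurable_funB; apply: measurable_funM.
      - by apply/measurable_EFinP/measurable_modular; exact: measurable_funB.
      - move=> x _; rewrite lee_fin -mulrBl.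
        rewrite [leRHS](_ : _ = modular `|h n x - h k x|); last first.
          by rewrite /modular normr_id real_normK// num_real.
        apply: modular_le; rewrite normrM indicE.
        by case: (_ \in _); rewrite ?normr1 ?mulr1// normr0 mulr0.
    rewrite [in leRHS](splitr e') EFinD; apply: le_trans (leeD (hn1 n k n1n n1k) h3).
    apply: tail_prob_le_add => //.
    + by apply: measurable_funB; apply: measurable_funB; [exact: mS|exact: mS'|exact: mS|exact: mS'].
    + by apply: measurable_funB; exact: mS.
    + by apply: measurable_funB; exact: mS'.
    + by rewrite -splitr.
    + move=> w; rewrite /M (_ : _ - _ - _ = (S n A w - S k A w) - (S' n A w - S' k A w)); last by ring.
      exact: ler_normB.
  - move=> i j ij x [/= [x1 x2] hx]; have ijR : (i%:R : R) <= j%:R by rewrite ler_nat.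
    split; last by move=> n; exact: le_trans (hx n) ijR.
    by move: x1 x2; rewrite /= !in_itv/= -!ler_norml => x1 x2; split; rewrite /= in_itv/= -ler_norml;
      [exact: le_trans x1 ijR|exact: le_trans x2 ijR].
  (* For fixed j, dominated convergence in n, as [H n] tends to 0 almost everywhere. *)
  - move=> j.
    apply/(ge0_cvge0P (u := fun n => v n (D j))).
      by move=> n; apply: integral_ge0 => x _; exact: v0.
    apply: (dominated_cvg0 (G := fun x => modular j%:R * \1_(square j%:R) x)).
    + by move=> n; apply: measurable_funM.
    + apply: filterS Ff => x Fx.
      have Hx : H n x @[n --> \oo] --> 0.
        by rewrite -[0](subrr (f x)); apply: cvgB; [exact: Fx|exact: hcv].
      rewrite [X in _ --> X](_ : 0 = (0 * 0 + `|0 : R|) * \1_(D j) x); last first.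
        by rewrite mul0r normr0 addr0 mul0r.
      apply: cvgM; last exact: cvg_cst.
      by apply: cvgD; [exact: cvgM|exact: cvg_norm].
    + exact: (integrableZl measurableT (modular j%:R) (integrable_indic_Borel (bounded_Borel_square j%:R))).
    + move=> n x; rewrite ger0_norm; last by rewrite mulr_ge0// modular_ge0.
      rewrite !indicE; case: (boolP (x \in D j)) => [/set_mem[sx hx]|_].
        by rewrite mem_set// !mulr1; apply: modular_le.
      by rewrite mulr0 mulr_ge0// modular_ge0.
  (* For fixed n, dominated convergence in j, as almost every point lies in D j for all large j. *)
  - move=> n.
    apply/(ge0_cvge0P (u := fun j => v n (~` D j))).
      by move=> j; apply: integral_ge0 => x _; exact: v0.
    apply: (dominated_cvg0 (G := fun x => modular (H n x))).
    + by move=> j; apply: measurable_funM => //; exact: measurable_indic (measurableC (mD j)).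
    + apply: filterS Ff => x Fx.
      have Hx : H n x @[n --> \oo] --> 0.
        by rewrite -[0](subrr (f x)); apply: cvgB; [exact: Fx|exact: hcv].
      have [K [Kr bK]] : bounded_fun (fun n => H n x).
        by apply: cvg_seq_bounded; apply/cvg_ex; exists 0.
      pose L := Num.max (K + 1) `|x|.
      have L0 : 0 <= L by rewrite le_max normr_ge0 orbT.
      apply: cvg_near_cst; exists (Num.truncn L).+1 => // j /= hj.
      have Lj : L <= j%:R by apply/ltW/(lt_le_trans (truncnS_gt _)); rewrite ler_nat.
      rewrite indicE memNset ?mulr0// => -[]; split.
        by apply: norm_square; apply: le_trans Lj; rewrite le_max lexx orbT.
      move=> n'; apply: le_trans (bK (K + 1) _ n' I) _; first by rewrite ltrDl.
      by apply: le_trans Lj; rewrite le_max lexx.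
    + by apply: integrable_modular; [exact: Lfun2B|exact: (integrableB measurableT (F1 n) (h1 n))].
    + move=> j x; rewrite ger0_norm; last by rewrite mulr_ge0// modular_ge0.
      by rewrite indicE; case: (_ \in _); rewrite ?mulr1// mulr0 modular_ge0.
(* S' = S - (S - S'), where the difference vanishes in probability by the gliding hump. *)
have UX : pcvg P (S' ^~ setT) X.
  have mSS n : measurable_fun setT (fun w => S n setT w - S' n setT w).
    by apply: measurable_funB; [exact: mS|exact: mS'].
  have hump' : pcvg P (fun n w => S n setT w - S' n setT w) (fun=> 0).
    apply/pcvgP => // e e0; apply: cvg_trans (hump e e0); apply: near_eq_cvg; apply: nearW => n.
    by congr (tail_prob P e _); apply/funext => w; rewrite subr0.
  have m0 : measurable_fun setT (fun _ : T => 0 : R) by [].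
  have hN := pcvgZ (-1) mSS m0 hump'.
  have h3 : pcvg P (fun n w => S n setT w + -1 * (S n setT w - S' n setT w)) (fun w => X w + -1 * 0).
    apply: pcvgD => // [n|n].
      exact: mS.
    exact: measurable_funM.
  move=> e e0; have [n0 hn0] := h3 e e0; exists n0 => n /hn0; apply: le_trans.
  rewrite le_eqVlt; apply/orP; left; apply/eqP; congr (tail_prob P e _).
  by apply/funext => w; ring.
have hUX : X \in Lfun P 2%:E /\
    ip P (fun w => S' n setT w - X w) (fun w => S' n setT w - X w) @[n --> \oo] --> 0.
  apply: prob_L2_complete => //.
  - by move=> n; have := levy_sum_Lfun2 Lambda_Lfun2 (hT n).
  - by apply/pcvgP => // n; exact: mS'.
  - move=> e e0; pose K := `|kappa| + m ^+ 2 + 1.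
    have K0 : 0 < K by rewrite ltr_wpDl// addr_ge0// sqr_ge0.
    have m0 : 0 < Num.min 1 (e / K) by rewrite lt_min ltr01 divr_gt0.
    have [n0 hn0] := hcauchy _ m0; exists n0 => n k n0n n0k.
    apply: le_trans (levy_sum_ip_le (levy_sumB (hT n) (hT k)) _ (hn0 n k n0n n0k)) _.
      by rewrite ge_min lexx.
    apply: (@le_trans _ _ (K * (e / K))); last by rewrite mulrC divfK ?gt_eqF.
    apply: ler_pM; rewrite ?addr_ge0 ?sqr_ge0 ?(ltW m0)//; first by rewrite /K lerDl.
    by rewrite ge_min lexx orbT.
have hf2 n := Lfun2B (h2 n) f2.
have mhf n := Lfun2_measurable (hf2 n).
exists (fun n => S' n setT), h; split => //; [exact: hUX.1|exact: hUX.2| |].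
- apply/cvgrPdist_le => e e0; have [n0 hn0] := hfcv e e0; exists n0 => // n /= n0n.
  rewrite sub0r normrN ger0_norm ?ip_ge0// -lee_fin -integral_sqr_ip//.
  apply: le_trans (hn0 n n0n); apply: ge0_le_integral => //.
  - by move=> x _; rewrite lee_fin sqr_ge0.
  - by apply/measurable_EFinP; exact: measurable_funX.
  - by apply/measurable_EFinP; exact: measurable_modular.
  - by move=> x _; rewrite lee_fin lerDl.
- apply/cvgrPdist_le => e e0; have [n0 hn0] := hfcv e e0; exists n0 => // n /= n0n.
  rewrite distrC -RintegralB//.
  have hf1 := integrableB measurableT (h1 n) f1.
  apply: le_trans (le_normr_Rintegral measurableT hf1) _.
  rewrite -lee_fin /Rintegral fineK; last first.
    by apply: integrable_fin_num => //; exact: integrable_abse hf1.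
  apply: le_trans (hn0 n n0n); apply: ge0_le_integral => //.
  - by apply/measurable_EFinP; exact: measurableT_comp.
  - by apply/measurable_EFinP; exact: measurable_modular.
  - by move=> x _; rewrite lee_fin lerDr sqr_ge0.
Qed.

End levy_limit_L2.

(** * Covariances of stochastic integrals and of the field *)

Lemma covariance_ip d (T : measurableType d) (R : realType) (P : probability T R) (X Y : T -> R) :
  X \in Lfun P 2%:E -> Y \in Lfun P 2%:E ->
  covariance P X Y = (ip P X Y - ip P (fun=> 1) X * ip P (fun=> 1) Y)%:E.
Proof.
move=> X2 Y2; have L1 Z : Z \in Lfun P 2%:E -> Z \in Lfun P 1%:E.
  exact: (Lfun_subset12 (fin_num_measure P _ measurableT)).
have XY1 := Lfun2_mul_Lfun1 X2 Y2.
have mE Z : Z \in Lfun P 2%:E -> ('E_P[Z] = (ip P (fun=> 1) Z)%:E)%E.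
  move=> Z2; rewrite ip_cstl// mul1r unlock /Rintegral fineK//.
  by apply: integrable_fin_num => //; exact: Lfun2_integrable.
rewrite (covarianceE (L1 _ X2) (L1 _ Y2) XY1) (mE _ X2) (mE _ Y2) EFinB EFinM; congr (_ - _)%E.
rewrite unlock /ip /Rintegral fineK//; apply: integrable_fin_num => //.
exact: Lfun2_integrableM.
Qed.

Section levy_limit_covariance.
Context d (T : measurableType d) (R : realType) (P : probability T R).
Variables (Lambda : set (R * R) -> {RV P >-> R}) (m kappa : R).
Hypothesis Lambda_Lfun2 : forall A, bounded_Borel A -> (Lambda A : T -> R) \in Lfun P 2%:E.
Hypothesis Lambda_mean : forall A, bounded_Borel A -> \int[P]_w Lambda A w = m * fine (Leb2 A).
Hypothesis Lambda_ip : forall A B, bounded_Borel A -> bounded_Borel B ->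
  ip P (Lambda A) (Lambda B) = kappa * fine (Leb2 (A `&` B)) +
    m * fine (Leb2 A) * (m * fine (Leb2 B)).
Notation leb := (@Leb2 R).

Lemma levy_limit_mean f X : f \in Lfun leb 2%:E -> leb.-integrable setT (EFin \o f) ->
  levy_limit Lambda f X -> ip P (fun=> 1) X = m * \int[leb]_x f x.
Proof.
move=> f2 f1 fX.
have [U [h [Uh X2 cU _ ch]]] := levy_limit_L2 Lambda_Lfun2 Lambda_ip f2 f1 fX.
have U2 n := levy_sum_Lfun2 Lambda_Lfun2 (Uh n).
have c1 := ip_cvgl U2 X2 (Lfun2_cst P 1) cU.
rewrite ipC -(cvg_lim _ c1)//; apply: cvg_lim => //.
apply: cvg_trans (cvgM (cvg_cst m) ch); apply: near_eq_cvg; apply: nearW => n /=.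
by rewrite ipC ip_cstl// mul1r (levy_sum_mean Lambda_Lfun2 Lambda_mean (Uh n)).
Qed.

Lemma levy_limit_ip f X g Y : f \in Lfun leb 2%:E -> leb.-integrable setT (EFin \o f) ->
  g \in Lfun leb 2%:E -> leb.-integrable setT (EFin \o g) ->
  levy_limit Lambda f X -> levy_limit Lambda g Y ->
  ip P X Y = kappa * ip leb f g + m * \int[leb]_x f x * (m * \int[leb]_x g x).
Proof.
move=> f2 f1 g2 g1 fX gY.
have [U [h [Uh X2 cU c2h ch]]] := levy_limit_L2 Lambda_Lfun2 Lambda_ip f2 f1 fX.
have [V [k [Vk Y2 cV c2k ck]]] := levy_limit_L2 Lambda_Lfun2 Lambda_ip g2 g1 gY.
have U2 n := levy_sum_Lfun2 Lambda_Lfun2 (Uh n).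
have V2 n := levy_sum_Lfun2 Lambda_Lfun2 (Vk n).
have h2 n := levy_sum_kernel_Lfun2 (Uh n); have k2 n := levy_sum_kernel_Lfun2 (Vk n).
have c1 := ip_cvg U2 X2 V2 Y2 cU cV.
rewrite -(cvg_lim _ c1)//; apply: cvg_lim => //.
under eq_fun do rewrite (levy_sum_ip Lambda_Lfun2 Lambda_ip (Uh _) (Vk _)).
apply: cvgD; first by apply: cvgM; [exact: cvg_cst|exact: ip_cvg].
by apply: cvgM; apply: cvgM => //; exact: cvg_cst.
Qed.

(** The product of the means in [levy_limit_ip] cancels, so that m leaves no trace. *)
Lemma levy_limit_covariance f X g Y : f \in Lfun leb 2%:E -> leb.-integrable setT (EFin \o f) ->
  g \in Lfun leb 2%:E -> leb.-integrable setT (EFin \o g) ->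
  levy_limit Lambda f X -> levy_limit Lambda g Y ->
  covariance P X Y = (kappa * ip leb f g)%:E.
Proof.
move=> f2 f1 g2 g1 fX gY.
have [U [h [_ X2 _ _ _]]] := levy_limit_L2 Lambda_Lfun2 Lambda_ip f2 f1 fX.
have [V [k [_ Y2 _ _ _]]] := levy_limit_L2 Lambda_Lfun2 Lambda_ip g2 g1 gY.
rewrite covariance_ip// (levy_limit_ip f2 f1 g2 g1 fX gY).
by rewrite (levy_limit_mean f2 f1 fX) (levy_limit_mean g2 g1 gY) addrK.
Qed.

End levy_limit_covariance.

Section carma_covariance.
Context d (T : measurableType d) (R : realType) (P : probability T R).
Variables (beta sigma : R) (nu : {measure set R -> \bar R}).
Variables (Lambda : set (R * R) -> {RV P >-> R}) (Y : R * R -> {RV P >-> R}).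
Variables (p : nat) (A1 A2 : 'M[R]_p) (b c : 'cV[R]_p).
Hypothesis hL : homogeneous_levy_basis beta sigma nu Lambda.
Hypothesis hnu : finite_second_moment nu.
Hypothesis hY : carma_equations A1 A2 b c Lambda Y.
Notation leb := (@Leb2 R).
Let g (t s : R * R) := kernel_g A1 A2 b c (t.1 - s.1, t.2 - s.2).
Hypothesis g2 : forall t, g t \in Lfun leb 2%:E.
Hypothesis g1 : forall t, leb.-integrable setT (EFin \o g t).

Let levy_limit_Y t : exists2 X, levy_limit Lambda (g t) X & {ae P, forall w, X w = Y t w}.
Proof.
have [m [L2 _ _]] := levy_basis_moments hL hnu.
have [X [hX hYX]] := hY; exists (fun w => \sum_(i < p) b i 0 * X t i w); last first.
  by apply: filterS (hYX t) => w ->.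
rewrite (_ : g t = (fun s => \sum_(i < p) b i 0 * state_kernel A1 A2 c (t.1 - s.1, t.2 - s.2) i 0)).
  apply: (levy_limit_sum L2) => i; apply: (levy_limitZ L2).
  by apply: (levy_limit_integral L2); exact: hX.
by apply/funext => s; rewrite /g /kernel_g mxE; apply: eq_bigr => i _; rewrite mxE.
Qed.

Lemma carma_Lfun2 t : (Y t : T -> R) \in Lfun P 2%:E.
Proof.
have [m [L2 _ Lip]] := levy_basis_moments hL hnu.
have [X hX XY] := levy_limit_Y t; have [_ [_ [_ X2 _ _ _]]] := levy_limit_L2 L2 Lip (g2 t) (g1 t) hX.
exact: Lfun2_ae XY X2.
Qed.

Lemma carma_covariance t r : covariance P (Y t) (Y r) = (kappa2 sigma nu * ip leb (g t) (g r))%:E.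
Proof.
have [m [L2 Lm Lip]] := levy_basis_moments hL hnu.
have [X hX XY] := levy_limit_Y t; have [Z hZ ZY] := levy_limit_Y r.
rewrite -(levy_limit_covariance L2 Lm Lip (g2 t) (g1 t) (g2 r) (g1 r) hX hZ).
have [_ [_ [_ X2 _ _ _]]] := levy_limit_L2 L2 Lip (g2 t) (g1 t) hX.
have [_ [_ [_ Z2 _ _ _]]] := levy_limit_L2 L2 Lip (g2 r) (g1 r) hZ.
have mX := Lfun2_measurable X2; have mZ := Lfun2_measurable Z2.
have m1 : measurable_fun setT (fun _ : T => 1 : R) by [].
have e1 : {ae P, forall w : T, (1 : R) = 1} by exact: nearW.
rewrite !covariance_ip ?carma_Lfun2//.
by rewrite (ip_ae mX mZ _ _ XY ZY)// (ip_ae m1 mX m1 _ e1 XY)// (ip_ae m1 mZ m1 _ e1 ZY).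
Qed.

End carma_covariance.

(** * Integrals of damped oscillations over a half-line *)

Section damped_oscillation.
Context (R : realType).
Variables (m alpha omega : R).

(* [damped_osc 1 0] and [damped_osc 0 1] are the real and imaginary parts of
   e^{(alpha + i omega) (m - x)}; the family is closed under derivation. *)
Definition damped_osc (c s x : R) : R :=
  expR (alpha * (m - x)) * (c * cos (omega * (m - x)) + s * sin (omega * (m - x))).

Lemma is_derive_damped_osc c s (x : R) : is_derive x (1 : R) (damped_osc c s)
  (damped_osc (- (c * alpha + s * omega)) (- (s * alpha - c * omega)) x).
Proof.
have dl (k : R) : is_derive x (1 : R) (fun x : R => k * (m - x)) (- k).
  by apply: is_derive_eq; rewrite /GRing.scale/=; ring.
have de := @is_derive1_comp R (@expR R) (fun x => alpha * (m - x)) x _ _ (is_derive_expR _) (dl alpha).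
have dc := @is_derive1_comp R (@cos R) (fun x => omega * (m - x)) x _ _ (is_derive_cos _) (dl omega).
have ds := @is_derive1_comp R (@sin R) (fun x => omega * (m - x)) x _ _ (is_derive_sin _) (dl omega).
rewrite /damped_osc; apply: is_derive_eq.
by rewrite /GRing.scale/=; ring.
Qed.

Lemma continuous_damped_osc c s : continuous (damped_osc c s : R -> R).
Proof.
move=> x; apply: differentiable_continuous; apply/derivable1_diffP.
by case: (is_derive_damped_osc c s x).
Qed.

Lemma measurable_damped_osc c s : measurable_fun setT (damped_osc c s : R -> R).
Proof. exact: (continuous_measurable_fun (@continuous_damped_osc c s)). Qed.

Lemma damped_osc_le c s x : `|damped_osc c s x| <= (`|c| + `|s|) * expR (alpha * (m - x)).
Proof.
rewrite normrM (ger0_norm (expR_ge0 _)) mulrC ler_wpM2r ?expR_ge0//.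
apply: le_trans (ler_normD _ _) _; rewrite !normrM lerD//.
  by rewrite ler_piMr// cos_max.
by rewrite ler_piMr// sin_max.
Qed.

End damped_oscillation.

Section damped_integral.
Context (R : realType).
Variables (m alpha omega : R).
Hypothesis alpha0 : alpha < 0.
Notation leb := (@lebesgue_measure R).
Notation half_line := (`]-oo, m]%classic : set R).
Let shell n : set R := `[m - n.+1%:R, m]%classic.

Let mshell n : measurable (shell n : set (measurableTypeR R)).
Proof. exact: measurable_itv. Qed.
Let mhalf : measurable (half_line : set (measurableTypeR R)).
Proof. exact: measurable_itv. Qed.
Let shellS n : shell n `<=` half_line.
Proof. by move=> x; rewrite /shell/= !in_itv/= => /andP[]. Qed.
Let mlt n : m - n.+1%:R < m. Proof. by rewrite ltrBlDr ltrDl ltr0n. Qed.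
Let half_shell x : half_line x -> exists n, shell n x.
Proof.
rewrite /= in_itv/= => xm; exists (Num.truncn (m - x)); rewrite /shell/= in_itv/= xm andbT.
by rewrite lerBlDr -lerBlDl; apply/ltW/truncnS_gt.
Qed.
Let shell_nd i j : (i <= j)%N -> shell i `<=` shell j.
Proof.
move=> ij x; rewrite /shell/= !in_itv/= => /andP[h ->]; rewrite andbT; apply: le_trans h.
by rewrite lerB// ler_nat.
Qed.

(** The integrand is the derivative of [damped_osc] with coefficients c and s, whose value at m is
    c. The frequency is left free, since [exp_integrable] takes it to be 0. *)
Let integral_shell om c s n : (\int[leb]_(x in shell n)
    (damped_osc m alpha om (- (c * alpha + s * om)) (- (s * alpha - c * om)) x)%:E =
  (c - damped_osc m alpha om c s (m - n.+1%:R))%:E)%E.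
Proof.
rewrite (FTC2_is_derive (mlt n) (@continuous_damped_osc R m alpha om _ _) (@is_derive_damped_osc R m alpha om c s)).
by rewrite {1}/damped_osc subrr !mulr0 expR0 cos0 sin0 mulr0 mulr1 addr0 mul1r.
Qed.

Let exp_integrable : leb.-integrable setT
  (EFin \o (fun x : R => expR (alpha * (m - x)) * \1_half_line x)).
Proof.
(* The exponential is the derivative of -1/alpha times itself: frequency 0, c = -1/alpha and s =
   0. *)
have eE x : expR (alpha * (m - x)) = damped_osc m alpha 0
    (- (- alpha^-1 * alpha + 0 * 0)) (- (0 * alpha - - alpha^-1 * 0)) x.
  have -> : - (- alpha^-1 * alpha + 0 * 0) = 1 by rewrite mulNr mulVf ?lt_eqF// mulr0 addr0 opprK.
  have -> : - (0 * alpha - - alpha^-1 * 0) = 0 by rewrite mul0r mulr0 subr0 oppr0.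
  by rewrite /damped_osc !mul0r cos0 mulr1 addr0 mulr1.
have me : measurable_fun setT (fun x : R => expR (alpha * (m - x))).
  by rewrite (funext eE); exact: measurable_damped_osc.
apply/integrableP; split.
  by apply/measurable_EFinP; apply: measurable_funM => //; exact: measurable_indic.
rewrite [X in (X < _)%E](_ : _ = \int[leb]_(x in half_line) (expR (alpha * (m - x)))%:E)%E; last first.
  rewrite [RHS]integral_mkcond; apply: eq_integral => x _.
  rewrite patchE /= indicE; case: (_ \in _); last by rewrite mulr0 normr0.
  by rewrite mulr1 ger0_norm ?expR_ge0.
have c := @ge0_cvg_integral_nd _ _ R leb shell half_line _ mshell mhalf shell_nd shellS half_shell
  me (fun x => expR_ge0 _).
rewrite -(cvg_lim _ c)//; apply: (@le_lt_trans _ _ (- alpha^-1)%:E); last exact: ltry.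
apply: lime_le; first by apply/cvg_ex; eexists; exact: c.
apply: nearW => n; under eq_integral do rewrite eE.
rewrite integral_shell lee_fin lerBlDr lerDl /damped_osc !mul0r cos0 mulr1 addr0.
by rewrite mulr_ge0 ?expR_ge0// oppr_ge0 invr_le0 ltW.
Qed.

Lemma damped_osc_integrable c s : leb.-integrable setT
  (EFin \o (fun x : R => damped_osc m alpha omega c s x * \1_half_line x)).
Proof.
have := integrableZl measurableT (`|c| + `|s|) exp_integrable; apply: le_integrable => //.
  apply/measurable_EFinP; apply: measurable_funM; first exact: measurable_damped_osc.
  exact: measurable_indic.
move=> x _; rewrite /= lee_fin [X in _ <= `|X|]mulrA !(normrM _ (\1_half_line x)) ler_wpM2r//.
by rewrite [leRHS]ger0_norm ?mulr_ge0 ?addr_ge0 ?expR_ge0//; exact: damped_osc_le.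
Qed.

Let osc_tail c s : damped_osc m alpha omega c s (m - n.+1%:R) @[n --> \oo] --> 0.
Proof.
have e1 : `|expR alpha| < 1 by rewrite ger0_norm ?expR_ge0// -expR0 ltr_expR.
have h : (`|c| + `|s|) * expR alpha ^+ n @[n --> \oo] --> 0.
  rewrite -[X in _ --> X](mulr0 (`|c| + `|s|)); apply: cvgM; [exact: cvg_cst|exact: cvg_expr].
apply: norm_cvg0; apply: (@squeeze_cvgr _ _ _ _ (cst 0) _ _ _ _ _ h); last exact: cvg_cst.
apply: nearW => n; rewrite normr_ge0/=; apply: le_trans (damped_osc_le _ _ _ _ _ _) _.
rewrite subKr ler_wpM2l ?addr_ge0// -expRM_natr ler_expR.
by rewrite ler_nM2l// ler_nat.
Qed.

(** The primitive tends to 0 at minus infinity, as alpha < 0, and equals c at m. *)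
Lemma damped_osc_Rintegral c s : \int[leb]_x
    (damped_osc m alpha omega (- (c * alpha + s * omega)) (- (s * alpha - c * omega)) x *
     \1_half_line x) = c.
Proof.
set f := damped_osc m alpha omega _ _.
have mf : measurable_fun setT (f : R -> R) by exact: measurable_damped_osc.
have fi : leb.-integrable setT (EFin \o (fun x => f x * \1_half_line x)).
  exact: damped_osc_integrable.
have h : (\int[leb]_x (f x * \1_(shell n) x)%:E @[n --> \oo] -->
    \int[leb]_x (f x * \1_half_line x)%:E)%E.
  have [||||_ _ h] := @dominated_convergence _ _ R leb setT measurableT
    (fun n => EFin \o (fun x => f x * \1_(shell n) x))
    (EFin \o (fun x => f x * \1_half_line x)) _ _ _ _ (integrable_abse fi).
  - move=> n; apply/measurable_EFinP; apply: measurable_funM => //; exact: measurable_indic.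
  - by apply/measurable_EFinP; apply: measurable_funM => //; exact: measurable_indic.
  - apply: nearW => x _ /=; apply: cvg_near_cst.
    have [xm|xm] := pselect (half_line x).
      have [n nx] := half_shell xm; exists n => // k /= nk.
      by rewrite !indicE !mem_set//; exact: shell_nd nk _ nx.
    apply: nearW => n; by rewrite !indicE !memNset// => /shellS.
  - apply: nearW => x n _ /=; rewrite lee_fin !normrM ler_wpM2l// !indicE.
    case: (boolP (x \in shell n)) => [/set_mem/shellS/mem_set ->//|_].
    by rewrite normr0.
  exact: h.
have E n : (\int[leb]_x (f x * \1_(shell n) x)%:E = (c - damped_osc m alpha omega c s (m - n.+1%:R))%:E)%E.
  rewrite -integral_shell [RHS]integral_mkcond; apply: eq_integral => x _.
  by rewrite patchE indicE; case: (_ \in _); rewrite ?mulr1 ?mulr0.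
have h' : (c - damped_osc m alpha omega c s (m - n.+1%:R))%:E @[n --> \oo] --> c%:E.
  apply: cvg_EFin; first exact: nearW.
  rewrite -[X in _ --> X]subr0; apply: cvgB; [exact: cvg_cst|exact: osc_tail].
rewrite /Rintegral -(cvg_lim _ h)//.
under eq_fun do rewrite E.
by rewrite (cvg_lim _ h').
Qed.

End damped_integral.

Local Open Scope complex_scope.

(** * Complex-valued integrals *)

Section complex_integral.
Context d (T : measurableType d) (R : realType) (mu : {measure set T -> \bar R}).
Implicit Types (F G : T -> R[i]) (u v : R[i]).

(** Integrability of both parts is bundled with the value, so that sums, multiples and products
    carry no side conditions. *)
Definition cint F v := [/\ mu.-integrable setT (EFin \o (fun x => complex.Re (F x))),
  mu.-integrable setT (EFin \o (fun x => complex.Im (F x))),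
  \int[mu]_x complex.Re (F x) = complex.Re v & \int[mu]_x complex.Im (F x) = complex.Im v].

Lemma ReD (z w : R[i]) : complex.Re (z + w) = complex.Re z + complex.Re w.
Proof. by case: z w => [? ?] []. Qed.

Lemma ImD (z w : R[i]) : complex.Im (z + w) = complex.Im z + complex.Im w.
Proof. by case: z w => [? ?] []. Qed.

Lemma ReM (z w : R[i]) :
  complex.Re (z * w) = complex.Re z * complex.Re w - complex.Im z * complex.Im w.
Proof. by case: z w => [? ?] []. Qed.

Lemma ImM (z w : R[i]) :
  complex.Im (z * w) = complex.Re z * complex.Im w + complex.Im z * complex.Re w.
Proof. by case: z w => [? ?] [? ?] /=; rewrite addrC. Qed.

Lemma cint0 : cint (fun=> 0) 0.
Proof.
by split; rewrite ?Rintegral_cst ?mul0r// (_ : _ \o _ = cst 0%E)//; exact: integrable0.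
Qed.

Lemma cintD F G u v : cint F u -> cint G v -> cint (fun x => F x + G x) (u + v).
Proof.
move=> [iF jF FE FE'] [iG jG GE GE']; split.
- rewrite (_ : (fun x => _) = (fun x => complex.Re (F x) + complex.Re (G x))).
    exact: (integrableD measurableT iF iG).
  by apply/funext => x; rewrite ReD.
- rewrite (_ : (fun x => _) = (fun x => complex.Im (F x) + complex.Im (G x))).
    exact: (integrableD measurableT jF jG).
  by apply/funext => x; rewrite ImD.
- by under eq_Rintegral do rewrite ReD; rewrite RintegralD// FE GE ReD.
- by under eq_Rintegral do rewrite ImD; rewrite RintegralD// FE' GE' ImD.
Qed.

Lemma cint_sum (I : Type) (s : seq I) (F : I -> T -> R[i]) (v : I -> R[i]) :
  (forall i, cint (F i) (v i)) -> cint (fun x => \sum_(i <- s) F i x) (\sum_(i <- s) v i).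
Proof.
move=> h; elim: s => [|i s ih].
  by under [X in cint X]eq_fun do rewrite big_nil; rewrite big_nil; exact: cint0.
by under [X in cint X]eq_fun do rewrite big_cons; rewrite big_cons; exact: cintD.
Qed.

Lemma cintZ z F v : cint F v -> cint (fun x => z * F x) (z * v).
Proof.
move=> [iF jF FE FE'].
have iZ (a : R) := integrableZl measurableT a iF; have jZ (a : R) := integrableZl measurableT a jF.
split.
- rewrite (_ : (fun x => _) = (fun x => complex.Re z * complex.Re (F x) - complex.Im z * complex.Im (F x))).
    exact: (integrableB measurableT (iZ _) (jZ _)).
  by apply/funext => x; rewrite ReM.
- rewrite (_ : (fun x => _) = (fun x => complex.Re z * complex.Im (F x) + complex.Im z * complex.Re (F x))).
    exact: (integrableD measurableT (jZ _) (iZ _)).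
  by apply/funext => x; rewrite ImM.
- under eq_Rintegral do rewrite ReM.
  by rewrite RintegralB ?RintegralZl// ?FE ?FE' ?ReM//; [exact: iZ|exact: jZ].
- under eq_Rintegral do rewrite ImM.
  by rewrite RintegralD ?RintegralZl// ?FE ?FE' ?ImM//; [exact: jZ|exact: iZ].
Qed.

End complex_integral.

Lemma cint_prod d1 d2 (T1 : measurableType d1) (T2 : measurableType d2) (R : realType)
    (m1 : {sigma_finite_measure set T1 -> \bar R}) (m2 : {sigma_finite_measure set T2 -> \bar R})
    (F : T1 -> R[i]) (G : T2 -> R[i]) u v :
  cint m1 F u -> cint m2 G v -> cint (m1 \x m2)%E (fun x => F x.1 * G x.2) (u * v).
Proof.
move=> [iF jF FE FE'] [iG jG GE GE'].
have i1 := prod_integrable iF iG; have i2 := prod_integrable jF jG.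
have i3 := prod_integrable iF jG; have i4 := prod_integrable jF iG.
have e1 := prod_Rintegral iF iG; have e2 := prod_Rintegral jF jG.
have e3 := prod_Rintegral iF jG; have e4 := prod_Rintegral jF iG.
split.
- rewrite (_ : (fun x => _) = (fun x => complex.Re (F x.1) * complex.Re (G x.2) - complex.Im (F x.1) * complex.Im (G x.2))).
    exact: (integrableB measurableT i1 i2).
  by apply/funext => x; rewrite ReM.
- rewrite (_ : (fun x => _) = (fun x => complex.Re (F x.1) * complex.Im (G x.2) + complex.Im (F x.1) * complex.Re (G x.2))).
    exact: (integrableD measurableT i3 i4).
  by apply/funext => x; rewrite ImM.
- under eq_Rintegral do rewrite ReM.
  by rewrite RintegralB// e1 e2 FE GE FE' GE' ReM.
- under eq_Rintegral do rewrite ImM.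
  by rewrite RintegralD// e3 e4 FE GE FE' GE' ImM.
Qed.

Lemma cint_Leb2 (R : realType) (F : R * R -> R[i]) v :
  cint (@lebesgue_measure R \x @lebesgue_measure R)%E F v -> cint (@Leb2 R) F v.
Proof.
move=> [iF jF FE FE']; split; [exact: integrable_Leb2..| |].
  by rewrite -FE /Rintegral integral_Leb2.
by rewrite -FE' /Rintegral integral_Leb2.
Qed.

(** * Correlation of two complex exponentials *)

Section exponential_correlation.
Context (R : realType).
Notation leb := (@lebesgue_measure R).
Implicit Types (z w lambda mu : R[i]) (a b m : R).

Lemma expCD z w : expC (z + w) = expC z * expC w.
Proof.
case: z w => [a b] [c d]; rewrite /expC /= expRD cosD sinD.
by apply/eqP; rewrite eq_complex/=; apply/andP; split; apply/eqP; ring.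
Qed.

Lemma expC0 : expC (0 : R[i]) = 1.
Proof. by rewrite /expC /= expR0 cos0 sin0 mulr1 mulr0. Qed.

Lemma cint_expC z m : complex.Re z < 0 ->
  cint leb (fun x : R => if x <= m then expC (z * (m - x)%:C) else 0) (- z^-1).
Proof.
case: z => [alpha omega] /= alpha0.
pose D := alpha ^+ 2 + omega ^+ 2.
have D0 : D != 0 by rewrite gt_eqF// ltr_wpDr ?sqr_ge0// exprn_even_gt0//= lt_eqF.
have half x : (if x <= m then 1 else 0) = \1_(`]-oo, m]%classic : set R) x :> R.
  rewrite indicE; case: (boolP (x <= m)) => xm; first by rewrite mem_set//= in_itv.
  by rewrite memNset//= in_itv/=; exact/negP.
have ReE (x : R) : complex.Re (if x <= m then expC ((alpha +i* omega) * (m - x)%:C) else 0) =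
    damped_osc m alpha omega 1 0 x * \1_(`]-oo, m]%classic : set R) x.
  rewrite -half; case: ifP => _; last by rewrite mulr0.
  by rewrite /damped_osc /= !mulr0 mul0r subr0 add0r mulr1 addr0 mul1r.
have ImE (x : R) : complex.Im (if x <= m then expC ((alpha +i* omega) * (m - x)%:C) else 0) =
    damped_osc m alpha omega 0 1 x * \1_(`]-oo, m]%classic : set R) x.
  rewrite -half; case: ifP => _; last by rewrite mulr0.
  by rewrite /damped_osc /= !mulr0 mul0r subr0 !add0r mulr1 mul1r.
(* The coefficients of the primitives solve a linear system in two unknowns; their first entries,
   -alpha/D and omega/D, are the real and imaginary parts of -1/z. *)
have cE1 : - (- (alpha / D) * alpha + - (omega / D) * omega) = 1.
  by rewrite /D in D0 *; field.
have cE2 : - (- (omega / D) * alpha - - (alpha / D) * omega) = 0 by ring.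
have cE3 : - (omega / D * alpha + - (alpha / D) * omega) = 0 by ring.
have cE4 : - (- (alpha / D) * alpha - omega / D * omega) = 1.
  by rewrite /D in D0 *; field.
split.
- by rewrite (funext ReE); exact: damped_osc_integrable.
- by rewrite (funext ImE); exact: damped_osc_integrable.
- rewrite (funext ReE); have := damped_osc_Rintegral m omega alpha0 (- (alpha / D)) (- (omega / D)).
  by rewrite cE1 cE2 => ->.
- rewrite (funext ImE); have := damped_osc_Rintegral m omega alpha0 (omega / D) (- (alpha / D)).
  by rewrite cE3 cE4 => -> /=; rewrite opprK.
Qed.

(* The integral of e^{lambda (a - s)} e^{mu (b - s)} over s <= min a b. *)
Definition exp_corr lambda mu a b : R[i] :=
  expC (lambda * (a - Num.min a b)%:C) * expC (mu * (b - Num.min a b)%:C) * - (lambda + mu)^-1.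

Lemma cint_exp_corr lambda mu a b : complex.Re lambda < 0 -> complex.Re mu < 0 ->
  cint leb (fun x : R => (if 0 <= a - x then expC (lambda * (a - x)%:C) else 0) *
    (if 0 <= b - x then expC (mu * (b - x)%:C) else 0)) (exp_corr lambda mu a b).
Proof.
move=> l0 m0; set m := Num.min a b.
have lm0 : complex.Re (lambda + mu) < 0 by rewrite ReD; lra.
have := cintZ (expC (lambda * (a - m)%:C) * expC (mu * (b - m)%:C)) (cint_expC m lm0).
rewrite /exp_corr -/m; congr (cint _ _ _); apply/funext => x.
rewrite !subr_ge0 /m le_min -/m.
case: (x <= a); case: (x <= b); rewrite /= ?mulr0 ?mul0r//.
rewrite -!expCD; congr expC.
have e (t : R) : (t - x)%:C = (t - m)%:C + (m - x)%:C by rewrite -rmorphD/=; congr (_%:C); ring.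
by rewrite (e a) (e b); ring.
Qed.

End exponential_correlation.

(** Renames the two indices of one coordinate, as is needed when the exponential of the second
    factor survives there. *)
Lemma exchange_big13 (V : nmodType) (I J K : finType) (G : I -> J -> K -> V) :
  \sum_i \sum_j \sum_k G i j k = \sum_k \sum_j \sum_i G i j k.
Proof.
under eq_bigr do rewrite exchange_big.
by rewrite exchange_big; apply: eq_bigr => k _; exact: exchange_big.
Qed.

(** * Correlations of a kernel that is a sum of exponentials *)

Section exponential_kernel.
Context (R : realType) (p : nat).
Variables (lambda1 lambda2 : 'I_p -> R[i]) (d : 'I_p -> 'I_p -> R[i]).
Hypotheses (Re1 : forall i, complex.Re (lambda1 i) < 0) (Re2 : forall i, complex.Re (lambda2 i) < 0).
Variable g : R * R -> R.
Hypothesis hg : forall s, (g s)%:C = if (0 <= s.1) && (0 <= s.2) then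
  \sum_(i1 < p) \sum_(i2 < p)
    d i1 i2 * expC (lambda1 i1 * (s.1)%:C) * expC (lambda2 i2 * (s.2)%:C) else 0.
Notation leb := (@Leb2 R).
Implicit Types t r s : R * R.

Let e (z : R[i]) (u : R) : R[i] := if 0 <= u then expC (z * u%:C) else 0.
Let G t s := g (t.1 - s.1, t.2 - s.2).

Let gE s : (g s)%:C = \sum_(i1 < p) \sum_(i2 < p) d i1 i2 * (e (lambda1 i1) s.1 * e (lambda2 i2) s.2).
Proof.
rewrite hg /e; case: (0 <= s.1); case: (0 <= s.2) => /=; last 3 first.
- by rewrite big1// => i1 _; rewrite big1// => i2 _; rewrite mulr0 mulr0.
- by rewrite big1// => i1 _; rewrite big1// => i2 _; rewrite mul0r mulr0.
- by rewrite big1// => i1 _; rewrite big1// => i2 _; rewrite mulr0 mulr0.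
by apply: eq_bigr => i1 _; apply: eq_bigr => i2 _; rewrite mulrA.
Qed.

Let cint_e z (a : R) : complex.Re z < 0 ->
  cint (@lebesgue_measure R) (fun x : R => e z (a - x)) (- z^-1).
Proof.
move=> z0; have := cint_expC a z0; congr (cint _ _ _); apply/funext => x.
by rewrite /e subr_ge0.
Qed.

Lemma exp_kernel_integrable t : leb.-integrable setT (EFin \o G t).
Proof.
have : cint leb (fun s => (G t s)%:C) (\sum_(i1 < p) \sum_(i2 < p) d i1 i2 *
    (- (lambda1 i1)^-1 * - (lambda2 i2)^-1)).
  rewrite (_ : (fun s => _) = (fun s => \sum_(i1 < p) \sum_(i2 < p) d i1 i2 *
      (e (lambda1 i1) (t.1 - s.1) * e (lambda2 i2) (t.2 - s.2)))).
    apply: cint_sum => i1; apply: cint_sum => i2; apply: cintZ; apply: cint_Leb2.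
    by apply: (cint_prod (cint_e t.1 (Re1 i1)) (cint_e t.2 (Re2 i2))).
  by apply/funext => s; rewrite gE.
by case.
Qed.

Definition exp_kernel_corr t r : R[i] :=
  \sum_(i1 < p) \sum_(i2 < p) \sum_(j1 < p) \sum_(j2 < p) d i1 i2 * d j1 j2 *
    (exp_corr (lambda1 i1) (lambda1 j1) t.1 r.1 * exp_corr (lambda2 i2) (lambda2 j2) t.2 r.2).

Let cint_GG t r : cint leb (fun s => (G t s * G r s)%:C) (exp_kernel_corr t r).
Proof.
rewrite (_ : (fun s => _) = (fun s => \sum_(i1 < p) \sum_(i2 < p) \sum_(j1 < p) \sum_(j2 < p)
    d i1 i2 * d j1 j2 * ((e (lambda1 i1) (t.1 - s.1) * e (lambda1 j1) (r.1 - s.1)) *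
      (e (lambda2 i2) (t.2 - s.2) * e (lambda2 j2) (r.2 - s.2))))).
  apply: cint_sum => i1; apply: cint_sum => i2; apply: cint_sum => j1; apply: cint_sum => j2.
  apply: cintZ; apply: cint_Leb2.
  exact: (cint_prod (cint_exp_corr t.1 r.1 (Re1 i1) (Re1 j1)) (cint_exp_corr t.2 r.2 (Re2 i2) (Re2 j2))).
apply/funext => s; rewrite rmorphM/= !gE/= mulr_suml; apply: eq_bigr => i1 _.
rewrite mulr_suml; apply: eq_bigr => i2 _; rewrite mulr_sumr; apply: eq_bigr => j1 _.
rewrite mulr_sumr; apply: eq_bigr => j2 _; ring.
Qed.

Lemma exp_kernel_Lfun2 t : G t \in Lfun leb 2%:E.
Proof.
apply/Lfun2P; split; first by have /measurable_int/measurable_EFinP := exp_kernel_integrable t.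
by have [iG _ _ _] := cint_GG t t; have := integrable_lty measurableT iG.
Qed.

Lemma exp_kernel_ip t r : (ip leb (G t) (G r))%:C = exp_kernel_corr t r.
Proof.
have [_ _ GE GE'] := cint_GG t r.
apply/eqP; rewrite eq_complex/=; apply/andP; split; apply/eqP.
  by rewrite -GE.
by rewrite -GE' Rintegral_cst// mul0r.
Qed.

Lemma exp_corr_ge0 (z w : R[i]) (a t : R) : 0 <= t ->
  exp_corr z w (a + t) a = - (z + w)^-1 * expC (z * `|t|%:C).
Proof.
move=> t0; rewrite /exp_corr min_r ?lerDl// subrr (_ : 0%:C = 0)// mulr0 expC0 mulr1.
by rewrite ger0_norm// mulrC; congr (_ * expC (_ * _%:C)); ring.
Qed.

Lemma exp_corr_le0 (z w : R[i]) (a t : R) : t <= 0 ->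
  exp_corr z w (a + t) a = - (z + w)^-1 * expC (w * `|t|%:C).
Proof.
move=> t0; rewrite /exp_corr min_l ?gerDl// subrr (_ : 0%:C = 0)// mulr0 expC0 mul1r.
by rewrite ler0_norm// mulrC; congr (_ * expC (_ * _%:C)); ring.
Qed.

Let E1 i (u : R) := expC (lambda1 i * `|u|%:C).
Let E2 i (u : R) := expC (lambda2 i * `|u|%:C).

Definition acov_same t := \sum_(i1 < p) \sum_(i2 < p)
  coef_same d lambda1 lambda2 i1 i2 * E1 i1 t.1 * E2 i2 t.2.
Definition acov_opposite t := \sum_(i1 < p) \sum_(i2 < p)
  coef_opposite d lambda1 lambda2 i1 i2 * E1 i1 t.1 * E2 i2 t.2.

(** The minus signs of the two one-dimensional integrals cancel, which leaves the coefficients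
    without a sign. *)
Let inv_mul (a b x y : R[i]) : - (a + b)^-1 * - (x + y)^-1 = ((b + a) * (y + x))^-1.
Proof. by rewrite invfM mulrNN (addrC a) (addrC x). Qed.

Lemma exp_kernel_corr_pp t r : 0 <= t.1 -> 0 <= t.2 ->
  exp_kernel_corr (r.1 + t.1, r.2 + t.2) r = acov_same t.
Proof.
move=> t1 t2; apply: eq_bigr => i1 _; apply: eq_bigr => i2 _.
rewrite /coef_same !mulr_suml; apply: eq_bigr => j1 _; rewrite !mulr_suml.
apply: eq_bigr => j2 _; rewrite !exp_corr_ge0// -inv_mul /E1 /E2; ring.
Qed.

(** Both surviving exponentials belong to the second factor. Exchanging i and j in both coordinates
    leaves the product of the two coefficients d invariant, so that the coefficients for nonnegative
    coordinates reappear. *)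
Lemma exp_kernel_corr_nn t r : t.1 <= 0 -> t.2 <= 0 ->
  exp_kernel_corr (r.1 + t.1, r.2 + t.2) r = acov_same t.
Proof.
move=> t1 t2; rewrite /exp_kernel_corr exchange_big13; apply: eq_bigr => i1 _.
rewrite exchange_big13; apply: eq_bigr => i2 _.
rewrite /coef_same !mulr_suml; apply: eq_bigr => j1 _; rewrite !mulr_suml.
apply: eq_bigr => j2 _; rewrite !exp_corr_le0// -inv_mul (addrC (lambda1 j1)) (addrC (lambda2 j2)) /E1 /E2; ring.
Qed.

(** The surviving exponentials belong to different factors. Exchanging i and j in the second
    coordinate only turns d i1 i2 * d j1 j2 into d i1 j2 * d j1 i2. *)
Lemma exp_kernel_corr_pn t r : 0 <= t.1 -> t.2 <= 0 ->
  exp_kernel_corr (r.1 + t.1, r.2 + t.2) r = acov_opposite t.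
Proof.
move=> t1 t2; apply: eq_bigr => i1 _; rewrite exchange_big13; apply: eq_bigr => i2 _.
rewrite /coef_opposite !mulr_suml; apply: eq_bigr => j1 _; rewrite !mulr_suml.
apply: eq_bigr => j2 _; rewrite exp_corr_ge0// exp_corr_le0// -inv_mul (addrC (lambda2 j2)) /E1 /E2; ring.
Qed.

Lemma exp_kernel_corr_np t r : t.1 <= 0 -> 0 <= t.2 ->
  exp_kernel_corr (r.1 + t.1, r.2 + t.2) r = acov_opposite t.
Proof.
move=> t1 t2; rewrite /exp_kernel_corr exchange_big13; apply: eq_bigr => i1 _; apply: eq_bigr => i2 _.
rewrite /coef_opposite !mulr_suml; apply: eq_bigr => j1 _; rewrite !mulr_suml.
apply: eq_bigr => j2 _; rewrite exp_corr_le0// exp_corr_ge0// -inv_mul (addrC (lambda1 j1)) /E1 /E2; ring.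
Qed.

End exponential_kernel.

(** * Eigenvalues of the two classes of fields *)

Lemma companion_root (R : realType) (p : nat) (a : {poly R}) (A : 'M[R]_p) z :
  is_companion a A -> complex_eigenvalue A z -> root (map_poly (real_complex R) a) z.
Proof.
move=> [am [e ->]]; subst p; rewrite castmx_id /complex_eigenvalue eigenvalue_root_char.
by rewrite -map_char_poly companionmxK.
Qed.

Lemma eigenvalue_Re_lt0 d (T : measurableType d) (R : realType) (P : probability T R)
    (p q : nat) (A1 A2 : 'M[R]_p) (b c : 'cV[R]_p) (beta sigma : R)
    (nu : {measure set R -> \bar R}) (Lambda : set (R * R) -> {RV P >-> R})
    (Y : R * R -> {RV P >-> R}) :
  causal_carma q A1 A2 b c beta sigma nu Lambda Y \/
    causal_gcarma A1 A2 b c beta sigma nu Lambda Y ->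
  [/\ forall z, complex_eigenvalue A1 z -> complex.Re z < 0,
      forall z, complex_eigenvalue A2 z -> complex.Re z < 0,
      homogeneous_levy_basis beta sigma nu Lambda &
      carma_equations A1 A2 b c Lambda Y].
Proof.
case=> [[_ _ _ [a1 [a2 [A1E A2E a1P a2P]]] [hL _ hY]]|[_ hA hL _ hY]]; split => //.
- by move=> z /(companion_root A1E); exact: a1P.
- by move=> z /(companion_root A2E); exact: a2P.
- by move=> z zA; apply: hA; left.
- by move=> z zA; apply: hA; right.
Qed.

(** * The autocovariance of the field *)

Unset Implicit Arguments.
Set Strict Implicit.

Theorem proposition4p3 (R : realType) (disp : measure_display)
  (Omega : measurableType disp) (P : probability Omega R)
  (hP : measure_is_complete P)
  (p q : nat) (A1 A2 : 'M[R]_p) (b c : 'cV[R]_p)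
  (beta sigma : R) (nu : {measure set R -> \bar R})
  (Lambda : set (R * R) -> {RV P >-> R})
  (Y : R * R -> {RV P >-> R})
  (hY : causal_carma q A1 A2 b c beta sigma nu Lambda Y \/
        causal_gcarma A1 A2 b c beta sigma nu Lambda Y)
  (hnu : finite_second_moment nu)
  (lambda1 lambda2 : 'I_p -> R[i])
  (hlambda1 : enum_distinct_eigenvalues A1 lambda1)
  (hlambda2 : enum_distinct_eigenvalues A2 lambda2)
  (d : 'I_p -> 'I_p -> R[i])
  (hg : forall s : R * R,
    (kernel_g A1 A2 b c s)%:C =
    if (0 <= s.1) && (0 <= s.2) then
      \sum_(i1 < p) \sum_(i2 < p)
        d i1 i2 * expC (lambda1 i1 * (s.1)%:C) * expC (lambda2 i2 * (s.2)%:C)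
    else 0) :
  exists gamma : R * R -> R,
    [/\ is_autocovariance Y gamma,
        forall t : R * R, 0 <= t.1 * t.2 ->
          (gamma t)%:C = (kappa2 sigma nu)%:C *
            \sum_(i1 < p) \sum_(i2 < p) coef_same d lambda1 lambda2 i1 i2 *
              expC (lambda1 i1 * `|t.1|%:C) * expC (lambda2 i2 * `|t.2|%:C),
        forall t : R * R, t.1 * t.2 < 0 ->
          (gamma t)%:C = (kappa2 sigma nu)%:C *
            \sum_(i1 < p) \sum_(i2 < p) coef_opposite d lambda1 lambda2 i1 i2 *
              expC (lambda1 i1 * `|t.1|%:C) * expC (lambda2 i2 * `|t.2|%:C) &
        exists dv : int * int -> R[i] -> R[i] -> R[i],
          (forall v : int * int,
             v.1 \in [:: 1; -1] -> v.2 \in [:: 1; -1] ->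
             forall t : R * R, 0 <= v.1%:~R * t.1 -> 0 <= v.2%:~R * t.2 ->
             (gamma t)%:C = (kappa2 sigma nu)%:C *
               \sum_(i1 < p) \sum_(i2 < p)
                 dv v (lambda1 i1) (lambda2 i2) *
                 expC (lambda1 i1 * `|t.1|%:C) *
                 expC (lambda2 i2 * `|t.2|%:C)) /\
          (forall i1 i2 : 'I_p,
             [/\ dv (1, 1) (lambda1 i1) (lambda2 i2) =
                   coef_same d lambda1 lambda2 i1 i2,
                 dv (-1, -1) (lambda1 i1) (lambda2 i2) =
                   coef_same d lambda1 lambda2 i1 i2,
                 dv (1, -1) (lambda1 i1) (lambda2 i2) =
                   coef_opposite d lambda1 lambda2 i1 i2 &
                 dv (-1, 1) (lambda1 i1) (lambda2 i2) =
                   coef_opposite d lambda1 lambda2 i1 i2])].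

Proof.
have [hA1 hA2 hL hE] := eigenvalue_Re_lt0 hY.
have [inj1 eig1] := hlambda1; have [inj2 eig2] := hlambda2.
have Re1 i : complex.Re (lambda1 i) < 0 by apply: hA1; apply/eig1; exists i.
have Re2 i : complex.Re (lambda2 i) < 0 by apply: hA2; apply/eig2; exists i.
have g1 t := exp_kernel_integrable Re1 Re2 hg t; have g2 t := exp_kernel_Lfun2 Re1 Re2 hg t.
have ipE t r := exp_kernel_ip Re1 Re2 hg t r.
have corr_pp := exp_kernel_corr_pp lambda1 lambda2 d; have corr_nn := exp_kernel_corr_nn lambda1 lambda2 d.
have corr_pn := exp_kernel_corr_pn lambda1 lambda2 d; have corr_np := exp_kernel_corr_np lambda1 lambda2 d.
pose k (t s : R * R) := kernel_g A1 A2 b c (t.1 - s.1, t.2 - s.2).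
(* The covariance with r at the origin; [0 + t.1] has the shape of the lemmas on [exp_kernel_corr]
   at r = (0, 0). *)
pose gamma (t : R * R) := kappa2 sigma nu * ip (@Leb2 R) (k (0 + t.1, 0 + t.2)) (k (0, 0)).
have gammaE t : (gamma t)%:C = (kappa2 sigma nu)%:C *
    exp_kernel_corr lambda1 lambda2 d (0 + t.1, 0 + t.2) (0, 0).
  by rewrite rmorphM/= ipE.
(* Stationarity is read off the closed formulas, in which r does not occur, rather than off
   translation invariance of Lebesgue measure. *)
have corr_shift t r : exp_kernel_corr lambda1 lambda2 d (r.1 + t.1, r.2 + t.2) r =
    exp_kernel_corr lambda1 lambda2 d (0 + t.1, 0 + t.2) (0, 0).
  case: (leP 0 t.1) => [t1|/ltW t1]; case: (leP 0 t.2) => [t2|/ltW t2].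
  - by rewrite corr_pp// -(corr_pp t (0, 0)).
  - by rewrite corr_pn// -(corr_pn t (0, 0)).
  - by rewrite corr_np// -(corr_np t (0, 0)).
  - by rewrite corr_nn// -(corr_nn t (0, 0)).
have gamma_pp t : 0 <= t.1 -> 0 <= t.2 -> (gamma t)%:C = (kappa2 sigma nu)%:C * acov_same lambda1 lambda2 d t.
  by move=> t1 t2; rewrite gammaE (corr_pp t (0, 0)).
have gamma_nn t : t.1 <= 0 -> t.2 <= 0 -> (gamma t)%:C = (kappa2 sigma nu)%:C * acov_same lambda1 lambda2 d t.
  by move=> t1 t2; rewrite gammaE (corr_nn t (0, 0)).
have gamma_pn t : 0 <= t.1 -> t.2 <= 0 -> (gamma t)%:C = (kappa2 sigma nu)%:C * acov_opposite lambda1 lambda2 d t.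
  by move=> t1 t2; rewrite gammaE (corr_pn t (0, 0)).
have gamma_np t : t.1 <= 0 -> 0 <= t.2 -> (gamma t)%:C = (kappa2 sigma nu)%:C * acov_opposite lambda1 lambda2 d t.
  by move=> t1 t2; rewrite gammaE (corr_np t (0, 0)).
exists gamma; split.
- split=> [t|r t]; first exact: (carma_Lfun2 hL hnu hE g2 g1).
  have e : ip (@Leb2 R) (k (r.1 + t.1, r.2 + t.2)) (k r) =
      ip (@Leb2 R) (k (0 + t.1, 0 + t.2)) (k (0, 0)).
    apply: (fmorph_inj (real_complex R)).
    exact: etrans (ipE _ _) (etrans (corr_shift t r) (esym (ipE _ _))).
  exact: etrans (carma_covariance hL hnu hE g2 g1 _ _) (congr1 (fun x => (kappa2 sigma nu * x)%:E) e).
- move=> t t12; case: (leP 0 t.1) => t1; case: (leP 0 t.2) => t2.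
  + exact: gamma_pp.
  (* A point on an axis: 0 <= t.1, t.2 < 0 and a nonnegative product force t.1 = 0, so that the case
     of two nonpositive coordinates applies. *)
  + apply: gamma_nn; last exact: ltW.
    by rewrite leNgt; apply/negP => t1'; move: t12; rewrite leNgt pmulr_rlt0 ?t2.
  + apply: gamma_nn; first exact: ltW.
    by rewrite leNgt; apply/negP => t2'; move: t12; rewrite leNgt pmulr_llt0 ?t1.
  + by apply: gamma_nn; exact: ltW.
- move=> t t12; case: (leP 0 t.1) => t1; case: (leP 0 t.2) => t2.
  + by move: t12; rewrite ltNge mulr_ge0.
  + by apply: gamma_pn => //; exact: ltW.
  + by apply: gamma_np => //; exact: ltW.
  + by move: t12; rewrite ltNge mulr_le0// ltW.
(* The coefficients have to be functions of the eigenvalues rather than of the indices; at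
   eigenvalues each sum has a single term, because the enumerations are injective. *)
exists (fun v z1 z2 => \sum_(i1 | lambda1 i1 == z1) \sum_(i2 | lambda2 i2 == z2)
  (if v.1 == v.2 then coef_same d lambda1 lambda2 i1 i2 else coef_opposite d lambda1 lambda2 i1 i2)).
have sumE (F : 'I_p -> 'I_p -> R[i]) i1 i2 :
    \sum_(j1 | lambda1 j1 == lambda1 i1) \sum_(j2 | lambda2 j2 == lambda2 i2) F j1 j2 = F i1 i2.
  rewrite (big_pred1 i1); last by move=> j; rewrite /= (inj_eq inj1).
  by rewrite (big_pred1 i2)// => j; rewrite /= (inj_eq inj2).
split; last by move=> i1 i2; split; rewrite sumE.
move=> [v1 v2] /=; rewrite !inE => /orP[]/eqP-> /orP[]/eqP-> t; rewrite ?mulrN1z ?mulN1r ?mul1r ?oppr_ge0 => t1 t2;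
  under eq_bigr do under eq_bigr do rewrite sumE.
- exact: gamma_pp.
- exact: gamma_pn.
- exact: gamma_np.
- exact: gamma_nn.
Qed.
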